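(* Let $\Omega$ be a domain in $\mathbb{H}$, including the open ball $B(z_0,R)$ for some $z_0\in\mathbb{C}$ and some $R>0$. If $f:\Omega\to\mathbb{H}$ is a $(1,3)$-regular function, then $$f(x)=\sum_{k\in\mathbb{N}}\sum_{|\mathbf{k}|=k}\mathcal{T}_{\mathbf{k}}(x-z_0)\,c_{\mathbf{k}},\qquad c_{\mathbf{k}}:=\frac{1}{\mathbf{k}!}\,\delta^{(0,\mathbf{k})}f(z_0)$$ for all $x\in B(z_0,R)$. Moreover, the series on the right-hand side converges absolutely and uniformly on compact sets in $B(z_0,R)$. Finally, $f$ is $(1,3)$-slice preserving if we make the following assumptions: $c_{\mathbf{k}}\in\mathbb{C}$ when $k_2=0$; $c_{\mathbf{k}}\in\mathbb{R}$ when either $k_1=0\neq k_2$ or $k_1\neq0,\ k_2\in2\mathbb{N}$; $c_{\mathbf{k}}=0$ when $k_1\neq0,\ k_2\in2\mathbb{N}+1$.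
   Context: $\mathbb{N}=\{0,1,2,\ldots\}$. $\mathbb{H}=\mathbb{R}+i\mathbb{R}+j\mathbb{R}+k\mathbb{R}$ is the algebra of real quaternions with its Euclidean norm $|x|=\sqrt{x\bar x}$ and variable $x=x_0+ix_1+jx_2+kx_3$; $B(z_0,R)=\{x\in\mathbb{H}:|x-z_0|<R\}$; $\mathbb{C}:=\mathbb{R}+i\mathbb{R}\subset\mathbb{H}$; $\mathbb{S}^1:=\{jb+kc: b,c\in\mathbb{R},\ b^2+c^2=1\}$. For $J\in\mathbb{S}^1$, $\mathbb{R}^{2+1}_J:=\mathrm{Span}_{\mathbb{R}}(1,i,J)$, with points written $x_0+ix_1+\beta J$ ($x_0,x_1,\beta\in\mathbb{R}$). For $V\subseteq\mathbb{R}^{2+1}_J$ open, a $C^1$ function $\phi:V\to\mathbb{H}$ is $J$-monogenic if $(\partial_{x_0}+i\partial_{x_1}+J\partial_\beta)\phi(x_0+ix_1+\beta J)\equiv0$ on $V$ (left multiplication). A domain $\Omega$ in $\mathbb{H}$ is a nonempty connected open subset; $\Omega_J:=\Omega\cap\mathbb{R}^{2+1}_J$ and, for $f:\Omega\to\mathbb{H}$, $f_J:=f|_{\Omega_J}$. The function $f$ is $(1,3)$-regular if $f_J$ is $J$-monogenic for every $J\in\mathbb{S}^1$. A $(1,3)$-regular $f:\Omega\to\mathbb{H}$ is $(1,3)$-slice preserving if $f(\Omega_J)\subseteq\mathbb{R}^{2+1}_J$ for all $J\in\mathbb{S}^1$. In the double series, the summation index $k$ is a natural number (not the quaternionic unit)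 and the inner sum runs over the $\mathbf{k}=(k_1,k_2)\in\mathbb{N}^2$ with $|\mathbf{k}|=k$; the assumptions on $c_{\mathbf{k}}$ are meant for all $\mathbf{k}=(k_1,k_2)\in\mathbb{N}^2$. For $\mathbf{k}=(k_1,k_2)\in\mathbb{Z}^2$, $|\mathbf{k}|:=k_1+k_2$, and for $\mathbf{k}\in\mathbb{N}^2$, $\mathbf{k}!:=k_1!\,k_2!$. The functions $\mathcal{T}_{\mathbf{k}}:\mathbb{H}\to\mathbb{H}$ are defined by: $\mathcal{T}_{\mathbf{k}}\equiv0$ if $k_1<0$ or $k_2<0$; $\mathcal{T}_{(0,0)}\equiv1$; and, for $\mathbf{k}\in\mathbb{N}^2\setminus\{(0,0)\}$, $$|\mathbf{k}|\,\mathcal{T}_{\mathbf{k}}(x):=k_1\mathcal{T}_{(k_1-1,k_2)}(x)\,(x_1-(-1)^{k_2}ix_0)+k_2\mathcal{T}_{(k_1,k_2-1)}(x)\,(x_0+jx_2+kx_3)\,,$$ where $k$ in $kx_3$ is the quaternionic unit. Writing $\partial_0=\partial_{x_0}$, $\partial_1=\partial_{x_1}$, with $i$ acting by left multiplication, for $t,k_1\in\mathbb{N}$: $\delta^{(0,k_1,2t)}:=\partial_1^{k_1}(\partial_0^2+\partial_1^2)^t$ and $\delta^{(0,k_1,2t+1)}:=\partial_1^{k_1}(\partial_0^2+\partial_1^2)^t(\partial_0+i\partial_1)$; and $\delta^{(0,\mathbf{k})}:=\delta^{(0,k_1,k_2)}$. These operators only involve derivatives in the directions of $\mathbb{C}$,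 so at $z_0\in\mathbb{C}$ they are computed on $f|_{\Omega\cap\mathbb{C}}$ (each $J$-monogenic function is real analytic, so these derivatives exist).
   Formalization: The final claim fails for domains with a disconnected Ω_J; it is proved for f restricted to B(z_0,R), and on all of Ω when every Ω_J is connected. Absolute convergence is that of the series over k of the blocks |k|=k. *)

(* Defs.v *)
From HB Require Import structures.
From mathcomp Require Import all_boot all_order all_algebra.
From mathcomp Require Import all_classical all_reals all_analysis.

Set Implicit Arguments.
Unset Strict Implicit.
Unset Printing Implicit Defensive.

Import Order.TTheory GRing.Theory Num.Theory.
Import numFieldNormedType.Exports.

Local Open Scope classical_set_scope.
Local Open Scope ring_scope.

(* Quaternions a + i b + j c + k d are the row vectors (a, b, c, d); the
   topology, scaling and derivatives are those of 'rV[R]_4. Its library norm is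
   the sup norm (equivalent to the Euclidean one), so the Euclidean norm used
   for balls and absolute convergence is the separate [qnorm]. *)
Notation quat R := 'rV[R]_4.

Section Quaternions.
Variable R : realType.
Implicit Types x y : quat R.

Definition mkq (a b c d : R) : quat R := \row_(l < 4) [:: a; b; c; d]`_l.

Definition q1 : quat R := mkq 1 0 0 0.
Definition qi : quat R := mkq 0 1 0 0.
Definition qj : quat R := mkq 0 0 1 0.
Definition qk : quat R := mkq 0 0 0 1.

Definition mulq x y : quat R :=
  let: (a, b, c, d) := (x 0 0, x 0 1, x 0 2, x 0 3) in
  let: (e, f, g, h) := (y 0 0, y 0 1, y 0 2, y 0 3) in
  mkq (a * e - b * f - c * g - d * h)
      (a * f + b * e + c * h - d * g)
      (a * g - b * h + c * e + d * f)
      (a * h + b * g - c * f + d * e).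

Definition qnorm x : R := Num.sqrt (\sum_(l < 4) x 0 l ^+ 2).

Definition qball (z : quat R) (r : R) : set (quat R) :=
  [set x | qnorm (x - z) < r].

Definition qreal : set (quat R) := [set x | exists a, x = a *: q1].

Definition qcomplex : set (quat R) :=
  [set x | exists a b, x = a *: q1 + b *: qi].

(* The circle S^1 inside Span(j, k). *)
Definition circ : set (quat R) :=
  [set J | exists b c, b ^+ 2 + c ^+ 2 = 1 /\ J = b *: qj + c *: qk].

Definition space3 (J : quat R) : set (quat R) :=
  [set x | exists a b beta, x = a *: q1 + b *: qi + beta *: J].

Definition qslice (Omega : set (quat R)) (J : quat R) : set (quat R) :=
  Omega `&` space3 J.

Definition qdomain (Omega : set (quat R)) : Prop :=
  [/\ Omega !=set0, open Omega & connected Omega].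

End Quaternions.

Arguments q1 {R}.
Arguments qi {R}.
Arguments qj {R}.
Arguments qk {R}.
Arguments qreal {R}.
Arguments qcomplex {R}.
Arguments circ {R}.

Notation "x *q y" := (mulq x y) (at level 40, left associativity).

Section Regularity.
Variable R : realType.
Implicit Types (f phi : quat R -> quat R) (V Omega : set (quat R)).

(* [V] is meant to be relatively open in [space3 J]. For x in such a [V], the
   derivatives along 1, i, J are d/dx0, d/dx1, d/dbeta of [phi] in the
   coordinates x0 + i x1 + beta J and depend only on [phi] restricted to [V],
   even though [phi] is total. The first two clauses say that [phi] is C^1. *)
Definition monogenic (J : quat R) V phi : Prop :=
  [/\ forall x v, V x -> v \in [:: q1; qi; J] -> derivable phi x v,
      forall v, v \in [:: q1; qi; J] -> {within V, continuous ('D_v phi)}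
    & forall x, V x ->
        'D_q1 phi x + qi *q 'D_qi phi x + J *q 'D_J phi x = 0].

Definition regular13 Omega f : Prop :=
  forall J, circ J -> monogenic J (qslice Omega J) f.

Definition slice_preserving13 Omega f : Prop :=
  regular13 Omega f /\
  forall J, circ J -> f @` (qslice Omega J) `<=` space3 J.

(* The functions T_(k1, k2); the [0] branches are the terms with a negative
   index. *)
Fixpoint fueterT (k1 : nat) : nat -> quat R -> quat R :=
  fix fueterT_k1 (k2 : nat) (x : quat R) : quat R :=
    if (k1 + k2 == 0)%N then q1 else
    (k1 + k2)%:R^-1 *:
      ((if k1 is k1'.+1 then
          k1%:R *: (fueterT k1' k2 x
                    *q (x 0 1 *: q1 - ((-1) ^+ k2 * x 0 0) *: qi))
        else 0)
     + (if k2 is k2'.+1 then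
          k2%:R *: (fueterT_k1 k2' x
                    *q (x 0 0 *: q1 + x 0 2 *: qj + x 0 3 *: qk))
        else 0)).

(* The operator d1^k1 (d0^2 + d1^2)^t (d0 + i d1)^e with k2 = 2 t + e,
   e in {0, 1}. At points of C it involves only the values of [f] on C. *)
Definition dbarC f : quat R -> quat R :=
  fun x => 'D_q1 f x + qi *q 'D_qi f x.

Definition laplC f : quat R -> quat R :=
  fun x => 'D_q1 ('D_q1 f) x + 'D_qi ('D_qi f) x.

Definition delta0 (k1 k2 : nat) f : quat R -> quat R :=
  iter k1 (fun g => 'D_qi g)
    (iter k2./2 laplC (if odd k2 then dbarC f else f)).

Definition coef13 f (z0 : quat R) (k1 k2 : nat) : quat R :=
  (k1`! * k2`!)%:R^-1 *: delta0 k1 k2 f z0.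

(* The inner sum over the pairs (k1, k2) with k1 + k2 = k. The summands of the
   outer series are these homogeneous blocks: absolute convergence of the
   ungrouped family indexed by (k1, k2) may fail in the ball. *)
Definition term13 f (z0 : quat R) (k : nat) (x : quat R) : quat R :=
  \sum_(k1 < k.+1) fueterT k1 (k - k1) (x - z0) *q coef13 f z0 k1 (k - k1).

End Regularity.

(* Main.v *)
Require Import Defs.
From HB Require Import structures.
From mathcomp Require Import all_boot all_order all_algebra.
From mathcomp Require Import all_classical all_reals all_analysis.
From mathcomp Require Import ring lra zify.

(** Rotations of H about C permute the three-dimensional slices, so a slice may be
    taken to be the span of 1, i, j. A monogenic function of (x0, x1, beta), made
    constant in a fourth variable, is a left Fueter-regular function in a
    four-dimensional ball. This reduces the local theory to Fueter's: in dimension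
    four the Cauchy kernel conj(z)/|z|^4 = z^-1 |z|^-2 is rational, and with
    q = y^-1 x its value at y - x is
    (1-q)^-1 conj(1-q)^-1 (1-q)^-1 y^-1 |y|^-2, a product of geometric series.

    The Cauchy formula is obtained with a positive linear functional [mean], an
    ultrafilter limit of Riemann sums. Integration by parts ([mean_deriv]) and
    invariance under translations ([mean_wt_translate]) suffice for the
    Cauchy-Pompeiu formula ([pompeiu]), and a cutoff gives the representation
    [cauchy_rep]. Expanding the kernel under the mean yields the power series of a
    regular function with geometric bounds up to the full radius
    ([regular_ball_expansion]).

    Such a series may be differentiated term by term ([hasexp_deriv]), so a
    monogenic function has a monogenic series. Euler's identity and the monogenic
    equation express its homogeneous part of degree k through the derivatives in x1
    and beta and the Fueter polynomials ([mono_taylor]); the latter are the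
    polynomials [fueterT] up to powers of j. The monogenic equation also converts
    derivatives in beta into the operators [delta0] along C ([deltab_dd]). As C is
    common to all slices, the coefficients are the same on each of them
    ([slice_taylor]), whence the expansion in the ball. Two opposite points
    of the slice of j determine a term on all slices ([rot_halves]), which makes
    the bounds uniform in the slice ([term13_bound]) and gives absolute and uniform
    convergence.

    Fueter polynomials are invariant under the reversion that fixes 1, i, j, so they
    have no k-component ([fpol_k0]). The conditions on the coefficients therefore
    make every term slice preserving. Beyond the ball the property spreads along each
    connected slice, because on the slice the component of f orthogonal to it is
    locally a power series ([slice_identity]). *)

Set Implicit Arguments.
Unset Strict Implicit.
Unset Printing Implicit Defensive.

Import Order.TTheory GRing.Theory Num.Theory.
Import numFieldNormedType.Exports.

Local Open Scope classical_set_scope.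
Local Open Scope ring_scope.

(** * Quaternion algebra *)

Section QuaternionAlgebra.
Variable R : realType.
Implicit Types (x y z c : quat R) (t : R).

Lemma mkq_0 (a b c d : R) : mkq a b c d 0 0 = a. Proof. by rewrite mxE. Qed.
Lemma mkq_1 (a b c d : R) : mkq a b c d 0 1 = b. Proof. by rewrite mxE. Qed.
Lemma mkq_2 (a b c d : R) : mkq a b c d 0 2 = c. Proof. by rewrite mxE. Qed.
Lemma mkq_3 (a b c d : R) : mkq a b c d 0 3 = d. Proof. by rewrite mxE. Qed.

Lemma mulq_0 x y : (x *q y) 0 0 =
  x 0 0 * y 0 0 - x 0 1 * y 0 1 - x 0 2 * y 0 2 - x 0 3 * y 0 3.
Proof. exact: mkq_0. Qed.
Lemma mulq_1 x y : (x *q y) 0 1 =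
  x 0 0 * y 0 1 + x 0 1 * y 0 0 + x 0 2 * y 0 3 - x 0 3 * y 0 2.
Proof. exact: mkq_1. Qed.
Lemma mulq_2 x y : (x *q y) 0 2 =
  x 0 0 * y 0 2 - x 0 1 * y 0 3 + x 0 2 * y 0 0 + x 0 3 * y 0 1.
Proof. exact: mkq_2. Qed.
Lemma mulq_3 x y : (x *q y) 0 3 =
  x 0 0 * y 0 3 + x 0 1 * y 0 2 - x 0 2 * y 0 1 + x 0 3 * y 0 0.
Proof. exact: mkq_3. Qed.

Lemma addqE x y l : (x + y) 0 l = x 0 l + y 0 l. Proof. by rewrite mxE. Qed.
Lemma oppqE x l : (- x) 0 l = - x 0 l. Proof. by rewrite mxE. Qed.
Lemma scaleqE t x l : (t *: x) 0 l = t * x 0 l. Proof. by rewrite mxE. Qed.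
Lemma zeroqE l : (0 : quat R) 0 l = 0. Proof. by rewrite mxE. Qed.

Lemma ord4P (P : 'I_4 -> Prop) : P 0 -> P 1 -> P 2 -> P 3 -> forall l, P l.
Proof.
move=> P0 P1 P2 P3 [[|[|[|[|//]]]] h].
- by have -> : Ordinal h = 0 by exact: val_inj.
- by have -> : Ordinal h = 1 by exact: val_inj.
- by have -> : Ordinal h = 2 by exact: val_inj.
- by have -> : Ordinal h = 3 by exact: val_inj.
Qed.

Lemma sum_ord4 (V : nmodType) (F : 'I_4 -> V) :
  \sum_(l < 4) F l = F 0 + F 1 + F 2 + F 3.
Proof.
rewrite !big_ord_recr big_ord0 /= add0r.
by congr (F _ + F _ + F _ + F _); exact: val_inj.
Qed.

Lemma quatP x y : x 0 0 = y 0 0 -> x 0 1 = y 0 1 -> x 0 2 = y 0 2 ->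
  x 0 3 = y 0 3 -> x = y.
Proof. by move=> *; apply/rowP; exact: ord4P. Qed.

Definition qconj x : quat R := mkq (x 0 0) (- x 0 1) (- x 0 2) (- x 0 3).
Definition qnorm2 x : R := x 0 0 ^+ 2 + x 0 1 ^+ 2 + x 0 2 ^+ 2 + x 0 3 ^+ 2.
Definition eq4 (l : 'I_4) : quat R := [:: q1; qi; qj; qk]`_l.

End QuaternionAlgebra.

Definition qcoordE := (mkq_0, mkq_1, mkq_2, mkq_3, mulq_0, mulq_1, mulq_2, mulq_3,
  addqE, oppqE, scaleqE, zeroqE).

Ltac qexpand := rewrite /qconj /q1 /qi /qj /qk ?qcoordE.
Ltac qring := apply: quatP; qexpand; ring.

Section QuaternionAlgebra2.
Variable R : realType.
Implicit Types (x y z c : quat R) (t : R).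

Lemma mulqA x y z : x *q (y *q z) = x *q y *q z. Proof. qring. Qed.
Lemma mulqDl x y z : (x + y) *q z = x *q z + y *q z. Proof. qring. Qed.
Lemma mulqDr x y z : z *q (x + y) = z *q x + z *q y. Proof. qring. Qed.
Lemma mul1q x : q1 *q x = x. Proof. qring. Qed.
Lemma mulq1 x : x *q q1 = x. Proof. qring. Qed.
Lemma mul0q x : 0 *q x = 0. Proof. qring. Qed.
Lemma mulq0 x : x *q 0 = 0. Proof. qring. Qed.
Lemma mulNq x y : (- x) *q y = - (x *q y). Proof. qring. Qed.
Lemma mulqN x y : x *q (- y) = - (x *q y). Proof. qring. Qed.
Lemma mulqBl x y z : (x - y) *q z = x *q z - y *q z. Proof. qring. Qed.
Lemma mulqBr x y z : z *q (x - y) = z *q x - z *q y. Proof. qring. Qed.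
Lemma scaleqAl t x y : (t *: x) *q y = t *: (x *q y). Proof. qring. Qed.
Lemma scaleqAr t x y : x *q (t *: y) = t *: (x *q y). Proof. qring. Qed.

Lemma mulq_suml (I : Type) (r : seq I) (P : pred I) (F : I -> quat R) y :
  (\sum_(i <- r | P i) F i) *q y = \sum_(i <- r | P i) (F i *q y).
Proof. by apply: (big_morph (fun x => x *q y)) => [a b|]; rewrite ?mulqDl ?mul0q. Qed.

Lemma mulq_sumr (I : Type) (r : seq I) (P : pred I) (F : I -> quat R) y :
  y *q (\sum_(i <- r | P i) F i) = \sum_(i <- r | P i) (y *q F i).
Proof. by apply: (big_morph (fun x => y *q x)) => [a b|]; rewrite ?mulqDr ?mulq0. Qed.

Lemma eq4_0 : eq4 R 0 = q1. Proof. by []. Qed.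
Lemma eq4_1 : eq4 R 1 = qi. Proof. by []. Qed.
Lemma eq4_2 : eq4 R 2 = qj. Proof. by []. Qed.

Lemma eq4E l m : eq4 R l 0 m = (m == l)%:R.
Proof.
by elim/ord4P: l; elim/ord4P: m; rewrite /eq4 /= /q1 /qi /qj /qk mxE.
Qed.

Lemma quat_sum x : x = \sum_l x 0 l *: eq4 R l.
Proof. by rewrite sum_ord4 /eq4 /=; qring. Qed.

Lemma qnorm2_ge0 x : 0 <= qnorm2 x. Proof. by rewrite /qnorm2; nra. Qed.

Lemma qnormE x : qnorm x = Num.sqrt (qnorm2 x).
Proof. by rewrite /qnorm sum_ord4. Qed.

Lemma qnorm_ge0 x : 0 <= qnorm x. Proof. by rewrite qnormE sqrtr_ge0. Qed.

Lemma sqr_qnorm x : qnorm x ^+ 2 = qnorm2 x.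
Proof. by rewrite qnormE sqr_sqrtr// qnorm2_ge0. Qed.

Lemma qnorm2M x y : qnorm2 (x *q y) = qnorm2 x * qnorm2 y.
Proof. rewrite /qnorm2; qexpand; ring. Qed.

Lemma qnormM x y : qnorm (x *q y) = qnorm x * qnorm y.
Proof. by rewrite !qnormE qnorm2M sqrtrM// qnorm2_ge0. Qed.

Lemma qnormZ t x : qnorm (t *: x) = `|t| * qnorm x.
Proof.
rewrite !qnormE (_ : qnorm2 _ = t ^+ 2 * qnorm2 x).
  by rewrite sqrtrM ?sqr_ge0// sqrtr_sqr.
by rewrite /qnorm2; qexpand; ring.
Qed.

Lemma qnormN x : qnorm (- x) = qnorm x.
Proof. by rewrite -scaleN1r qnormZ normrN1 mul1r. Qed.

Lemma qnorm_conj x : qnorm (qconj x) = qnorm x.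
Proof. by rewrite !qnormE /qnorm2; qexpand; rewrite !sqrrN. Qed.

Lemma qnorm0 : qnorm (0 : quat R) = 0.
Proof. by rewrite -(scale0r 0) qnormZ normr0 mul0r. Qed.

Lemma qnorm_q1 : qnorm (q1 : quat R) = 1.
Proof. by rewrite qnormE /qnorm2; qexpand; rewrite expr1n !expr0n /= !addr0 sqrtr1. Qed.

Lemma qnorm_eq4 l : qnorm (eq4 R l) = 1.
Proof.
elim/ord4P: l; rewrite /eq4 /= qnormE /qnorm2; qexpand;
by rewrite expr1n !expr0n /= ?addr0 ?add0r ?addr0 sqrtr1.
Qed.

Lemma qnormD x y : qnorm (x + y) <= qnorm x + qnorm y.
Proof.
rewrite -(@ler_pXn2r _ 2)// ?nnegrE ?addr_ge0 ?qnorm_ge0//.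
rewrite sqrrD !sqr_qnorm.
set d := x 0 0 * y 0 0 + x 0 1 * y 0 1 + x 0 2 * y 0 2 + x 0 3 * y 0 3.
have -> : qnorm2 (x + y) = qnorm2 x + d *+ 2 + qnorm2 y.
  by rewrite /qnorm2 /d; qexpand; ring.
rewrite lerD2r lerD2l ler_wMn2r//.
apply: (le_trans (ler_norm _)).
rewrite -(@ler_pXn2r _ 2)// ?nnegrE ?mulr_ge0 ?qnorm_ge0//.
rewrite exprMn !sqr_qnorm real_normK ?num_real// -subr_ge0 /d /qnorm2.
rewrite (_ : _ - _ = (x 0 0 * y 0 1 - x 0 1 * y 0 0) ^+ 2 +
  (x 0 0 * y 0 2 - x 0 2 * y 0 0) ^+ 2 + (x 0 0 * y 0 3 - x 0 3 * y 0 0) ^+ 2 +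
  (x 0 1 * y 0 2 - x 0 2 * y 0 1) ^+ 2 + (x 0 1 * y 0 3 - x 0 3 * y 0 1) ^+ 2 +
  (x 0 2 * y 0 3 - x 0 3 * y 0 2) ^+ 2); last by ring.
by rewrite !addr_ge0 ?sqr_ge0.
Qed.

Lemma qnorm_sum (I : Type) (r : seq I) (P : pred I) (F : I -> quat R) :
  qnorm (\sum_(i <- r | P i) F i) <= \sum_(i <- r | P i) qnorm (F i).
Proof.
elim/big_ind2 : _ => //; first by rewrite qnorm0.
by move=> a u b v ha hb; apply: (le_trans (qnormD _ _)); exact: lerD.
Qed.

Lemma qnormB x y : qnorm (x - y) = qnorm (y - x).
Proof. by rewrite -qnormN opprB. Qed.

Lemma qnorm_eq0 x : (qnorm x == 0) = (x == 0).
Proof.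
apply/eqP/eqP => [h|->]; last exact: qnorm0.
have := sqr_qnorm x; rewrite h expr0n /= /qnorm2 => /esym/eqP.
rewrite !paddr_eq0 ?addr_ge0 ?sqr_ge0// !sqrf_eq0.
by move=> /andP[/andP[/andP[/eqP ? /eqP ?] /eqP ?] /eqP ?]; apply: quatP; rewrite mxE.
Qed.

Lemma qnorm_gt0 x : (0 < qnorm x) = (x != 0).
Proof. by rewrite lt_neqAle qnorm_ge0 andbT eq_sym qnorm_eq0. Qed.

Lemma coord_le_qnorm x l : `|x 0 l| <= qnorm x.
Proof.
rewrite -(@ler_pXn2r _ 2)// ?nnegrE ?qnorm_ge0 ?normr_ge0// sqr_qnorm.
rewrite real_normK ?num_real//.
have -> : qnorm2 x = \sum_l x 0 l ^+ 2 by rewrite sum_ord4.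
by rewrite (bigD1 l)//= lerDl sumr_ge0// => m _; rewrite sqr_ge0.
Qed.

Lemma mxnorm_le_qnorm x : `|x| <= qnorm x.
Proof.
rewrite [leLHS]/Num.Def.normr/= mx_normrE; apply/bigmax_leP; split.
  exact: qnorm_ge0.
by move=> [i j] _ /=; rewrite (ord1 i) coord_le_qnorm.
Qed.

Lemma coord_le_mxnorm x l : `|x 0 l| <= `|x|.
Proof.
rewrite [leRHS]/Num.Def.normr/= mx_normrE.
exact: (le_bigmax _ (fun i : 'I_1 * 'I_4 => `|x i.1 i.2|) (0, l)).
Qed.

Lemma qnorm_le_coord x e : (forall l, `|x 0 l| <= e) -> qnorm x <= 4 * e.
Proof.
move=> h; rewrite {1}(quat_sum x); apply: (le_trans (qnorm_sum _ _ _)).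
apply: (@le_trans _ _ (\sum_(l < 4) e)).
  by apply: ler_sum => l _; rewrite qnormZ qnorm_eq4 mulr1.
by rewrite sum_ord4; lra.
Qed.

Lemma qnorm_le_mxnorm x : qnorm x <= 4 * `|x|.
Proof. by apply: qnorm_le_coord => l; exact: coord_le_mxnorm. Qed.

Definition qinv x : quat R := (qnorm2 x)^-1 *: qconj x.

Lemma mulq_conj x : x *q qconj x = qnorm2 x *: q1.
Proof. by rewrite /qnorm2; qring. Qed.
Lemma mulq_conjl x : qconj x *q x = qnorm2 x *: q1.
Proof. by rewrite /qnorm2; qring. Qed.
Lemma qconjM x y : qconj (x *q y) = qconj y *q qconj x.
Proof. qring. Qed.

Lemma qnorm2_eq0 x : (qnorm2 x == 0) = (x == 0).
Proof. by rewrite -sqr_qnorm sqrf_eq0 qnorm_eq0. Qed.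

Lemma mulqV x : x != 0 -> x *q qinv x = q1.
Proof.
move=> x0; rewrite /qinv scaleqAr mulq_conj scalerA mulVf ?scale1r//.
by rewrite qnorm2_eq0.
Qed.
Lemma qnormV x : qnorm (qinv x) = (qnorm x)^-1.
Proof.
rewrite /qinv qnormZ qnorm_conj -sqr_qnorm normfV normrX ger0_norm ?qnorm_ge0//.
have [->|x0] := eqVneq (qnorm x) 0; first by rewrite expr0n /= invr0 mulr0.
by rewrite expr2 invfM -mulrA mulVf// mulr1.
Qed.

End QuaternionAlgebra2.

(** * A mean value on bounded functions of four real variables *)

Section UltraLimit.
Variable R : realType.

Definition ufil : set_system nat :=
  sval (cid (ultraFilterLemma eventually_filter)).

Lemma ufilU : UltraFilter ufil.
Proof. by rewrite /ufil; case: cid => U []. Qed.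
Lemma ufil_oo : \oo `<=` ufil.
Proof. by rewrite /ufil; case: cid => U []. Qed.

#[local] Instance ufilP : ProperFilter ufil := @ultra_proper _ _ ufilU.

(** Limit along a fixed ultrafilter finer than [\oo]: it exists for every bounded
    sequence and is linear and monotone, which is all that is asked of it. *)
Definition ulim (v : nat -> R) : R := lim (v @ ufil).

Lemma cvg_ulim (v : nat -> R) M : (forall n, `|v n| <= M) -> v @ ufil --> ulim v.
Proof.
move=> vM; apply/cvg_ex.
have UP : ProperFilter (v @ ufil) by exact: fmap_proper_filter.
have FA : (v @ ufil) `[- M, M]%classic.
  by apply: nearW => n; rewrite /= in_itv /= -ler_norml.
have [p [_ clp]] := @segment_compact R (- M) M (v @ ufil) UP FA.
exists p => V Vp /=; have [//|nV] := in_ultra_setVsetC (v @^-1` V) ufilU.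
have : (v @ ufil) (~` V) by exact: nV.
by move=> /clp /(_ Vp) [z []].
Qed.

Lemma ulim_eq (v : nat -> R) l : v @ \oo --> l -> ulim v = l.
Proof. by move=> vl; apply/cvg_lim => // V /vl; exact: ufil_oo. Qed.

End UltraLimit.

Section Mean.
Variable R : realType.
Variable m : nat.
Implicit Types (u v : quat R -> R) (n : nat).

Definition gstep n : R := n.+1%:R^-1.
Definition gnode n i : R := i%:R * gstep n - m%:R.
Definition gpoint n (a b c d : nat) : quat R :=
  mkq (gnode n a) (gnode n b) (gnode n c) (gnode n d).
Definition gsize n := (2 * m * n.+1)%N.

(** Riemann sum of [u] over the cube [-m, m)^4 with mesh 1/(n+1). *)
Definition gsum n u : R := gstep n ^+ 4 *
  \sum_(0 <= a < gsize n) \sum_(0 <= b < gsize n)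
  \sum_(0 <= c < gsize n) \sum_(0 <= d < gsize n) u (gpoint n a b c d).

(** A positive linear functional on all bounded functions that plays the role of
    the Lebesgue integral over the cube. No measurability enters, and the few
    properties of integrals that the Cauchy formula rests on (positivity,
    integration by parts, invariance under translations) can be read off the
    Riemann sums. *)
Definition mean u : R := ulim (fun n => gsum n u).

Definition bnd u := exists M : R, forall y, `|u y| <= M.

Definition vol : R := (2 * m)%:R ^+ 4.

Lemma vol_ge0 : 0 <= vol. Proof. by rewrite exprn_ge0. Qed.

Lemma gstep_gt0 n : 0 < gstep n. Proof. by rewrite invr_gt0. Qed.

Lemma gstep_ge0 n : 0 <= gstep n. Proof. by rewrite ltW ?gstep_gt0. Qed.

Lemma gsumD n u v : gsum n (fun y => u y + v y) = gsum n u + gsum n v.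
Proof.
rewrite /gsum -mulrDr; congr (_ * _).
rewrite -big_split; apply: eq_bigr => a _; rewrite -big_split; apply: eq_bigr => b _.
by rewrite -big_split; apply: eq_bigr => c _; rewrite -big_split.
Qed.

Lemma gsumZ n k u : gsum n (fun y => k * u y) = k * gsum n u.
Proof.
rewrite /gsum mulrCA; congr (_ * _).
rewrite mulr_sumr; apply: eq_bigr => a _; rewrite mulr_sumr; apply: eq_bigr => b _.
by rewrite mulr_sumr; apply: eq_bigr => c _; rewrite mulr_sumr.
Qed.

Lemma gsum_cst n k : gsum n (fun=> k) = vol * k.
Proof.
rewrite /gsum; under eq_bigr do under eq_bigr do under eq_bigr do
  rewrite sumr_const_nat subn0.
under eq_bigr do under eq_bigr do rewrite sumr_const_nat subn0.
under eq_bigr do rewrite sumr_const_nat subn0.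
rewrite sumr_const_nat subn0 -!mulrnA -mulr_natr !natrM /gsize /vol /gstep.
have : n.+1%:R != 0 :> R by rewrite pnatr_eq0.
by rewrite !natrM; move: (n.+1%:R : R) => N N0; field.
Qed.

Lemma ler_gsum n u v : (forall y, u y <= v y) -> gsum n u <= gsum n v.
Proof.
move=> uv; rewrite /gsum ler_wpM2l ?exprn_ge0 ?gstep_ge0//.
by do 4 (apply: ler_sum => ? _).
Qed.

Lemma gsum_norm n u M : (forall y, `|u y| <= M) -> `|gsum n u| <= vol * M.
Proof.
move=> uM; rewrite ler_norml; apply/andP; split.
  rewrite -mulrN -(gsum_cst n); apply: ler_gsum => y.
  by have := uM y; rewrite ler_norml => /andP[].
rewrite -(gsum_cst n); apply: ler_gsum => y.
by have := uM y; rewrite ler_norml => /andP[].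
Qed.

Lemma mean_cvg u : bnd u -> (fun n => gsum n u) @ ufil --> mean u.
Proof.
by move=> [M uM]; apply: (@cvg_ulim _ _ (vol * M)) => n; exact: gsum_norm.
Qed.

#[local] Existing Instance ufilP.

Lemma meanD u v : bnd u -> bnd v -> mean (fun y => u y + v y) = mean u + mean v.
Proof.
move=> /mean_cvg bu /mean_cvg bv; apply/cvg_lim => //.
by under eq_fun do rewrite gsumD; exact: cvgD.
Qed.

Lemma meanZ k u : bnd u -> mean (fun y => k * u y) = k * mean u.
Proof.
move=> /mean_cvg bu; apply/cvg_lim => //.
by under eq_fun do rewrite gsumZ; apply: cvgM => //; exact: cvg_cst.
Qed.

Lemma mean_near_ge u c : bnd u -> (forall n, c <= gsum n u) -> c <= mean u.
Proof.
move=> /mean_cvg bu uc; rewrite /mean /ulim; apply: limr_ge; last exact: nearW.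
by apply/cvg_ex; exists (mean u).
Qed.

Lemma ler_mean u v : bnd u -> bnd v -> (forall y, u y <= v y) -> mean u <= mean v.
Proof.
move=> /mean_cvg bu /mean_cvg bv uv; rewrite /mean /ulim.
apply: ler_lim; [by apply/cvg_ex; exists (mean u)
  |by apply/cvg_ex; exists (mean v)|].
by apply: nearW => n; exact: ler_gsum.
Qed.

Lemma mean_norm u M : (forall y, `|u y| <= M) -> `|mean u| <= vol * M.
Proof.
move=> uM; have bu : bnd u by exists M.
have c k : mean (fun=> k) = vol * k.
  by apply: ulim_eq; under eq_fun do rewrite gsum_cst; exact: cvg_cst.
have bc k : bnd (fun=> k) by exists `|k|.
rewrite ler_norml -mulrN -!c !ler_mean// => y; have := uM y;
by rewrite ler_norml => /andP[].
Qed.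

Lemma sum_sub (F : nat -> R) N a b : (a <= b <= N)%N -> (forall i, 0 <= F i) ->
  \sum_(a <= i < b) F i <= \sum_(0 <= i < N) F i.
Proof.
move=> /andP[ab bN] F0; rewrite (@big_cat_nat _ _ _ a 0 N)//=; last exact: leq_trans bN.
rewrite (@big_cat_nat _ _ _ b a N)//=.
have h p q : 0 <= \sum_(p <= i < q) F i by rewrite sumr_ge0.
have := h 0%N a; have := h b N; lra.
Qed.

(** A nonnegative function that is large on the cell [1, 2]^4 has a large mean:
    this is what shows that the constant in the Cauchy formula does not vanish. *)
Lemma mean_ge (hm : (2 <= m)%N) u (c : R) : bnd u -> (forall y, 0 <= u y) ->
  (forall y : quat R, (forall l, 1 <= y 0 l <= 2) -> c <= u y) -> c <= mean u.
Proof.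
move=> bu u0 uc; apply: mean_near_ge => // n; rewrite /gsum.
set A := (m.+1 * n.+1)%N; set B := (m.+2 * n.+1)%N.
have AB : (A <= B <= gsize n)%N.
  by rewrite /A /B /gsize !leq_mul2r leqnSn /=; lia.
have step F k : (forall i, 0 <= F i) -> (forall i, (A <= i < B)%N -> k <= F i) ->
    (n.+1%:R * k : R) <= \sum_(0 <= i < gsize n) F i.
  move=> F0 Fk; apply: le_trans (sum_sub AB F0).
  rewrite big_nat; apply: (@le_trans _ _ (\sum_(A <= i < B) k)).
    by rewrite sumr_const_nat /B /A -mulnBl subSnn mul1n mulr_natl.
  by rewrite big_nat; apply: ler_sum => i /Fk.
have node i : (A <= i < B)%N -> 1 <= gnode n i <= 2.
  rewrite /gnode /gstep /A /B => /andP[iA iB].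
  have n0 : 0 < n.+1%:R :> R by [].
  have iA' : (m.+1%:R * n.+1%:R <= i%:R :> R) by rewrite -natrM ler_nat.
  have iB' : (i%:R <= m.+2%:R * n.+1%:R :> R) by rewrite -natrM ler_nat ltnW.
  apply/andP; split.
    by rewrite lerBrDr ler_pdivlMr//; move: iA'; rewrite -natr1; lra.
  by rewrite lerBlDr ler_pdivrMr//; move: iB'; rewrite -!natr1; lra.
apply: (@le_trans _ _ (gstep n ^+ 4 * (n.+1%:R * (n.+1%:R * (n.+1%:R * (n.+1%:R * c)))))).
  rewrite /gstep le_eqVlt; apply/orP; left; apply/eqP.
  have : n.+1%:R != 0 :> R by rewrite pnatr_eq0.
  by move: (n.+1%:R : R) => N N0; field.
rewrite ler_wpM2l ?exprn_ge0 ?gstep_ge0//.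
apply: (step) => a; first by do 3 (apply: sumr_ge0 => ? _).
move=> /node ha; apply: (step) => b; first by do 2 (apply: sumr_ge0 => ? _).
move=> /node hb; apply: (step) => e; first by apply: sumr_ge0.
move=> /node hc; apply: (step) => d; first by [].
move=> /node hd; apply: uc; apply: ord4P; by rewrite /gpoint qcoordE.
Qed.

End Mean.

(** * Integration by parts and translation for the mean *)

Section IBP.
Variable R : realType.
Variable m : nat.
Implicit Types (u v : quat R -> R) (n : nat) (l : 'I_4).
#[local] Existing Instance ufilP.

(** Differentiability along the l-th axis with a remainder uniform in the point,
    as needed to replace derivatives by difference quotients on a whole grid. *)
Definition unif_deriv l u (u' : quat R -> R) := forall e : R, 0 < e ->
  exists2 d : R, 0 < d & forall (y : quat R) (t : R), `|t| < d ->
    `|u (y + t *: eq4 R l) - u y - t * u' y| <= e * `|t|.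

Definition supp_in (L : R) u := forall (y : quat R) l, L <= `|y 0 l| -> u y = 0.

Lemma gnodeS n i : gnode R m n i.+1 = gnode R m n i + gstep R n.
Proof. by rewrite /gnode -natr1; lra. Qed.

Lemma gnode0 n : gnode R m n 0 = - m%:R.
Proof. by rewrite /gnode mul0r add0r. Qed.

Lemma gnode_end n : gnode R m n (gsize m n) = m%:R.
Proof.
rewrite /gnode /gsize /gstep natrM mulfK ?pnatr_eq0// natrM; lra.
Qed.

(** Shifting by one mesh step permutes the grid, except for a boundary layer where
    a function supported in the cube vanishes. *)
Lemma gsum_shift n l u : supp_in m%:R u ->
  gsum m n (fun y => u (y + gstep R n *: eq4 R l)) = gsum m n u.
Proof.
move=> u0; rewrite /gsum; congr (_ * _).
set N := gsize m n.
pose C (F : nat -> R) := \sum_(0 <= i < N) F i.+1 = \sum_(0 <= i < N) F i.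
have tele (F : nat -> R) : F 0%N = 0 -> F N = 0 -> C F.
  move=> F0 FN; apply/eqP; rewrite -subr_eq0 -sumrB telescope_sumr ?leq0n//.
  by rewrite F0 FN subr0.
have end0 i : gnode R m n 0 = i \/ gnode R m n N = i -> m%:R <= `|i|.
  by rewrite gnode0 gnode_end => -[|] <-; rewrite ?normrN ger0_norm.
have z l' (y : quat R) : gnode R m n 0 = y 0 l' \/ gnode R m n N = y 0 l' -> u y = 0.
  by move=> h; apply: (u0 _ l'); exact: end0.
have sh (a b c d : nat) : gpoint R m n a b c d + gstep R n *: eq4 R l =
    gpoint R m n (a + (l == 0)) (b + (l == 1)) (c + (l == 2)) (d + (l == 3)).
  have gS i (k : bool) : gnode R m n (i + k) = gnode R m n i + gstep R n * k%:R.
    by case: k; rewrite ?addn1 ?addn0 ?gnodeS ?mulr1 ?mulr0 ?addr0.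
  by rewrite /gpoint !gS; apply: quatP; rewrite !qcoordE eq4E eq_sym.
under eq_bigr do under eq_bigr do under eq_bigr do under eq_bigr do rewrite sh.
move: sh => _; elim/ord4P: l; rewrite /= ?eqxx.
- apply: (etrans _ (tele (fun a => \sum_(0 <= b < N)
    \sum_(0 <= c < N) \sum_(0 <= d < N) u (gpoint R m n a b c d)) _ _)).
  + by apply: eq_bigr => a _; do 3 (apply: eq_bigr => ? _); rewrite addn1 !addn0.
  + do 3 (apply: big1 => ? _); apply: (z 0); rewrite /gpoint; qexpand; auto.
  + do 3 (apply: big1 => ? _); apply: (z 0); rewrite /gpoint; qexpand; auto.
- apply: eq_bigr => a _; apply: (etrans _ (tele (fun b =>
    \sum_(0 <= c < N) \sum_(0 <= d < N) u (gpoint R m n a b c d)) _ _)).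
  + by apply: eq_bigr => b _; do 2 (apply: eq_bigr => ? _); rewrite addn1 !addn0.
  + do 2 (apply: big1 => ? _); apply: (z 1); rewrite /gpoint; qexpand; auto.
  + do 2 (apply: big1 => ? _); apply: (z 1); rewrite /gpoint; qexpand; auto.
- apply: eq_bigr => a _; apply: eq_bigr => b _; apply: (etrans _ (tele (fun c =>
    \sum_(0 <= d < N) u (gpoint R m n a b c d)) _ _)).
  + by apply: eq_bigr => c _; do 1 (apply: eq_bigr => ? _); rewrite addn1 !addn0.
  + apply: big1 => ? _; apply: (z 2); rewrite /gpoint; qexpand; auto.
  + apply: big1 => ? _; apply: (z 2); rewrite /gpoint; qexpand; auto.
- apply: eq_bigr => a _; apply: eq_bigr => b _; apply: eq_bigr => c _.
  apply: (etrans _ (tele (fun d => u (gpoint R m n a b c d)) _ _)).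
  + by apply: eq_bigr => d _; rewrite addn1 !addn0.
  + apply: (z 3); rewrite /gpoint; qexpand; auto.
  + apply: (z 3); rewrite /gpoint; qexpand; auto.
Qed.

(** Integration by parts: up to a uniformly small error a derivative is a
    difference quotient whose step is the mesh, and the Riemann sum of the
    latter is zero by [gsum_shift]. *)
Lemma mean_deriv l u u' : unif_deriv l u u' -> supp_in m%:R u -> bnd u' ->
  mean m u' = 0.
Proof.
move=> du su bu'; apply: ulim_eq; apply/cvgrPdist_le => /= e e0.
have v1 : 0 < vol R m + 1 by rewrite ltr_wpDl// vol_ge0.
have [d d0 dP] := du (e / (vol R m + 1)) (divr_gt0 e0 v1).
near=> n; rewrite sub0r normrN.
have hd : gstep R n < d.
  by near: n; exact: (cvgr_lt (0 : R) (@cvg_harmonic R) d d0).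
have h0 := gstep_gt0 R n; set h := gstep R n in hd h0 *.
have -> : gsum m n u' = gsum m n
    (fun y => u' y - h^-1 * (u (y + h *: eq4 R l) - u y)).
  have -> : (fun y => u' y - h^-1 * (u (y + h *: eq4 R l) - u y)) =
    (fun y => u' y + (- h^-1) * (u (y + h *: eq4 R l) + (-1) * u y)).
    by apply/funext => y; ring.
  rewrite gsumD gsumZ gsumD gsumZ gsum_shift//.
  by rewrite mulN1r subrr mulr0 addr0.
apply: (le_trans (@gsum_norm _ _ _ _ (e / (vol R m + 1)) _)).
  move=> y; have /(_ y h) := dP; rewrite (gtr0_norm h0) => /(_ _).
  move=> /(_ hd); rewrite -ler_pdivrMr// => /(le_trans _); apply.
  rewrite -[X in _ / X](gtr0_norm h0) -normfV -normrM distrC.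
  by rewrite le_eqVlt; apply/orP; left; apply/eqP; congr `|_|; field; rewrite gt_eqF.
by rewrite mulrA ler_pdivrMr// mulrDr mulr1 [vol R m * e]mulrC lerDl ltW.
Unshelve. all: by end_near. Qed.

(** The derivative of the mean along a translation is the mean of a derivative,
    hence zero. Since the mean is only finitely additive, this is carried out
    with finitely many small steps whose errors add up to at most e. *)
Lemma mean_translate1 l u u' (T : R) : unif_deriv l u u' ->
  (forall s : R, 0 <= s <= 1 -> supp_in m%:R (fun y : quat R => u (y - (s * T) *: eq4 R l))) ->
  bnd u -> bnd u' -> mean m (fun y => u (y - T *: eq4 R l)) = mean m u.
Proof.
move=> du su [M uM] [M' uM'].
pose v (s : R) (y : quat R) := u (y - (s * T) *: eq4 R l).
have bv s : bnd (v s) by exists M => y; exact: uM.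
suff : mean m (v 1) = mean m (v 0).
  rewrite /v; under eq_fun do rewrite mul1r.
  by under [in X in _ = X -> _]eq_fun do rewrite mul0r scale0r subr0.
apply/eqP; rewrite -subr_eq0 -normr_le0; apply/ler_addgt0Pr => e0' e0; set e : R := e0'; have {}e0 : 0 < e := e0; rewrite add0r.
pose e' := e / ((vol R m + 1) * (`|T| + 1)).
have V0 := vol_ge0 R m.
have e'0 : 0 < e' by rewrite divr_gt0// mulr_gt0// ltr_wpDl.
have [d d0 dP] := du e' e'0.
have [N NT] : exists N : nat, `|T| / d < N.+1%:R.
  exists (Num.truncn (`|T| / d)); rewrite truncnS_gt//.
have N0 : 0 < N.+1%:R :> R by [].
pose t := N.+1%:R^-1 * T.
have td : `|t| < d.
  rewrite /t normrM normfV (gtr0_norm N0) mulrC ltr_pdivrMr// mulrC.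
  by rewrite -ltr_pdivrMr.
have step k : (k < N.+1)%N ->
    `|mean m (v (k.+1%:R / N.+1%:R)) - mean m (v (k%:R / N.+1%:R))| <=
    vol R m * (e' * `|t|).
  move=> kN; set s := k%:R / N.+1%:R.
  pose w (y : quat R) := u' (y - (s * T) *: eq4 R l).
  have bw : bnd w by exists M' => y; exact: uM'.
  have s01 : 0 <= s <= 1.
    by rewrite divr_ge0//= ler_pdivrMr// mul1r ler_nat ltnW.
  have w0 : mean m w = 0.
    apply: (@mean_deriv l (v s) w _ (su s s01) bw) => a a0.
    have [b b0 bP] := du a a0; exists b => // y x xb.
    by rewrite /v (addrAC y); exact: bP.
  have -> : mean m (v (k.+1%:R / N.+1%:R)) - mean m (v s) =
      mean m (fun y => v (k.+1%:R / N.+1%:R) y + ((-1) * v s y + t * w y)).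
    have bZ c f : bnd f -> bnd (fun y => c * f y).
      by move=> [K fK]; exists (`|c| * K) => y; rewrite normrM ler_wpM2l.
    have bD f g : bnd f -> bnd g -> bnd (fun y => f y + g y).
      move=> [K fK] [K' gK]; exists (K + K') => y.
      by apply: (le_trans (ler_normD _ _)); exact: lerD.
    rewrite meanD; [|exact: bv|by apply: (bD); apply: (bZ)].
    rewrite meanD; [|exact: bZ|exact: bZ].
    by rewrite !meanZ// w0 mulr0 addr0 mulN1r.
  apply: mean_norm => y.
  have -> : v (k.+1%:R / N.+1%:R) y =
      u ((y - (s * T) *: eq4 R l) + (- t) *: eq4 R l).
    rewrite /v /s /t -(natr1 k); congr u.
    by move: (N.+1%:R : R) (lt0r_neq0 N0) => K K0; apply: quatP; qexpand; field.
  rewrite /v /w.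
  have := dP (y - (s * T) *: eq4 R l) (- t); rewrite !normrN => /(_ td).
  by congr (is_true (`|_| <= _)); ring.
have tot : forall k, (k <= N.+1)%N ->
    `|mean m (v (k%:R / N.+1%:R)) - mean m (v 0)| <= k%:R * (vol R m * (e' * `|t|)).
  elim=> [_|k IH kN]; first by rewrite mul0r subrr normr0 mul0r.
  rewrite -[in leRHS]natr1 mulrDl mul1r.
  apply: (le_trans (ler_distD (mean m (v (k%:R / N.+1%:R))) _ _)).
  by rewrite [leRHS]addrC lerD ?IH ?step// ltnW.
have := tot _ (leqnn _); rewrite divff ?pnatr_eq0// => /le_trans; apply.
rewrite /t normrM normfV (gtr0_norm N0) /e'.
have -> : N.+1%:R * (vol R m * (e / ((vol R m + 1) * (`|T| + 1)) * (N.+1%:R^-1 * `|T|)))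
   = e * ((vol R m * `|T|) / ((vol R m + 1) * (`|T| + 1))).
  have T1 : `|T| + 1 != 0 by rewrite gt_eqF// ltr_wpDl.
  have V1 : vol R m + 1 != 0 by rewrite gt_eqF// ltr_wpDl.
  have : N.+1%:R != 0 :> R by rewrite pnatr_eq0.
  by move: (N.+1%:R : R) => K K0; field; rewrite T1 V1 K0.
rewrite -[leRHS]mulr1 ler_wpM2l ?(ltW e0)// ler_pdivrMr ?mulr_gt0 ?ltr_wpDl// mul1r.
by rewrite ler_pM// lerDl.
Qed.

End IBP.

(** * Calculus along coordinate directions *)

Section SmoothCompactSupport.
Variable R : realType.
Implicit Types (u v : quat R -> R) (l : 'I_4) (y : quat R).

Lemma is_derive_line (W : normedModType R) (u : quat R -> W) y (v : quat R) (s : R) d :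
  is_derive (y + s *: v) v u d -> is_derive s 1 (fun s : R => u (y + s *: v)) d.
Proof.
move=> [du <-].
have E : (fun h : R => h^-1 *: (u (y + (h *: 1 + s) *: v) - u (y + s *: v))) =
         (fun h : R => h^-1 *: (u (h *: v + (y + s *: v)) - u (y + s *: v))).
  apply/funext => h; congr (_ *: (u _ - _)).
  by rewrite scalerDl addrCA [h *: 1]mulr1.
by split; rewrite /derivable /derive /= E.
Qed.

Lemma compact_box (L : R) : compact [set y : quat R | forall l, `[- L, L]%classic (y 0 l)].
Proof. by apply: (@rV_compact _ _ (fun=> `[- L, L]%classic)) => l; exact: segment_compact. Qed.

Lemma supp_bnd u L : continuous u -> supp_in L u -> bnd u.
Proof.
move=> cu su; pose K := [set y : quat R | forall l, `[- `|L|, `|L|]%classic (y 0 l)].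
have K0 : K !=set0.
  by exists 0 => l; rewrite mxE /= in_itv /= oppr_le0 normr_ge0.
have cn : {within K, continuous (fun y => `|u y|)}.
  apply: continuous_subspaceT => y; move: (cu y) => cuy.
  exact: (cvg_norm cuy).
have [c _ cP] := EVT_max_rV K0 (@compact_box _) cn.
exists `|u c| => y; have [Ky|nKy] := pselect (K y); first by apply: cP; rewrite inE.
suff -> : u y = 0 by rewrite normr0.
apply: contrapT => uy; apply: nKy => l; rewrite /= in_itv /= -ler_norml leNgt.
apply/negP => h; apply: uy; apply: (su y l); apply/ltW/(le_lt_trans _ h).
exact: ler_norm.
Qed.

(** A C^1 function of compact support is uniformly differentiable: its derivative
    is uniformly continuous, and the mean value theorem applies along the line. *)
Lemma unif_deriv_smooth l u u' L : (forall y, is_derive y (eq4 R l) u (u' y)) ->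
  continuous u' -> supp_in L u' -> unif_deriv l u u'.
Proof.
move=> du cu' su' e e0.
pose K := [set y : quat R | forall l, `[- (`|L| + 1), `|L| + 1]%classic (y 0 l)].
pose P (t : R) (y : quat R) := `|u' (y + t *: eq4 R l) - u' y| <= e.
have cP : \forall t \near (0 : R), K `<=` P t.
  have /compact_near_coveringP cK := @compact_box (`|L| + 1).
  apply: (cK R (nbhs (0 : R)) P _) => x _.
  have c1 : (fun z : R * quat R => u' (z.2 + z.1 *: eq4 R l)) @ (nbhs (0 : R, x))
      --> u' x.
    have c0 : (fun z : R * quat R => z.2 + z.1 *: eq4 R l) @ (nbhs (0 : R, x)) --> x.
      rewrite -[X in _ --> X]addr0 -(scale0r (eq4 R l)).
      apply: cvgD; first exact: cvg_snd.
      by apply: cvgZ; [exact: cvg_fst|exact: cvg_cst].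
    exact: (cvg_comp _ _ c0 (cu' x)).
  have c2 : (fun z : R * quat R => u' z.2) @ (nbhs (0 : R, x)) --> u' x.
    have c20 : (fun z : R * quat R => z.2) @ nbhs (0 : R, x) --> x by exact: cvg_snd.
    exact: (cvg_comp _ _ c20 (cu' x)).
  have c3 : (fun z : R * quat R => u' (z.2 + z.1 *: eq4 R l) - u' z.2)
      @ (nbhs (0 : R, x)) --> (0 : R).
    by rewrite -[X in _ --> X](subrr (u' x)); exact: cvgB.
  have h := (cvgr0Pnorm_le _).1 c3 e e0.
  case: h => -[A B] [/= A0 Bx] AB; exists (B, A) => //.
  by move=> [p q] [/= Bp Aq]; exact: (AB (q, p)).
have /nbhs_ballP [d' /= d'0 dP] := cP.
pose d := Num.min d' 1; have d0 : 0 < d by rewrite lt_min d'0 ltr01.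
exists d => // y t td.
have Pt (s : R) z : `|s| < d -> P s z.
  rewrite lt_min => /andP[sd s1]; have [Kz|nKz] := pselect (K z).
    by apply: dP => //=; rewrite /ball/= sub0r normrN.
  have [k hk] : exists k, `|L| + 1 < `|z 0 k|.
    apply: contrapT => h; apply: nKz => k; rewrite /= in_itv /= -ler_norml leNgt.
    by apply/negP => hk; apply: h; exists k.
  have hL := ler_norm L.
  rewrite /P (su' z k); last by apply/ltW/(le_lt_trans _ hk); lra.
  rewrite (su' _ k) ?subr0 ?normr0 ?ltW//.
  have h1 : `|s * eq4 R l 0 k| <= 1.
    rewrite normrM eq4E; case: (k == l); rewrite ?normr1 ?normr0 ?mulr1 ?mulr0//.
    exact: ltW.
  rewrite addqE scaleqE.
  have := lerB_normD (z 0 k) (s * eq4 R l 0 k); lra.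
have D (s : R) : is_derive s 1 (fun s : R => u (y + s *: eq4 R l)) (u' (y + s *: eq4 R l)).
  exact: is_derive_line.
have cD (a b : R) : {within `[a, b], continuous (fun s : R => u (y + s *: eq4 R l))}.
  apply: continuous_subspaceT => s; apply/differentiable_continuous/derivable1_diffP.
  by case: (D s).
have [c ct E] : exists2 c, `|c| <= `|t| &
    u (y + t *: eq4 R l) - u y = u' (y + c *: eq4 R l) * t.
  have [t0|t0] := leP 0 t.
    have [c] := MVT_segment t0 (fun s _ => D s) (cD _ _).
    rewrite in_itv /= scale0r addr0 subr0 => /andP[c0 ct] E; exists c => //.
    by rewrite !ger0_norm.
  have [c] := MVT_segment (ltW t0) (fun s _ => D s) (cD _ _).
  rewrite in_itv /= scale0r addr0 sub0r => /andP[c0 ct] E; exists c.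
    by rewrite !ler0_norm ?lerN2// ltW.
  by rewrite -opprB E mulrN opprK.
rewrite E mulrC -mulrBr normrM mulrC ler_wpM2r//.
by apply: Pt; exact: le_lt_trans td.
Qed.

End SmoothCompactSupport.

Section DirectionalCalculus.
Variable R : realType.
Implicit Types (l : 'I_4) (y v : quat R).

Lemma is_derive_from_line (u : quat R -> R) y v (d : R) :
  is_derive (0 : R) (1 : R) (fun s : R => u (y + s *: v)) d -> is_derive y v u d.
Proof.
move=> [du <-].
have E : (fun h : R => h^-1 *: (u (h *: v + y) - u y)) =
    (fun h : R => h^-1 *: (u (y + (h *: 1 + 0) *: v) - u (y + 0 *: v))).
  by apply/funext => h; rewrite scale0r !addr0 [h *: 1]mulr1 (addrC y).
by split; rewrite /derivable /derive /= E.
Qed.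

Lemma is_derive_chain (u : quat R -> R) (g : R -> R) y v (d d' : R) :
  is_derive y v u d -> is_derive (u y) (1 : R) g d' ->
  is_derive y v (fun z => g (u z)) (d' * d).
Proof.
move=> du dg; apply: is_derive_from_line.
have dl : is_derive (0 : R) (1 : R) (fun s : R => u (y + s *: v)) d.
  by apply: is_derive_line; rewrite scale0r addr0.
have dg' : is_derive (u (y + (0 : R) *: v)) (1 : R) g d' by rewrite scale0r addr0.
exact: (is_derive1_comp dg' dl).
Qed.

Lemma is_derive_quad (u : R -> R) (s d C : R) :
  (forall h : R, `|h| <= 1 -> `|u (s + h) - u s - h * d| <= C * h ^+ 2) ->
  is_derive s (1 : R) u d.
Proof.
move=> hC.
suff L : (fun h : R => h^-1 *: (u (h *: 1 + s) - u s)) @ 0^' --> d.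
  by split; [apply/cvg_ex; exists d|exact: cvg_lim].
apply/cvgrPdist_le => e e0.
have C1 : 0 < `|C| + 1 by rewrite ltr_wpDl.
near=> h.
have h0 : h != 0 by near: h; exact: nbhs_dnbhs_neq.
have h1 : `|h| <= Num.min 1 (e / (`|C| + 1)).
  by near: h; apply: dnbhs0_le; rewrite lt_min ltr01 divr_gt0.
move: h1; rewrite le_min => /andP[h1 he].
have := hC h h1; rewrite [h *: 1]mulr1 [_ *: _]/(_ * _) (addrC h).
have -> : d - h^-1 * (u (s + h) - u s) = - (h^-1 * (u (s + h) - u s - h * d)).
  by field.
rewrite normrN normrM normfV => H; rewrite mulrC ler_pdivrMr ?normr_gt0//.
apply: (le_trans H); rewrite -(real_normK (num_real h)) expr2 mulrA ler_wpM2r//.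
apply: (@le_trans _ _ ((`|C| + 1) * `|h|)).
  by rewrite ler_wpM2r//; have := ler_norm C; lra.
by rewrite mulrC -ler_pdivlMr.
Unshelve. all: by end_near. Qed.

Definition pospow k (s : R) : R := Num.max s 0 ^+ k.

Lemma pospow_ge0 k s : 0 <= pospow k s.
Proof. by rewrite exprn_ge0// le_max lexx orbT. Qed.

Lemma pospow_neg k s : s <= 0 -> pospow k.+1 s = 0.
Proof. by move=> s0; rewrite /pospow max_r// expr0n. Qed.

Lemma pospow_pos k s : 0 <= s -> pospow k s = s ^+ k.
Proof. by move=> s0; rewrite /pospow max_l. Qed.

Lemma pospow_cont k : continuous (pospow k).
Proof.
move=> s; rewrite /pospow.
have c : (fun s : R => Num.max s 0) @ s --> Num.max s 0.
  by apply: continuous_max; [exact: cvg_id|exact: cvg_cst].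
exact: (cvg_comp _ _ c (@exprn_continuous R k _)).
Qed.

#[global] Instance is_derive_pospow2 (s : R) : is_derive s (1 : R) (pospow 2) (2 * pospow 1 s).
Proof.
apply: (@is_derive_quad _ _ _ 1) => h _.
have [s0|s0] := leP 0 s; have [t0|t0] := leP 0 (s + h);
  rewrite ?(pospow_pos _ s0) ?(pospow_pos _ t0) ?(pospow_neg _ (ltW s0)) ?(pospow_neg _ (ltW t0)) ler_norml; apply/andP; split; nra.
Qed.

#[global] Instance is_derive_pospow3 (s : R) : is_derive s (1 : R) (pospow 3) (3 * pospow 2 s).
Proof.
apply: (@is_derive_quad _ _ _ (3 * `|s| + 3)) => h h1.
have q := ler_norm s; have q' := ler_norm (- s); rewrite normrN in q'.
move: h1; rewrite ler_norml => /andP[h1 h2].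
have hh := sqr_ge0 h.
have [s0|s0] := leP 0 s; have [t0|t0] := leP 0 (s + h);
  rewrite ?(pospow_pos _ s0) ?(pospow_pos _ t0) ?(pospow_neg _ (ltW s0)) ?(pospow_neg _ (ltW t0)) ler_norml.
- rewrite (ger0_norm s0); rewrite (_ : (s + h) ^+ 3 - s ^+ 3 - _ = (3 * s + h) * h ^+ 2); last by ring.
  by rewrite -mulNr !ler_wpM2r//; lra.
- rewrite (ger0_norm s0) (_ : _ - _ = s ^+ 2 * (- s - 3 * h)); last by ring.
  have a : 0 <= s ^+ 2 by exact: sqr_ge0.
  have b : 0 <= - s - 3 * h by lra.
  have c : s ^+ 2 <= h ^+ 2 by nra.
  have k : s ^+ 2 * (- s - 3 * h) <= h ^+ 2 * (- s - 3 * h) by rewrite ler_wpM2r.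
  have k2 : h ^+ 2 * (- s - 3 * h) <= h ^+ 2 * (3 * s + 3) by rewrite ler_wpM2l//; lra.
  have := mulr_ge0 a b; lra.
- rewrite !mulr0 !subr0.
  have b : 0 <= (s + h) ^+ 2 by exact: sqr_ge0.
  have c : (s + h) ^+ 2 <= h ^+ 2 by nra.
  have k : (s + h) ^+ 3 <= h ^+ 2 * (s + h) by rewrite exprS mulrC ler_wpM2r.
  have k2 : h ^+ 2 * (s + h) <= h ^+ 2 * (3 * `|s| + 3) by rewrite ler_wpM2l//; lra.
  have := exprn_ge0 3 t0; lra.
- rewrite !mulr0 !subr0; have : 0 <= (3 * `|s| + 3) * h ^+ 2 by rewrite mulr_ge0//; lra.
  lra.
Qed.

(** Derivatives of quaternion-valued functions are taken coordinate by coordinate,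
    so that the calculus of real-valued functions applies. *)
Definition dq y l (F : quat R -> quat R) (d : quat R) :=
  forall k, is_derive y (eq4 R l) (fun z => F z 0 k) (d 0 k).
Definition qcont (F : quat R -> quat R) := forall k, continuous (fun z => F z 0 k).

Lemma coord_cont k : continuous (fun z : quat R => z 0 k).
Proof. by move=> y; exact: coord_continuous. Qed.

Lemma is_derive_coord y v k : is_derive y v (fun z => z 0 k) (v 0 k).
Proof.
apply: is_derive_from_line; apply: (@is_derive_quad _ _ _ 0) => h _.
by rewrite !qcoordE (_ : _ - _ - _ = 0) ?normr0 ?mul0r//; ring.
Qed.

Lemma dq_mul y l A a B b : dq y l A a -> dq y l B b ->
  dq y l (fun z => A z *q B z) (a *q B y + A y *q b).
Proof.
move=> dA dB; have A0 := dA 0; have A1 := dA 1; have A2 := dA 2; have A3 := dA 3.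
have B0 := dB 0; have B1 := dB 1; have B2 := dB 2; have B3 := dB 3.
apply: ord4P.
- under eq_fun do rewrite mulq_0; apply: is_derive_eq.
  by qexpand; rewrite /GRing.scale /=; ring.
- under eq_fun do rewrite mulq_1; apply: is_derive_eq.
  by qexpand; rewrite /GRing.scale /=; ring.
- under eq_fun do rewrite mulq_2; apply: is_derive_eq.
  by qexpand; rewrite /GRing.scale /=; ring.
- under eq_fun do rewrite mulq_3; apply: is_derive_eq.
  by qexpand; rewrite /GRing.scale /=; ring.
Qed.

Lemma dq_cst y l c : dq y l (fun=> c) 0.
Proof. by move=> k; rewrite mxE; exact: is_derive_cst. Qed.

Lemma dq_scale y l (u : quat R -> R) (d : R) B b : is_derive y (eq4 R l) u d ->
  dq y l B b -> dq y l (fun z => u z *: B z) (d *: B y + u y *: b).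
Proof.
move=> du dB k; have Bk := dB k; under eq_fun do rewrite scaleqE.
by apply: is_derive_eq; qexpand; rewrite /GRing.scale /=; ring.
Qed.

Lemma dq_sub y l A a B b : dq y l A a -> dq y l B b ->
  dq y l (fun z => A z - B z) (a - b).
Proof.
move=> dA dB k; have Ak := dA k; have Bk := dB k.
by under eq_fun do rewrite addqE oppqE; apply: is_derive_eq; rewrite !mxE.
Qed.

Lemma dq_conj y l x : dq y l (fun z => qconj (z - x)) (qconj (eq4 R l)).
Proof.
have D k := is_derive_coord y (eq4 R l) k.
have D0 := D 0; have D1 := D 1; have D2 := D 2; have D3 := D 3.
rewrite /qconj => k; elim/ord4P: k;
by under eq_fun do rewrite !qcoordE; apply: is_derive_eq; rewrite !qcoordE ?subr0.
Qed.

Lemma is_derive_qnorm2 y l x :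
  is_derive y (eq4 R l) (fun z => qnorm2 (z - x)) (2 * (y - x) 0 l).
Proof.
have D k := is_derive_coord y (eq4 R l) k.
have D0 := D 0; have D1 := D 1; have D2 := D 2; have D3 := D 3.
rewrite /qnorm2; under eq_fun do rewrite !qcoordE.
apply: is_derive_eq; rewrite !eq4E /GRing.scale /=.
by elim/ord4P: l D D0 D1 D2 D3 => _ _ _ _ _; rewrite !qcoordE /=; ring.
Qed.

Lemma cont_add (u v : quat R -> R) : continuous u -> continuous v ->
  continuous (fun z => u z + v z).
Proof. by move=> cu cv y; exact: (cvgD (cu y) (cv y)). Qed.
Lemma cont_sub (u v : quat R -> R) : continuous u -> continuous v ->
  continuous (fun z => u z - v z).
Proof. by move=> cu cv y; exact: (cvgB (cu y) (cv y)). Qed.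
Lemma cont_mul (u v : quat R -> R) : continuous u -> continuous v ->
  continuous (fun z => u z * v z).
Proof. by move=> cu cv y; exact: (cvgM (cu y) (cv y)). Qed.
Lemma cont_cst (c : R) : continuous (fun _ : quat R => c).
Proof. exact: cst_continuous. Qed.

Lemma qcont_mul A B : qcont A -> qcont B -> qcont (fun z => A z *q B z).
Proof.
move=> cA cB k; elim/ord4P: k.
- under eq_fun do rewrite mulq_0.
  by apply: cont_sub; [apply: cont_sub; [apply: cont_sub|]|]; apply: cont_mul.
- under eq_fun do rewrite mulq_1.
  by apply: cont_sub; [apply: cont_add; [apply: cont_add|]|]; apply: cont_mul.
- under eq_fun do rewrite mulq_2.
  by apply: cont_add; [apply: cont_add; [apply: cont_sub|]|]; apply: cont_mul.
- under eq_fun do rewrite mulq_3.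
  by apply: cont_add; [apply: cont_sub; [apply: cont_add|]|]; apply: cont_mul.
Qed.

Lemma qcont_add A B : qcont A -> qcont B -> qcont (fun z => A z + B z).
Proof. by move=> cA cB k; under eq_fun do rewrite addqE; exact: cont_add. Qed.
Lemma qcont_sub A B : qcont A -> qcont B -> qcont (fun z => A z - B z).
Proof. by move=> cA cB k; under eq_fun do rewrite addqE oppqE; exact: cont_sub. Qed.
Lemma qcont_scale (u : quat R -> R) B : continuous u -> qcont B -> qcont (fun z => u z *: B z).
Proof. by move=> cu cB k; under eq_fun do rewrite scaleqE; exact: cont_mul. Qed.
Lemma qcont_cst c : qcont (fun=> c).
Proof. by move=> k; exact: cont_cst. Qed.
Lemma qcont_id : qcont id.
Proof. exact: coord_cont. Qed.
Lemma qcont_conj A : qcont A -> qcont (fun z => qconj (A z)).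
Proof.
move=> cA k; rewrite /qconj; elim/ord4P: k; under eq_fun do rewrite qcoordE.
- exact: cA.
- by move=> y; exact: (cvgN (cA _ y)).
- by move=> y; exact: (cvgN (cA _ y)).
- by move=> y; exact: (cvgN (cA _ y)).
Qed.
Lemma cont_qnorm2 A : qcont A -> continuous (fun z => qnorm2 (A z)).
Proof.
move=> cA; rewrite /qnorm2.
have h k : continuous (fun z => A z 0 k ^+ 2).
  by under eq_fun do rewrite expr2; exact: cont_mul.
by apply: cont_add => //; apply: cont_add => //; apply: cont_add.
Qed.
Lemma cont_comp (g : R -> R) (u : quat R -> R) : continuous g -> continuous u ->
  continuous (fun z => g (u z)).
Proof. by move=> cg cu y; exact: (cvg_comp _ _ (cu y) (cg (u y))). Qed.

End DirectionalCalculus.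

(** * Smooth radial cutoff functions *)

Section Cutoff.
Variable R : realType.
Implicit Types (l : 'I_4) (x y z : quat R) (a b : R).

(** A radial function equal to b^3 where |z|^4 <= a and to 0 where
    |z|^4 >= a + b^(1/3). The outer and inner cubes make it C^1 with a derivative
    that is again C^1; the fourth power of the norm makes the gradient a multiple
    of |z|^2 z, which cancels the singularity of the Cauchy kernel. *)
Definition bump a b z : R := pospow 3 (b - pospow 3 (qnorm2 z ^+ 2 - a)).
(** The weight with gradient of bump = - bwt |z|^2 z. *)
Definition bwt a b z : R := 36 * pospow 2 (b - pospow 3 (qnorm2 z ^+ 2 - a)) *
  pospow 2 (qnorm2 z ^+ 2 - a).

Lemma is_derive_rad a l x y : is_derive y (eq4 R l)
  (fun y => qnorm2 (y - x) ^+ 2 - a) (4 * qnorm2 (y - x) * (y - x) 0 l).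
Proof.
have D := is_derive_qnorm2 y l x; apply: is_derive_eq.
by rewrite /GRing.scale /=; ring.
Qed.

Lemma is_derive_inner a b l x y : is_derive y (eq4 R l)
  (fun y => b - pospow 3 (qnorm2 (y - x) ^+ 2 - a))
  (- (3 * pospow 2 (qnorm2 (y - x) ^+ 2 - a) * (4 * qnorm2 (y - x) * (y - x) 0 l))).
Proof.
have D := is_derive_rad a l x y.
have D' := is_derive_chain D (is_derive_pospow3 _).
by apply: is_derive_eq; ring.
Qed.

Lemma is_derive_bump a b l x y : is_derive y (eq4 R l) (fun y => bump a b (y - x))
  (- (bwt a b (y - x) * qnorm2 (y - x) * (y - x) 0 l)).
Proof.
have D := is_derive_chain (is_derive_inner a b l x y) (is_derive_pospow3 _).
by apply: is_derive_eq; rewrite /bwt; ring.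
Qed.

Definition bwt' a b l z : R := 36 *
  (- (2 * pospow 1 (b - pospow 3 (qnorm2 z ^+ 2 - a)) * (3 * pospow 2 (qnorm2 z ^+ 2 - a)
      * (4 * qnorm2 z * z 0 l))) * pospow 2 (qnorm2 z ^+ 2 - a)
   + pospow 2 (b - pospow 3 (qnorm2 z ^+ 2 - a))
     * (2 * pospow 1 (qnorm2 z ^+ 2 - a) * (4 * qnorm2 z * z 0 l))).

Lemma is_derive_bwt a b l x y : is_derive y (eq4 R l) (fun y => bwt a b (y - x))
  (bwt' a b l (y - x)).
Proof.
have D1 := is_derive_chain (is_derive_inner a b l x y) (is_derive_pospow2 _).
have D2 := is_derive_chain (is_derive_rad a l x y) (is_derive_pospow2 _).
rewrite /bwt; under eq_fun do rewrite -mulrA.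
by apply: is_derive_eq; rewrite /bwt' /GRing.scale /=; ring.
Qed.

Lemma qcont_shift x : qcont (fun z : quat R => z - x).
Proof.
move=> k; under eq_fun do rewrite addqE oppqE.
by apply: cont_sub; [exact: coord_cont|exact: cont_cst].
Qed.

Lemma cont_rad a x : continuous (fun y => qnorm2 (y - x) ^+ 2 - a).
Proof.
apply: cont_sub; last exact: cont_cst.
by under eq_fun do rewrite expr2; apply: cont_mul; apply: cont_qnorm2; exact: qcont_shift.
Qed.

Lemma cont_inner a b x :
  continuous (fun y => b - pospow 3 (qnorm2 (y - x) ^+ 2 - a)).
Proof.
apply: cont_sub; first exact: cont_cst.
exact: (cont_comp (@pospow_cont R 3) (@cont_rad a x)).
Qed.

Lemma cont_bump a b x : continuous (fun y => bump a b (y - x)).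
Proof. exact: (cont_comp (@pospow_cont R 3) (@cont_inner a b x)). Qed.

Lemma cont_bwt a b x : continuous (fun y => bwt a b (y - x)).
Proof.
rewrite /bwt; under eq_fun do rewrite -mulrA.
apply: cont_mul; first exact: cont_cst.
apply: cont_mul.
  exact: (cont_comp (@pospow_cont R 2) (@cont_inner a b x)).
exact: (cont_comp (@pospow_cont R 2) (@cont_rad a x)).
Qed.

Lemma cont_lin l x : continuous (fun y => 4 * qnorm2 (y - x) * (y - x) 0 l).
Proof.
apply: cont_mul; last exact: qcont_shift.
apply: cont_mul; first exact: cont_cst.
exact: (cont_qnorm2 (@qcont_shift x)).
Qed.

Lemma cont_bwt' a b l : continuous (bwt' a b l).
Proof.
have E : bwt' a b l = (fun y => bwt' a b l (y - 0)).
  by apply/funext => y; rewrite subr0.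
rewrite E /bwt'; apply: cont_mul; first exact: cont_cst.
have I1 k := cont_comp (@pospow_cont R k) (@cont_inner a b 0).
have I2 k := cont_comp (@pospow_cont R k) (@cont_rad a 0).
have C (c : R) : continuous (fun _ : quat R => c) by exact: cont_cst.
have L := @cont_lin l 0.
apply: cont_add.
  apply: cont_mul; last exact: I2.
  have N (u : quat R -> R) : continuous u -> continuous (fun y : quat R => - (u y) : R).
    by move=> cu y; exact: (cvgN (cu y)).
  apply: N; apply: cont_mul; first by apply: cont_mul.
  by apply: cont_mul => //; exact: cont_mul.
apply: cont_mul => //; apply: cont_mul => //; exact: cont_mul.
Qed.

Lemma bump_plateau a b z : 0 <= b -> qnorm2 z ^+ 2 <= a -> bump a b z = b ^+ 3.
Proof.
move=> b0 za; rewrite /bump (@pospow_neg _ 2 (_ ^+ 2 - a)) ?subr_le0// subr0.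
exact: pospow_pos.
Qed.

Lemma bwt_plateau a b z : qnorm2 z ^+ 2 <= a -> bwt a b z = 0.
Proof. by move=> za; rewrite /bwt (@pospow_neg _ 1 (_ ^+ 2 - a)) ?subr_le0// mulr0. Qed.

Lemma bwt_ge0 a b z : 0 <= bwt a b z.
Proof.
rewrite /bwt -mulrA; apply: mulr_ge0; first exact: ler0n.
by apply: mulr_ge0; exact: pospow_ge0.
Qed.

Lemma bump_ge0 a b z : 0 <= bump a b z.
Proof. exact: pospow_ge0. Qed.

Lemma inner_out a b z T : a <= T -> b <= (T - a) ^+ 3 -> T <= qnorm2 z ^+ 2 ->
  b - pospow 3 (qnorm2 z ^+ 2 - a) <= 0.
Proof.
move=> aT bT Tz; rewrite subr_le0; apply: (le_trans bT).
rewrite pospow_pos ?subr_ge0; last exact: le_trans Tz.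
rewrite lerXn2r ?nnegrE ?subr_ge0//; last by rewrite lerB.
exact: le_trans Tz.
Qed.

Lemma bump_out a b z T : a <= T -> b <= (T - a) ^+ 3 -> T <= qnorm2 z ^+ 2 ->
  bump a b z = 0.
Proof. by move=> aT bT Tz; rewrite /bump pospow_neg//; exact: inner_out Tz. Qed.

Lemma bwt_out a b z T : a <= T -> b <= (T - a) ^+ 3 -> T <= qnorm2 z ^+ 2 ->
  bwt a b z = 0.
Proof.
move=> aT bT Tz; rewrite /bwt (@pospow_neg _ 1 (b - _)) ?mulr0 ?mul0r//.
exact: inner_out Tz.
Qed.

Lemma bwt'_out a b l z T : a <= T -> b <= (T - a) ^+ 3 -> T <= qnorm2 z ^+ 2 ->
  bwt' a b l z = 0.
Proof.
move=> aT bT Tz; have h := inner_out aT bT Tz.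
by rewrite /bwt' !(pospow_neg _ h) mulr0 !mul0r oppr0 mul0r add0r mulr0.
Qed.

Lemma coord_qnorm2_sqr z l T : 0 <= T -> T <= `|z 0 l| -> T ^+ 4 <= qnorm2 z ^+ 2.
Proof.
move=> T0 Tz; have Tq := le_trans Tz (coord_le_qnorm z l).
by rewrite -sqr_qnorm -exprM lerXn2r ?nnegrE ?qnorm_ge0.
Qed.

End Cutoff.

(** * Means of quaternion-valued functions *)

Section QuaternionMean.
Variable R : realType.
Variable m : nat.
Implicit Types (F : quat R -> quat R) (l : 'I_4) (x y z : quat R).

Definition qmean F : quat R := \row_k mean m (fun y => F y 0 k).
Definition qbnd F := exists M : R, forall y, qnorm (F y) <= M.

Lemma qmeanE F k : qmean F 0 k = mean m (fun y => F y 0 k).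
Proof. by rewrite mxE. Qed.

Lemma qbnd_coord F k : qbnd F -> bnd (fun y => F y 0 k).
Proof. by move=> [M FM]; exists M => y; exact: le_trans (coord_le_qnorm _ _) (FM y). Qed.

Lemma coord_qbnd F : (forall k, bnd (fun y => F y 0 k)) -> qbnd F.
Proof.
move=> h; have [M0 h0] := h 0; have [M1 h1] := h 1; have [M2 h2] := h 2.
have [M3 h3] := h 3; exists (4 * (`|M0| + `|M1| + `|M2| + `|M3|)) => y.
have n0 := normr_ge0 M0; have n1 := normr_ge0 M1.
have n2 := normr_ge0 M2; have n3 := normr_ge0 M3.
apply: qnorm_le_coord; apply: ord4P.
- by have := le_trans (h0 y) (ler_norm _); lra.
- by have := le_trans (h1 y) (ler_norm _); lra.
- by have := le_trans (h2 y) (ler_norm _); lra.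
- by have := le_trans (h3 y) (ler_norm _); lra.
Qed.

Lemma qbndD F G : qbnd F -> qbnd G -> qbnd (fun y => F y + G y).
Proof.
move=> [M FM] [N GN]; exists (M + N) => y.
by apply: (le_trans (qnormD _ _)); exact: lerD.
Qed.

Lemma qbnd_mulr c F : qbnd F -> qbnd (fun y => F y *q c).
Proof.
by move=> [M FM]; exists (M * qnorm c) => y; rewrite qnormM ler_wpM2r ?qnorm_ge0.
Qed.

Lemma qbndZ (c : R) F : qbnd F -> qbnd (fun y => c *: F y).
Proof. by move=> [M FM]; exists (`|c| * M) => y; rewrite qnormZ ler_wpM2l. Qed.

Lemma qbnd_sum (I : finType) (F : I -> quat R -> quat R) :
  (forall i, qbnd (F i)) -> qbnd (fun y => \sum_i F i y).
Proof.
move=> /choice [M FM]; exists (\sum_i M i) => y.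
by apply: (le_trans (qnorm_sum _ _ _)); exact: ler_sum.
Qed.

Lemma qmeanD F G : qbnd F -> qbnd G ->
  qmean (fun y => F y + G y) = qmean F + qmean G.
Proof.
move=> bF bG; apply/rowP => k; rewrite addqE !qmeanE -meanD; try exact: qbnd_coord.
by congr (mean m _); apply/funext => y; rewrite addqE.
Qed.

Lemma qmeanZ (c : R) F : qbnd F -> qmean (fun y => c *: F y) = c *: qmean F.
Proof.
move=> bF; apply/rowP => k; rewrite scaleqE !qmeanE -meanZ; last exact: qbnd_coord.
by congr (mean m _); apply/funext => y; rewrite scaleqE.
Qed.

Lemma qmeanN F : qbnd F -> qmean (fun y => - F y) = - qmean F.
Proof.
move=> bF; rewrite -scaleN1r -qmeanZ//.
by congr qmean; apply/funext => y; rewrite scaleN1r.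
Qed.

Lemma qmeanB F G : qbnd F -> qbnd G ->
  qmean (fun y => F y - G y) = qmean F - qmean G.
Proof.
move=> bF bG; rewrite qmeanD ?qmeanN//.
by move: bG => [M GM]; exists M => y; rewrite qnormN.
Qed.

Lemma qmean_sum (I : finType) (F : I -> quat R -> quat R) :
  (forall i, qbnd (F i)) -> qmean (fun y => \sum_i F i y) = \sum_i qmean (F i).
Proof.
move=> bF; have H (s : seq I) :
  qbnd (fun y => \sum_(i <- s) F i y) /\
  qmean (fun y => \sum_(i <- s) F i y) = \sum_(i <- s) qmean (F i).
  elim: s => [|i s [IHb IH]].
    have E : (fun y => \sum_(i <- [::]) F i y) = (fun=> 0).
      by apply/funext => y; rewrite big_nil.
    rewrite E big_nil; split; first by exists 0 => y; rewrite qnorm0.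
    apply/rowP => k; rewrite qmeanE mxE; apply/eqP; rewrite -normr_le0.
    by apply: le_trans (@mean_norm _ _ _ 0 _) _ => [y|]; rewrite ?mxE ?normr0 ?mulr0.
  have E : (fun y => \sum_(j <- i :: s) F j y) = (fun y => F i y + \sum_(j <- s) F j y).
    by apply/funext => y; rewrite big_cons.
  rewrite E big_cons; split; first exact: qbndD.
  by rewrite qmeanD// IH.
exact: (H _).2.
Qed.

(** A product with a constant is a real linear combination of coordinates, so the
    constant passes through the mean. *)
Lemma qmean_mulr c F : qbnd F -> qmean (fun y => F y *q c) = qmean F *q c.
Proof.
move=> bF.
have E : (fun y => F y *q c) = (fun y => \sum_l F y 0 l *: (eq4 R l *q c)).
  apply/funext => y; rewrite {1}(quat_sum (F y)) mulq_suml.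
  by apply: eq_bigr => l _; rewrite scaleqAl.
rewrite E qmean_sum; last first.
  move=> l; have [M FM] := bF; exists (M * qnorm (eq4 R l *q c)) => y.
  by rewrite qnormZ ler_wpM2r ?qnorm_ge0//; exact: le_trans (coord_le_qnorm _ _) (FM y).
rewrite [in RHS](quat_sum (qmean F)) mulq_suml; apply: eq_bigr => l _.
rewrite scaleqAl; apply/rowP => k; rewrite qmeanE scaleqE qmeanE mulrC -meanZ.
  by congr mean; apply/funext => y; rewrite scaleqE mulrC.
exact: qbnd_coord.
Qed.

(** The mean of a quaternion is taken coordinatewise, which costs a factor 4. *)
Lemma qmean_norm F (w : quat R -> R) : bnd w -> (forall y, qnorm (F y) <= w y) ->
  qnorm (qmean F) <= 4 * mean m w.
Proof.
move=> bw Fw; have [M wM] := bw.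
have bF : qbnd F by exists M => y; apply: le_trans (Fw y) (le_trans (ler_norm _) (wM y)).
apply: qnorm_le_coord => k; rewrite qmeanE ler_norml.
have ck y : `|F y 0 k| <= w y by exact: le_trans (coord_le_qnorm _ _) (Fw y).
have bk := qbnd_coord k bF.
have bNw : bnd (fun y => -1 * w y) by exists M => y; rewrite mulN1r normrN.
rewrite -mulN1r -meanZ// !ler_mean// => y; have := ck y; rewrite ler_norml ?mulN1r => /andP[] //.
Qed.

End QuaternionMean.

(** * The regularized Cauchy kernel *)

Section Stokes.
Variable R : realType.
Implicit Types (F : quat R -> quat R) (l : 'I_4) (x y z : quat R).

(** The Cauchy kernel conj(z) / |z|^4 made smooth by adding e to |z|^2; for e = 0
    it is the kernel itself. [epsmass e] is its right divergence, which
    concentrates at the origin as e tends to 0. *)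
Definition epsker (e : R) z : quat R := (qnorm2 z + e)^-1 ^+ 2 *: qconj z.
Definition epsmass (e : R) z : R := 4 * e * (qnorm2 z + e)^-1 ^+ 3.
Definition epsker' (e : R) l z : quat R :=
  (- (4 * z 0 l * (qnorm2 z + e)^-1 ^+ 3)) *: qconj z +
  (qnorm2 z + e)^-1 ^+ 2 *: qconj (eq4 R l).

Lemma qnorm2_eps_neq0 (e : R) z : 0 < e -> qnorm2 z + e != 0.
Proof. by move=> e0; rewrite gt_eqF// ltr_wpDl// qnorm2_ge0. Qed.

Lemma is_derive_inv_eps (e : R) l x y : 0 < e -> is_derive y (eq4 R l)
  (fun y => (qnorm2 (y - x) + e)^-1)
  (- (2 * (y - x) 0 l * (qnorm2 (y - x) + e)^-1 ^+ 2)).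
Proof.
move=> e0; have D := is_derive_qnorm2 y l x.
have D2 : is_derive y (eq4 R l) (fun y => qnorm2 (y - x) + e) (2 * (y - x) 0 l).
  have D3 := is_derive_cst e y (eq4 R l).
  by rewrite -[X in is_derive _ _ _ X]addr0; exact: (is_deriveD D D3).
have n0 := qnorm2_eps_neq0 (y - x) e0.
have [dD eD] := D2.
split; first exact: derivableV.
by rewrite deriveV// eD /GRing.scale /= exprVn; ring.
Qed.

Lemma dq_epsker (e : R) l x y : 0 < e ->
  dq y l (fun y => epsker e (y - x)) (epsker' e l (y - x)).
Proof.
move=> e0; have D := is_derive_inv_eps l x y e0.
have D2 : is_derive y (eq4 R l) (fun y => (qnorm2 (y - x) + e)^-1 ^+ 2)
   (- (4 * (y - x) 0 l * (qnorm2 (y - x) + e)^-1 ^+ 3)).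
  by apply: is_derive_eq; rewrite /GRing.scale /=; ring.
exact: dq_scale D2 (dq_conj y l x).
Qed.

Lemma cont_inv (u : quat R -> R) : (forall y, u y != 0) -> continuous u ->
  continuous (fun y => (u y)^-1).
Proof. by move=> u0 cu y; exact: (cvgV (u0 y) (cu y)). Qed.

Lemma cont_exp (u : quat R -> R) k : continuous u -> continuous (fun y => u y ^+ k).
Proof. by move=> cu; exact: (cont_comp (@exprn_continuous R k) cu). Qed.

Lemma cont_inv_eps (e : R) x k : 0 < e ->
  continuous (fun y => (qnorm2 (y - x) + e)^-1 ^+ k).
Proof.
move=> e0; apply: cont_exp; apply: cont_inv.
  by move=> y; exact: qnorm2_eps_neq0.
apply: cont_add; last exact: cont_cst.
exact: (cont_qnorm2 (@qcont_shift R x)).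
Qed.

Lemma qcont_epsker (e : R) x : 0 < e -> qcont (fun y => epsker e (y - x)).
Proof.
move=> e0; apply: qcont_scale; first exact: cont_inv_eps.
exact: (qcont_conj (@qcont_shift R x)).
Qed.

Lemma qcont_epsker' (e : R) l x : 0 < e -> qcont (fun y => epsker' e l (y - x)).
Proof.
move=> e0; apply: qcont_add; apply: qcont_scale.
- have E : (fun z => - (4 * (z - x) 0 l * (qnorm2 (z - x) + e)^-1 ^+ 3)) =
    (fun z => (-4 * (z - x) 0 l) * (qnorm2 (z - x) + e)^-1 ^+ 3).
    by apply/funext => z; rewrite !mulNr.
  rewrite E; apply: cont_mul; last exact: cont_inv_eps.
  by apply: cont_mul; [exact: cont_cst|exact: qcont_shift].
- exact: (qcont_conj (@qcont_shift R x)).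
- exact: cont_inv_eps.
- exact: qcont_cst.
Qed.

Lemma epsker_div (e : R) z : 0 < e ->
  \sum_l epsker' e l z *q eq4 R l = epsmass e z *: q1.
Proof.
move=> e0; have n0 := qnorm2_eps_neq0 z e0.
rewrite /epsker' /epsmass; set s := (qnorm2 z + e)^-1.
transitivity ((- (4 * s ^+ 3)) *: (qconj z *q z) + \sum_(l < 4) s ^+ 2 *: (q1 : quat R)).
  have -> : qconj z *q z = \sum_l z 0 l *: (qconj z *q eq4 R l).
    by rewrite {2}(quat_sum z) mulq_sumr; apply: eq_bigr => l _; rewrite scaleqAr.
  rewrite scaler_sumr -big_split /=.
  apply: eq_bigr => l _; rewrite mulqDl !scaleqAl scalerA mulq_conjl.
  rewrite -sqr_qnorm qnorm_eq4 expr1n scale1r.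
  by congr (_ *: _ + _); ring.
rewrite mulq_conjl scalerA -scaler_suml -scalerDl; congr (_ *: _).
by rewrite sum_ord4 /s; field.
Qed.

(** C^1 functions supported in a cube. The partial derivatives are part of the data,
    so that [dirac] is an algebraic operation on them. *)
Definition C1c (L : R) F (F' : 'I_4 -> quat R -> quat R) :=
  [/\ forall l y, dq y l F (F' l y), qcont F, forall l, qcont (F' l),
      forall k, supp_in L (fun y => F y 0 k)
    & forall l k, supp_in L (fun y => F' l y 0 k)].

(** The left Cauchy-Riemann-Fueter operator applied to a function given by its
    partial derivatives. *)
Definition dirac (F' : 'I_4 -> quat R -> quat R) y : quat R :=
  \sum_l eq4 R l *q F' l y.

Variable m : nat.

Lemma supp_in_le (L L' : R) (u : quat R -> R) : L <= L' -> supp_in L u -> supp_in L' u.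
Proof. by move=> LL' su y l h; apply: (su y l); exact: le_trans h. Qed.

Lemma qcont_supp_bnd (L : R) F : qcont F -> (forall k, supp_in L (fun y => F y 0 k)) ->
  qbnd F.
Proof. by move=> cF sF; apply: coord_qbnd => k; exact: supp_bnd (cF k) (sF k). Qed.

Lemma qmean_deriv (L : R) l F (F' : quat R -> quat R) : L <= m%:R ->
  (forall y, dq y l F (F' y)) -> qcont F' ->
  (forall k, supp_in L (fun y => F y 0 k)) ->
  (forall k, supp_in L (fun y => F' y 0 k)) -> qmean m F' = 0.
Proof.
move=> Lm dF cF' sF sF'; apply/rowP => k; rewrite qmeanE mxE.
apply: (@mean_deriv _ _ l (fun y => F y 0 k)).
- by apply: (@unif_deriv_smooth _ _ _ _ L) => // y; exact: dF.
- exact: supp_in_le Lm (sF k).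
- exact: supp_bnd (cF' k) (sF' k).
Qed.

Lemma suppP (L : R) F : (forall k, supp_in L (fun y => F y 0 k)) <->
  (forall y l, L <= `|y 0 l| -> F y = 0).
Proof.
split=> [h y l yl|h k y l yl]; last by rewrite (h y l)// mxE.
by apply/rowP => k; rewrite mxE; exact: h yl.
Qed.

(** The Leibniz rule for kernel times F, summed over the axes: the mean of each
    partial derivative is zero. *)
Lemma stokes (e L : R) x F (F' : 'I_4 -> quat R -> quat R) : 0 < e -> L <= m%:R -> C1c L F F' ->
  qmean m (fun y => epsmass e (y - x) *: F y) =
  - qmean m (fun y => epsker e (y - x) *q dirac F' y).
Proof.
move=> e0 Lm [dF cF cF' /suppP sF sF'].
have {}sF' l y j : L <= `|y 0 j| -> F' l y = 0.
  by move/suppP: (sF' l); exact.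
pose W' l y := epsker' e l (y - x) *q eq4 R l *q F y +
  epsker e (y - x) *q eq4 R l *q F' l y.
have cK l : qcont (fun y => epsker e (y - x) *q eq4 R l).
  by apply: qcont_mul; [exact: qcont_epsker|exact: qcont_cst].
have cK' l : qcont (fun y => epsker' e l (y - x) *q eq4 R l).
  by apply: qcont_mul; [exact: qcont_epsker'|exact: qcont_cst].
have cA l : qcont (fun y => epsker' e l (y - x) *q eq4 R l *q F y) by exact: qcont_mul.
have cB l : qcont (fun y => epsker e (y - x) *q eq4 R l *q F' l y) by exact: qcont_mul.
have bA l : qbnd (fun y => epsker' e l (y - x) *q eq4 R l *q F y).
  apply: (@qcont_supp_bnd L) => //; apply/suppP => y j /(sF y j) ->.
  by rewrite mulq0.
have bB l : qbnd (fun y => epsker e (y - x) *q eq4 R l *q F' l y).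
  apply: (@qcont_supp_bnd L) => //; apply/suppP => y j /(sF' l y j) ->.
  by rewrite mulq0.
have z l : qmean m (W' l) = 0.
  apply: (@qmean_deriv L l (fun y => epsker e (y - x) *q eq4 R l *q F y)) => //.
  - move=> y; have DK := dq_mul (dq_epsker l x y e0) (dq_cst y l (eq4 R l)).
    by have := dq_mul DK (dF l y); rewrite mulq0 addr0.
  - exact: qcont_add.
  - by apply/suppP => y j /(sF y j) ->; rewrite mulq0.
  - by apply/suppP => y j h; rewrite /W' (sF y j h) (sF' l y j h) !mulq0 addr0.
have EA : (fun y => epsmass e (y - x) *: F y) =
    (fun y => \sum_l epsker' e l (y - x) *q eq4 R l *q F y).
  by apply/funext => y; rewrite -mulq_suml epsker_div// scaleqAl mul1q.
have EB : (fun y => epsker e (y - x) *q dirac F' y) =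
    (fun y => \sum_l epsker e (y - x) *q eq4 R l *q F' l y).
  by apply/funext => y; rewrite /dirac mulq_sumr; apply: eq_bigr => l _; rewrite mulqA.
apply/eqP; rewrite -addr_eq0 EA EB -qmeanD; [|exact: qbnd_sum|exact: qbnd_sum].
have -> : (fun y => (\sum_l epsker' e l (y - x) *q eq4 R l *q F y) +
    \sum_l epsker e (y - x) *q eq4 R l *q F' l y) = (fun y => \sum_l W' l y).
  by apply/funext => y; rewrite -big_split.
by rewrite (qmean_sum m (fun l => qbndD (bA l) (bB l))) big1// => l _; exact: z.
Qed.

End Stokes.

(** * The Cauchy-Pompeiu formula *)

Section Pompeiu.
Variable R : realType.
Implicit Types (F G : quat R -> quat R) (l : 'I_4) (x y z : quat R).

Definition bump' (a b : R) x l y : quat R :=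
  (- (bwt a b (y - x) * qnorm2 (y - x) * (y - x) 0 l)) *: q1.

Lemma C1c_bump (a b T X : R) x : 0 <= T -> a <= T ^+ 4 -> b <= (T ^+ 4 - a) ^+ 3 ->
  (forall l, `|x 0 l| <= X) ->
  C1c (X + T) (fun y => bump a b (y - x) *: q1) (bump' a b x).
Proof.
move=> T0 aT bT xX.
have far y l : X + T <= `|y 0 l| -> T ^+ 4 <= qnorm2 (y - x) ^+ 2.
  move=> h; apply: (@coord_qnorm2_sqr _ _ l) => //; rewrite addqE oppqE.
  by have := lerB_normD (y 0 l) (- x 0 l); rewrite normrN; have := xX l; lra.
split.
- move=> l y; have := dq_scale (is_derive_bump a b l x y) (dq_cst y l (q1 : quat R)).
  by rewrite scaler0 addr0.
- by apply: qcont_scale; [exact: cont_bump|exact: qcont_cst].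
- move=> l; apply: qcont_scale; last exact: qcont_cst.
  have E : (fun y => - (bwt a b (y - x) * qnorm2 (y - x) * (y - x) 0 l)) =
    (fun y => -1 * (bwt a b (y - x) * qnorm2 (y - x) * (y - x) 0 l)).
    by apply/funext => y; rewrite mulN1r.
  rewrite E; apply: cont_mul; first exact: cont_cst.
  apply: cont_mul; last exact: qcont_shift.
  apply: cont_mul; first exact: cont_bwt.
  exact: (cont_qnorm2 (@qcont_shift R x)).
- by apply/suppP => y l /far h; rewrite (bump_out aT bT h) scale0r.
- by move=> l; apply/suppP => y j /far h; rewrite /bump' (bwt_out aT bT h) !mul0r oppr0 scale0r.
Qed.

Lemma dirac_bump (a b : R) x y :
  dirac (bump' a b x) y = (- (bwt a b (y - x) * qnorm2 (y - x))) *: (y - x).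
Proof.
rewrite /dirac /bump'; move: (y - x) => z; move: (bwt a b z * qnorm2 z) => k.
rewrite [in RHS](quat_sum z) scaler_sumr.
by apply: eq_bigr => l _; rewrite scaleqAr mulq1 scalerA mulNr.
Qed.

Lemma C1c_le (L L' : R) F (F' : 'I_4 -> quat R -> quat R) : L <= L' -> C1c L F F' -> C1c L' F F'.
Proof.
move=> LL [dF cF cF' sF sF']; split=> //; first by move=> k; exact: supp_in_le (sF k).
by move=> l k; exact: supp_in_le (sF' l k).
Qed.

Lemma C1c_comb (L c : R) d F (F' : 'I_4 -> quat R -> quat R) G (G' : 'I_4 -> quat R -> quat R) : C1c L F F' -> C1c L G G' ->
  C1c L (fun y => c *: F y - G y *q d) (fun l y => c *: F' l y - G' l y *q d).
Proof.
move=> [dF cF cF' /suppP sF sF'] [dG cG cG' /suppP sG sG'].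
have cc : continuous (fun _ : quat R => c) by exact: cont_cst.
split.
- move=> l y; apply: dq_sub.
    by have := dq_scale (is_derive_cst c y (eq4 R l)) (dF l y); rewrite scale0r add0r.
  by have := dq_mul (dG l y) (dq_cst y l d); rewrite mulq0 addr0.
- by apply: qcont_sub; [exact: qcont_scale|apply: qcont_mul => //; exact: qcont_cst].
- by move=> l; apply: qcont_sub; [exact: qcont_scale|apply: qcont_mul => //; exact: qcont_cst].
- by apply/suppP => y l h; rewrite (sF y l h) (sG y l h) scaler0 mul0q subr0.
- move=> l; apply/suppP => y j h.
  have /suppP /(_ y j h) -> := sF' l; have /suppP /(_ y j h) -> := sG' l.
  by rewrite scaler0 mul0q subr0.
Qed.

Lemma dirac_comb (c : R) d (F' G' : 'I_4 -> quat R -> quat R) y :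
  dirac (fun l y => c *: F' l y - G' l y *q d) y = c *: dirac F' y - dirac G' y *q d.
Proof.
rewrite /dirac scaler_sumr mulq_suml -sumrB; apply: eq_bigr => l _.
by rewrite mulqBr scaleqAr mulqA.
Qed.

Lemma qcont_dirac (L : R) F (F' : 'I_4 -> quat R -> quat R) : C1c L F F' -> qcont (dirac F').
Proof.
move=> [_ _ cF' _ _]; rewrite /dirac.
have E : (fun y => \sum_l eq4 R l *q F' l y) = (fun y => eq4 R 0 *q F' 0 y +
   eq4 R 1 *q F' 1 y + eq4 R 2 *q F' 2 y + eq4 R 3 *q F' 3 y).
  by apply/funext => y; rewrite sum_ord4.
have h l : qcont (fun y => eq4 R l *q F' l y) by apply: qcont_mul => //; exact: qcont_cst.
rewrite E; apply: qcont_add => //; apply: qcont_add => //.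
exact: qcont_add.
Qed.

Lemma dirac_supp (L : R) F (F' : 'I_4 -> quat R -> quat R) : C1c L F F' ->
  forall y l, L <= `|y 0 l| -> dirac F' y = 0.
Proof.
move=> [_ _ _ _ sF'] y l h; rewrite /dirac big1// => j _.
by have /suppP /(_ y l h) -> := sF' j; rewrite mulq0.
Qed.

Lemma dirac_bnd (L : R) F (F' : 'I_4 -> quat R -> quat R) : C1c L F F' -> qbnd (dirac F').
Proof.
move=> C; apply: (qcont_supp_bnd (qcont_dirac C)); apply/suppP; exact: dirac_supp C.
Qed.

Lemma epsker0_mul z : epsker 0 z *q z = (qnorm2 z)^-1 *: q1.
Proof.
rewrite /epsker addr0 scaleqAl mulq_conjl scalerA expr2 -mulrA.
have [->|n0] := eqVneq (qnorm2 z) 0; first by rewrite invr0 !mul0r.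
by rewrite mulVf// mulr1.
Qed.

Lemma epsker_diff (e d : R) z : 0 < e -> 0 < d -> d <= qnorm2 z ->
  qnorm (epsker e z - epsker 0 z) <= 2 * e * (d^-1 ^+ 3 + d^-1 ^+ 2).
Proof.
move=> e0 d0 dz; have n0 := lt_le_trans d0 dz; rewrite /epsker addr0 -scalerBl qnormZ.
rewrite qnorm_conj; set n := qnorm2 z in n0 dz *.
have qz : qnorm z <= 1 + n.
  have := sqr_qnorm z; rewrite -/n; have := qnorm_ge0 z; nra.
have ne0 : 0 < n + e by lra.
have -> : `|(n + e)^-1 ^+ 2 - n^-1 ^+ 2| = (2 * n * e + e ^+ 2) * ((n + e)^-1 ^+ 2 * n^-1 ^+ 2).
  rewrite distrC ger0_norm; first by field; rewrite !gt_eqF.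
  rewrite subr_ge0 lerXn2r ?nnegrE ?invr_ge0 ?(ltW n0) ?(ltW ne0)//.
  by rewrite lef_pV2 ?posrE//; lra.
have h1 : (2 * n * e + e ^+ 2) * ((n + e)^-1 ^+ 2 * n^-1 ^+ 2) <= 2 * e * n^-1 ^+ 3.
  rewrite -subr_ge0 (_ : _ - _ = n^-1 ^+ 3 * (n + e)^-1 ^+ 2 * (3 * e ^+ 2 * n + 2 * e ^+ 3)).
    by rewrite !mulr_ge0// ?exprn_ge0 ?invr_ge0 ?(ltW n0) ?(ltW ne0)//
      addr_ge0// !mulr_ge0// ?exprn_ge0 ?(ltW e0) ?(ltW n0).
  by field; rewrite !gt_eqF.
have i0 : 0 <= n^-1 by rewrite invr_ge0 ltW.
have id : n^-1 <= d^-1 by rewrite lef_pV2.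
apply: (@le_trans _ _ (2 * e * n^-1 ^+ 3 * (1 + n))).
  apply: ler_pM => //; last exact: qnorm_ge0.
  apply: mulr_ge0; last by apply: mulr_ge0; exact: sqr_ge0.
  by have := mulr_gt0 n0 e0; have := sqr_ge0 e; lra.
have -> : 2 * e * n^-1 ^+ 3 * (1 + n) = 2 * e * (n^-1 ^+ 3 + n^-1 ^+ 2).
  by field; rewrite gt_eqF.
rewrite ler_wpM2l//; first lra.
by apply: lerD; rewrite lerXn2r ?nnegrE ?invr_ge0 ?(ltW d0) ?(ltW n0).
Qed.

Lemma epsmass_ge0 (e : R) z : 0 <= e -> 0 <= epsmass e z.
Proof.
move=> e0; rewrite /epsmass; apply: mulr_ge0; first exact: mulr_ge0.
by apply: exprn_ge0; rewrite invr_ge0 addr_ge0 ?qnorm2_ge0.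
Qed.

Lemma epsmass_far (e d : R) z : 0 < e -> 0 < d -> d <= qnorm2 z ->
  epsmass e z <= 4 * e * d^-1 ^+ 3.
Proof.
move=> e0 d0 dz; rewrite /epsmass ler_wpM2l ?mulr_ge0 ?(ltW e0)//.
have ne0 : 0 < qnorm2 z + e by apply: lt_le_trans d0 _; lra.
rewrite lerXn2r ?nnegrE ?invr_ge0 ?(ltW ne0) ?(ltW d0)// lef_pV2 ?posrE//; lra.
Qed.

Variable m : nat.
(** The height is chosen so that the cutoff [bump 1 B0] has its support in the
    cube of half side 5 (as 5^4 >= 256 + 1) while its weight is at least 1 on the
    cell [1, 2]^4, where |z|^4 <= 256. *)
Definition B0 : R := 256 ^+ 3.
Lemma B0_gt0 : 0 < B0.
Proof. by apply: exprn_gt0; rewrite ltr0n. Qed.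
Definition psi x y : quat R := bump 1 B0 (y - x) *: q1.
Definition psi' x := bump' 1 B0 x.
Definition wt : quat R -> R := bwt 1 B0.

Lemma cube_le (b T : R) : 0 <= b -> b + 1 <= T -> b ^+ 3 <= (T - 1) ^+ 3.
Proof. by move=> b0 bT; rewrite lerXn2r ?nnegrE//; lra. Qed.

Lemma pow5_ge : (256 : R) + 1 <= 5 ^+ 4.
Proof. by rewrite -natrX -(natrD _ 256 1) ler_nat. Qed.

Lemma psi_C1c x (X : R) : (forall l, `|x 0 l| <= X) -> C1c (X + 5) (psi x) (psi' x).
Proof.
move=> h; have h5 := pow5_ge.
have T1 : (1 : R) <= 5 ^+ 4 by rewrite -natrX (ler_nat _ 1).
apply: C1c_bump => //.
exact: (cube_le (ler0n _ _) h5).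
Qed.

Lemma wt_bnd : exists2 M : R, 0 <= M & forall z, wt z <= M.
Proof.
have h5 := pow5_ge.
have T1 : (1 : R) <= 5 ^+ 4 by rewrite -natrX (ler_nat _ 1).
have TB : B0 <= (5 ^+ 4 - 1) ^+ 3.
  exact: (cube_le (ler0n _ _) h5).
have [M hM] : bnd wt.
  apply: (@supp_bnd _ _ 5).
    have := @cont_bwt R 1 (256 ^+ 3) 0; have E : (fun y => bwt 1 B0 (y - 0)) = wt.
      by apply/funext => y; rewrite subr0.
    by rewrite E.
  by move=> y l h; apply: (bwt_out T1 TB); exact: (coord_qnorm2_sqr _ h).
exists `|M| => // z; exact: le_trans (ler_norm _) (le_trans (hM z) (ler_norm _)).
Qed.

(** The mass that the regularized kernel puts near x is bounded independently of
    e: Stokes' formula for the bump replaces it by an integrand in which the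
    factor |z|^2 z cancels the kernel. *)
Lemma mass_bump_bnd (e X M : R) x : 0 < e -> (forall l, `|x 0 l| <= X) ->
  X + 5 <= m%:R -> (forall z, wt z <= M) ->
  `|mean m (fun y => epsmass e (y - x) * bump 1 B0 (y - x))| <= vol R m * M.
Proof.
move=> e0 xX Xm wM; have C := psi_C1c xX.
have := stokes x e0 Xm C => /(congr1 (fun q : quat R => q 0 0)).
rewrite oppqE !qmeanE /psi.
have -> : (fun y => (epsmass e (y - x) *: (bump 1 B0 (y - x) *: q1)) 0 0) =
   (fun y => epsmass e (y - x) * bump 1 B0 (y - x)).
  by apply/funext => y; rewrite !scaleqE /q1 mkq_0 mulr1.
move=> ->; rewrite normrN; apply: mean_norm => y; rewrite dirac_bump.
set z := y - x; rewrite scaleqAr /epsker scaleqAl mulq_conjl !scaleqE /q1 mkq_0 mulr1.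
have n0 := qnorm2_ge0 z; have ne : 0 < qnorm2 z + e by lra.
have -> : - (bwt 1 B0 z * qnorm2 z) * ((qnorm2 z + e)^-1 ^+ 2 * qnorm2 z) =
  - (wt z * (qnorm2 z / (qnorm2 z + e)) ^+ 2).
  by rewrite /wt; field; rewrite gt_eqF.
have w0 : 0 <= wt z by exact: bwt_ge0.
have q0 : 0 <= qnorm2 z / (qnorm2 z + e) by rewrite divr_ge0// ltW.
rewrite normrN ger0_norm; last by rewrite mulr_ge0// exprn_ge0.
apply: (le_trans _ (wM z)); rewrite -[leRHS]mulr1 ler_wpM2l// exprn_ile1//.
by rewrite ler_pdivrMr// mul1r; lra.
Qed.

Lemma cont_mass_bump_bnd (e X : R) x : 0 < e -> (forall l, `|x 0 l| <= X) ->
  bnd (fun y => epsmass e (y - x) * bump 1 B0 (y - x)).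
Proof.
move=> e0 xX; have [_ _ _ /suppP sp _] := psi_C1c xX.
apply: (@supp_bnd _ _ (X + 5)).
  apply: cont_mul; last exact: cont_bump.
  by apply: cont_mul; [exact: cont_cst|exact: cont_inv_eps].
move=> y l /sp /(congr1 (fun q : quat R => q 0 0)).
by rewrite /psi scaleqE /q1 mkq_0 mulr1 mxE => ->; rewrite mulr0.
Qed.

Lemma mean_cst (k : R) : mean m (fun=> k) = vol R m * k.
Proof. by apply: ulim_eq; under eq_fun do rewrite gsum_cst; exact: cvg_cst. Qed.

Lemma qcont_near F x (t : R) : qcont F -> 0 < t -> exists2 d : R, 0 < d &
  forall y, qnorm2 (y - x) < d -> qnorm (F y - F x) <= t.
Proof.
move=> cF t0.
have h k : \forall y \near x, `|F x 0 k - F y 0 k| <= t / 4.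
  by have /cvgrPdist_le := cF k x; apply; rewrite divr_gt0.
have /nbhs_ballP [d /= d0 dP] : \forall y \near x, forall k, `|F x 0 k - F y 0 k| <= t / 4.
  exact: (@filter_forall _ _ (fun k y => `|F x 0 k - F y 0 k| <= t / 4) _ _ h).
exists (d ^+ 2) => [|y]; first exact: exprn_gt0.
rewrite -sqr_qnorm ltr_pXn2r ?nnegrE ?qnorm_ge0 ?(ltW d0)// => yd.
have yb : ball x d y.
  rewrite -ball_normE /ball_ /= distrC; exact: le_lt_trans (mxnorm_le_qnorm _) yd.
rewrite qnormB; apply: (@le_trans _ _ (4 * (t / 4))).
  by apply: qnorm_le_coord => k; rewrite addqE oppqE; exact: dP.
by lra.
Qed.

(** Stokes' formula with e tending to 0. Near x the factor F is small because
    F x = 0, and the mass of the kernel is bounded there; away from x the mass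
    itself tends to 0. *)
Lemma pompeiu0 (L X d : R) x F (F' : 'I_4 -> quat R -> quat R) : C1c L F F' -> L <= m%:R ->
  (forall l, `|x 0 l| <= X) -> X + 5 <= m%:R -> F x = 0 ->
  0 < d -> (forall y, qnorm2 (y - x) < d -> dirac F' y = 0) ->
  qmean m (fun y => epsker 0 (y - x) *q dirac F' y) = 0.
Proof.
move=> C Lm xX Xm Fx d0 hd.
have [_ cF _ sF _] := C.
have [MF FM] := qcont_supp_bnd cF sF.
have [MD DM] := dirac_bnd C.
have [MW MW0 WM] := wt_bnd.
have MF0 : 0 <= MF := le_trans (qnorm_ge0 _) (FM 0).
have MD0 : 0 <= MD := le_trans (qnorm_ge0 _) (DM 0).
have V0 := vol_ge0 R m.
have B00 : 0 < B0 ^+ 3 by apply: exprn_gt0; exact: B0_gt0.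
apply/eqP; rewrite -qnorm_eq0 eq_le qnorm_ge0 andbT; apply/ler_addgt0Pr => t' t0.
rewrite add0r; set t : R := t' in t0 *.
pose A := 4 * (vol R m * MW) / B0 ^+ 3 + 1.
have A0 : 0 < A by rewrite ltr_wpDl// mulr_ge0 ?invr_ge0 ?(ltW B00)// !mulr_ge0.
have t2 : 0 < t / 2 by rewrite divr_gt0.
have tA : 0 < t / 2 / A by rewrite divr_gt0.
have [d1 d10 Fnear] := qcont_near x cF tA.
pose dd := Num.min d (Num.min d1 1).
have dd0 : 0 < dd by rewrite !lt_min d0 d10 ltr01.
have [ddd ddd1 dd1] : [/\ dd <= d, dd <= d1 & dd <= 1].
  by rewrite /dd !ge_min !lexx !orbT.
have i3 : 0 <= dd^-1 ^+ 3 by rewrite exprn_ge0// invr_ge0 ltW.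
pose K := dd^-1 ^+ 3 + dd^-1 ^+ 2.
have K0 : 0 <= K by rewrite addr_ge0// exprn_ge0// invr_ge0 ltW.
pose Q := 4 * (vol R m * (MF * (4 * dd^-1 ^+ 3))) + 4 * (vol R m * (2 * K * MD)) + 1.
have Q0 : 0 < Q.
  by rewrite ltr_wpDl// addr_ge0//; do !apply: mulr_ge0 => //.
pose e := t / 2 / Q.
have e0 : 0 < e by rewrite !divr_gt0.
have e00 := ltW e0.
have bE : qbnd (fun y => epsker e (y - x) *q dirac F' y).
  apply: (@qcont_supp_bnd _ L).
    by apply: qcont_mul; [exact: qcont_epsker|exact: qcont_dirac C].
  by apply/suppP => y l h; rewrite (dirac_supp C h) mulq0.
have diffP y : qnorm (epsker e (y - x) *q dirac F' y - epsker 0 (y - x) *q dirac F' y)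
    <= 2 * e * K * MD.
  rewrite -mulqBl qnormM; have [h|h] := ltP (qnorm2 (y - x)) dd.
    rewrite hd; last exact: lt_le_trans h ddd.
    by rewrite qnorm0 mulr0; do !apply: mulr_ge0 => //.
  by apply: ler_pM; rewrite ?qnorm_ge0//; exact: epsker_diff.
have b0 : qbnd (fun y => epsker 0 (y - x) *q dirac F' y).
  have [N EN] := bE; exists (2 * e * K * MD + N) => y.
  have -> : epsker 0 (y - x) *q dirac F' y = - (epsker e (y - x) *q dirac F' y -
      epsker 0 (y - x) *q dirac F' y) + epsker e (y - x) *q dirac F' y.
    by rewrite opprB subrK.
  by apply: (le_trans (qnormD _ _)); rewrite qnormN; exact: lerD.
have -> : qmean m (fun y => epsker 0 (y - x) *q dirac F' y) =
    - (qmean m (fun y => epsker e (y - x) *q dirac F' y - epsker 0 (y - x) *q dirac F' y))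
    - qmean m (fun y => epsmass e (y - x) *: F y).
  by rewrite qmeanB// (stokes x e0 Lm C) opprB opprK subrK.
apply: (le_trans (qnormD _ _)); rewrite !qnormN.
have bc (k : R) : bnd (fun _ : quat R => k) by exists `|k|.
have first : qnorm (qmean m (fun y => epsker e (y - x) *q dirac F' y -
    epsker 0 (y - x) *q dirac F' y)) <= 4 * (vol R m * (2 * e * K * MD)).
  by rewrite -mean_cst; apply: qmean_norm.
(* The majorant w adds the two regions: near x the plateau of the bump has height
   B0^3, so the first term is at least epsmass times the bound for F. *)
pose w y := (t / 2 / A / B0 ^+ 3) * (epsmass e (y - x) * bump 1 B0 (y - x)) +
  MF * (4 * e * dd^-1 ^+ 3).
have bmb := cont_mass_bump_bnd e0 xX.
have bw1 : bnd (fun y => (t / 2 / A / B0 ^+ 3) * (epsmass e (y - x) * bump 1 B0 (y - x))).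
  have [N hN] := bmb; exists (`|t / 2 / A / B0 ^+ 3| * N) => y.
  by rewrite normrM ler_wpM2l.
have bw : bnd w.
  have [N hN] := bw1; exists (N + `|MF * (4 * e * dd^-1 ^+ 3)|) => y.
  by apply: (le_trans (ler_normD _ _)); exact: lerD.
have tA0 : 0 <= t / 2 / A by rewrite !divr_ge0// ltW.
have second : qnorm (qmean m (fun y => epsmass e (y - x) *: F y)) <= 4 * mean m w.
  apply: qmean_norm => // y; rewrite qnormZ ger0_norm ?epsmass_ge0 ?(ltW e0)//.
  have m0 := epsmass_ge0 (y - x) (ltW e0).
  have far0 : 0 <= MF * (4 * e * dd^-1 ^+ 3).
    by do !apply: mulr_ge0 => //.
  have [h|h] := ltP (qnorm2 (y - x)) dd.
    have -> : w y = epsmass e (y - x) * (t / 2 / A) + MF * (4 * e * dd^-1 ^+ 3).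
      have p1 : qnorm2 (y - x) ^+ 2 <= 1.
        by rewrite exprn_ile1 ?qnorm2_ge0// (le_trans (ltW h)).
      rewrite /w (bump_plateau (ltW B0_gt0) p1); congr (_ + _).
      by rewrite mulrA mulrAC divfK ?gt_eqF// mulrC.
    rewrite -[leLHS]addr0 lerD// ler_wpM2l//.
    have := Fnear y (lt_le_trans h ddd1); by rewrite Fx subr0.
  rewrite -[leLHS]add0r lerD//.
    apply: mulr_ge0; last by apply: mulr_ge0 => //; exact: bump_ge0.
    by apply: divr_ge0 => //; exact: ltW.
  rewrite mulrC; apply: ler_pM => //; first exact: qnorm_ge0.
  exact: epsmass_far.
apply: (le_trans (lerD first second)).
rewrite meanD// meanZ// mean_cst.
have mb := mass_bump_bnd e0 xX Xm WM.
have h1 : (t / 2 / A / B0 ^+ 3) * mean m (fun y => epsmass e (y - x) * bump 1 B0 (y - x))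
    <= (t / 2 / A / B0 ^+ 3) * (vol R m * MW).
  apply: ler_wpM2l; first by apply: divr_ge0 => //; exact: ltW.
  exact: le_trans (ler_norm _) mb.
have h2 : 4 * ((t / 2 / A / B0 ^+ 3) * (vol R m * MW)) <= t / 2.
  have -> : 4 * ((t / 2 / A / B0 ^+ 3) * (vol R m * MW)) = (t / 2) * ((A - 1) / A).
    have -> : A - 1 = 4 * (vol R m * MW) / B0 ^+ 3 by rewrite /A addrK.
    by move: (A) => a; ring.
  rewrite -[leRHS]mulr1 ler_wpM2l ?(ltW t2)// ler_pdivrMr// mul1r; lra.
have h3 : 4 * (vol R m * (MF * (4 * e * dd^-1 ^+ 3))) + 4 * (vol R m * (2 * e * K * MD))
    <= t / 2.
  have -> : 4 * (vol R m * (MF * (4 * e * dd^-1 ^+ 3))) + 4 * (vol R m * (2 * e * K * MD))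
    = t / 2 * ((Q - 1) / Q).
    have -> : Q - 1 = 4 * (vol R m * (MF * (4 * dd^-1 ^+ 3))) + 4 * (vol R m * (2 * K * MD)).
      by rewrite /Q; ring.
    rewrite /e; move: (Q) Q0 => q q0; move: (dd^-1) => ddi; field; rewrite gt_eqF//.
  rewrite -[leRHS]mulr1 ler_wpM2l ?(ltW t2)// ler_pdivrMr// mul1r; lra.
lra.
Qed.

End Pompeiu.

Section CauchyPompeiu.
Variable R : realType.
Variable m : nat.
Implicit Types (F : quat R -> quat R) (l : 'I_4) (x y z : quat R).

Lemma wt_supp z l : 5 <= `|z 0 l| -> wt z = 0.
Proof.
move=> h; apply: (bwt_out _ _ (coord_qnorm2_sqr (ler0n _ 5) h)).
  by rewrite -natrX (ler_nat _ 1).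
exact: (cube_le (ler0n _ _) (pow5_ge R)).
Qed.

Lemma wt_step (X t : R) z l : X + 5 <= m%:R ->
  (forall j (s : R), 0 <= s <= 1 -> `|z 0 j + s * t * (j == l)%:R| <= X) ->
  mean m (fun y => wt (y - (z + t *: eq4 R l))) = mean m (fun y => wt (y - z)).
Proof.
move=> Xm hX.
have zX j : `|z 0 j| <= X.
  by have := hX j 0; rewrite !mul0r addr0 lexx ler01; apply.
have sh (s : R) : 0 <= s <= 1 ->
    supp_in m%:R (fun y : quat R => wt (y - (s * t) *: eq4 R l - z)).
  move=> s01 y j h; apply: (@wt_supp _ j); rewrite !qcoordE eq4E.
  have := lerB_normD (y 0 j) (- (z 0 j + s * t * (j == l)%:R)).
  rewrite normrN; have := hX j s s01; rewrite opprD addrA.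
  have -> : y 0 j - s * t * (j == l)%:R - z 0 j = y 0 j - z 0 j - s * t * (j == l)%:R.
    by rewrite addrAC.
  lra.
have cb : continuous (fun y => bwt' 1 (B0 R) l (y - z)).
  move=> y; have c0 : (fun y : quat R => y - z) @ y --> y - z.
    exact: (cvgB cvg_id (cvg_cst z)).
  exact: (cvg_comp _ _ c0 (@cont_bwt' R 1 (B0 R) l (y - z))).
have sb : supp_in m%:R (fun y => bwt' 1 (B0 R) l (y - z)).
  move=> y j h; have h5 : 5 <= `|(y - z) 0 j|.
    rewrite addqE oppqE; have := lerB_normD (y 0 j) (- z 0 j).
    by rewrite normrN; have := zX j; lra.
  apply: (bwt'_out l _ _ (coord_qnorm2_sqr (ler0n _ 5) h5)).
    by rewrite -natrX (ler_nat _ 1).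
  exact: (cube_le (ler0n _ _) (pow5_ge R)).
have [M M0 hM] := wt_bnd R.
have <- := @mean_translate1 R m l (fun y => wt (y - z))
  (fun y => bwt' 1 (B0 R) l (y - z)) t _ sh _ _; last 3 first.
- by apply: (@unif_deriv_smooth _ _ _ _ m%:R) => // y; exact: is_derive_bwt.
- by exists M => y; rewrite ger0_norm ?bwt_ge0.
- exact: supp_bnd cb sb.
by congr mean; apply/funext => y; rewrite opprD addrA addrAC.
Qed.

(** The constant of the Cauchy formula is the mean of the translated weight, so
    this makes it independent of the point. *)
Lemma mean_wt_translate (X : R) x : (forall l, `|x 0 l| <= X) -> X + 5 <= m%:R ->
  mean m (fun y => wt (y - x)) = mean m (@wt R).
Proof.
move=> xX Xm.
have X0 : 0 <= X := le_trans (normr_ge0 _) (xX 0).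
have sX (s a : R) : `|a| <= X -> 0 <= s <= 1 -> `|s * a| <= X.
  move=> aX /andP[s0 s1]; rewrite normrM (ger0_norm s0).
  by apply: le_trans aX; rewrite ler_piMl.
have E0 : mean m (fun y => wt (y - 0)) = mean m (@wt R).
  by congr mean; apply/funext => y; rewrite subr0.
rewrite -E0.
pose z1 : quat R := mkq (x 0 0) 0 0 0; pose z2 : quat R := mkq (x 0 0) (x 0 1) 0 0.
pose z3 : quat R := mkq (x 0 0) (x 0 1) (x 0 2) 0.
have -> : x = z3 + x 0 3 *: eq4 R 3 by rewrite /eq4 /= /z3; qring.
rewrite (wt_step Xm); last first.
  move=> j s s01; elim/ord4P: j; rewrite /z3 qcoordE /= ?mulr0 ?mulr1 ?addr0 ?add0r //.
  exact: sX.
have -> : z3 = z2 + x 0 2 *: eq4 R 2 by rewrite /eq4 /= /z3 /z2; qring.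
rewrite (wt_step Xm); last first.
  move=> j s s01; elim/ord4P: j; rewrite /z2 qcoordE /= ?mulr0 ?mulr1 ?addr0 ?add0r ?normr0 //.
  exact: sX.
have -> : z2 = z1 + x 0 1 *: eq4 R 1 by rewrite /eq4 /= /z2 /z1; qring.
rewrite (wt_step Xm); last first.
  move=> j s s01; elim/ord4P: j; rewrite /z1 qcoordE /= ?mulr0 ?mulr1 ?addr0 ?add0r ?normr0 //.
  exact: sX.
have -> : z1 = 0 + x 0 0 *: eq4 R 0 by rewrite /eq4 /= /z1; qring.
rewrite (wt_step Xm) // => j s s01.
elim/ord4P: j; rewrite qcoordE /= ?mulr0 ?mulr1 ?addr0 ?add0r ?normr0 //.
exact: sX.
Qed.

Lemma mean_wt_gt0 : (2 <= m)%N -> 0 < mean m (@wt R).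
Proof.
move=> m2; apply: (lt_le_trans ltr01); have [M M0 hM] := wt_bnd R.
apply: mean_ge => //.
- by exists M => y; rewrite ger0_norm ?bwt_ge0.
- by move=> y; exact: bwt_ge0.
move=> y hy.
have q l : 1 <= y 0 l ^+ 2 <= 4.
  have /andP[a b] := hy l; nra.
have [N1 N2] : 4 <= qnorm2 y /\ qnorm2 y <= 16.
  have /andP[a0 b0] := q 0; have /andP[a1 b1] := q 1.
  have /andP[a2 b2] := q 2; have /andP[a3 b3] := q 3.
  by rewrite /qnorm2; split; lra.
(* |y|^4 - 1 <= 16^2 - 1 *)
pose a : R := 255.
have E : B0 R = (a + 1) ^+ 3 by rewrite /B0 /a -(natrD _ 255 1).
rewrite /wt /bwt E; have a0 : 0 <= a by exact: ler0n.
set u := qnorm2 y ^+ 2 - 1.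
have u1 : 1 <= u by rewrite /u; nra.
have ua : u <= a.
  rewrite /u lerBlDr /a -(natrD _ 255 1) (_ : (255 + 1)%N = (16 ^ 2)%N)// natrX.
  by rewrite lerXn2r ?nnegrE ?qnorm2_ge0// ler0n.
move: (a) a0 ua => A A0 uA.
have k : 1 <= (A + 1) ^+ 3 - pospow 3 u.
  rewrite pospow_pos; last lra.
  have : u ^+ 3 <= A ^+ 3 by rewrite lerXn2r ?nnegrE//; lra.
  have -> : (A + 1) ^+ 3 = A ^+ 3 + 3 * A ^+ 2 + 3 * A + 1 by ring.
  have := sqr_ge0 A; lra.
rewrite (pospow_pos 2 (le_trans ler01 k)) (pospow_pos 2 (le_trans ler01 u1)).
have k2 : 1 <= ((A + 1) ^+ 3 - pospow 3 u) ^+ 2 by rewrite exprn_ege1.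
have u2 : 1 <= u ^+ 2 by rewrite exprn_ege1.
move: (((A + 1) ^+ 3 - pospow 3 u) ^+ 2) (u ^+ 2) k2 u2 => p q' p1 q1'.
nra.
Qed.

Lemma epsker0_bnd (d : R) z : 0 < d -> d <= qnorm2 z ->
  qnorm (epsker 0 z) <= d^-1 ^+ 2 + d^-1.
Proof.
move=> d0 dz; have n0 := lt_le_trans d0 dz; rewrite /epsker addr0 qnormZ qnorm_conj.
set n := qnorm2 z in n0 dz *.
have qz : qnorm z <= 1 + n.
  have := sqr_qnorm z; rewrite -/n; have := qnorm_ge0 z; nra.
have i0 : 0 <= n^-1 by rewrite invr_ge0 ltW.
have id : n^-1 <= d^-1 by rewrite lef_pV2.
rewrite ger0_norm ?sqr_ge0//.
apply: (@le_trans _ _ (n^-1 ^+ 2 * (1 + n))); first by rewrite ler_wpM2l ?sqr_ge0.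
have -> : n^-1 ^+ 2 * (1 + n) = n^-1 ^+ 2 + n^-1 by field; rewrite gt_eqF.
by rewrite lerD// lerXn2r ?nnegrE ?invr_ge0 ?(ltW d0) ?(ltW n0).
Qed.

Lemma epsker0_qbnd x (G : quat R -> quat R) (d : R) : 0 < d ->
  (forall y, qnorm2 (y - x) < d -> G y = 0) -> qbnd G ->
  qbnd (fun y => epsker 0 (y - x) *q G y).
Proof.
move=> d0 hd [M GM]; exists ((d^-1 ^+ 2 + d^-1) * M) => y.
have M0 : 0 <= M := le_trans (qnorm_ge0 _) (GM 0).
have i0 : 0 <= d^-1 by rewrite invr_ge0 ltW.
have [h|h] := ltP (qnorm2 (y - x)) d.
  by rewrite hd// mulq0 qnorm0 mulr_ge0// addr_ge0// sqr_ge0.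
by rewrite qnormM ler_pM ?qnorm_ge0//; exact: epsker0_bnd.
Qed.

(** Apply [pompeiu0] to B0^3 F minus the standard bump at x times F x, which
    vanishes at x. The kernel times the derivative of the bump is minus the
    weight, so the second term contributes the constant mean of the weight times
    F x. *)
Theorem pompeiu (L X d : R) x F (F' : 'I_4 -> quat R -> quat R) :
  C1c L F F' -> L <= m%:R -> (forall l, `|x 0 l| <= X) -> X + 5 <= m%:R ->
  0 < d -> (forall y, qnorm2 (y - x) < d -> dirac F' y = 0) ->
  B0 R ^+ 3 *: qmean m (fun y => epsker 0 (y - x) *q dirac F' y) =
  - (mean m (@wt R) *: F x).
Proof.
move=> C Lm xX Xm d0 hd.
have Cm := C1c_le Lm C; have Pm := C1c_le Xm (psi_C1c xX).
have CE := C1c_comb (B0 R ^+ 3) (F x) Cm Pm.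
have psix : psi x x = B0 R ^+ 3 *: q1.
  rewrite /psi bump_plateau ?(ltW (B0_gt0 R))//.
  by rewrite subrr /qnorm2 !mxE !expr0n /= !addr0 expr0n.
have psi0 y : qnorm2 (y - x) < Num.min d 1 -> dirac (psi' x) y = 0.
  rewrite lt_min => /andP[_ h1]; rewrite dirac_bump (@bwt_plateau _ 1).
    by rewrite mul0r oppr0 scale0r.
  by rewrite exprn_ile1 ?qnorm2_ge0// ltW.
have d1 : 0 < Num.min d 1 by rewrite lt_min d0 ltr01.
have := pompeiu0 CE (lexx _) xX Xm _ d1 _.
rewrite psix scaleqAl mul1q subrr => /(_ erefl).
have dE y := dirac_comb (B0 R ^+ 3) (F x) F' (psi' x) y.
have bF := epsker0_qbnd d0 hd (dirac_bnd C).
have bP := epsker0_qbnd d1 psi0 (dirac_bnd Pm).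
have EE : (fun y => epsker 0 (y - x) *q dirac (fun l y => B0 R ^+ 3 *: F' l y - psi' x l y *q F x) y)
  = (fun y => B0 R ^+ 3 *: (epsker 0 (y - x) *q dirac F' y) -
     (epsker 0 (y - x) *q dirac (psi' x) y) *q F x).
  by apply/funext => y; rewrite dE mulqBr scaleqAr mulqA.
rewrite EE qmeanB; [|exact: qbndZ|exact: qbnd_mulr].
rewrite qmeanZ// qmean_mulr// => H.
have {}H : B0 R ^+ 3 *: qmean m (fun y => epsker 0 (y - x) *q dirac F' y) =
   qmean m (fun y => epsker 0 (y - x) *q dirac (psi' x) y) *q F x.
  apply/eqP; rewrite -subr_eq0; apply/eqP; apply: H => y h.
  rewrite dE psi0// mul0q subr0 hd ?scaler0//.
  by move: h; rewrite lt_min => /andP[].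
rewrite H.
have -> : (fun y => epsker 0 (y - x) *q dirac (psi' x) y) =
    (fun y => (-1) *: (wt (y - x) *: q1)).
  apply/funext => y; rewrite dirac_bump scaleqAr epsker0_mul scalerA.
  rewrite scalerA; congr (_ *: _); rewrite /wt.
  have [z0|z0] := eqVneq (qnorm2 (y - x)) 0.
    have p : qnorm2 (y - x) ^+ 2 <= 1 by rewrite z0 expr0n.
    by rewrite (bwt_plateau _ p) mulr0 mul0r oppr0 mul0r.
  by rewrite mulN1r mulNr mulfK.
have bw : qbnd (fun y => wt (y - x) *: (q1 : quat R)).
  have [M M0 hM] := wt_bnd R; exists M => y.
  by rewrite qnormZ qnorm_q1 mulr1 ger0_norm ?bwt_ge0.
rewrite qmeanZ// scaleN1r mulNq; congr (- _).
have -> : qmean m (fun y => wt (y - x) *: q1) = mean m (@wt R) *: q1.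
  rewrite -(mean_wt_translate xX Xm); apply/rowP => k; rewrite qmeanE scaleqE mulrC -meanZ.
    by congr mean; apply/funext => y; rewrite scaleqE mulrC.
  by have [M M0 hM] := wt_bnd R; exists M => y; rewrite ger0_norm ?bwt_ge0.
by rewrite scaleqAl mul1q.
Qed.

End CauchyPompeiu.

(** * Cauchy representation of regular functions *)

Section Representation.
Variable R : realType.
Implicit Types (F : quat R -> quat R) (l : 'I_4) (x y z : quat R).

(** C^1 functions g with partial derivatives g' l that are left Fueter-regular on
    the open ball of radius r about 0. *)
Definition regular_ball (r : R) (g : quat R -> quat R) (g' : 'I_4 -> quat R -> quat R) :=
  forall y, qnorm y < r ->
    [/\ forall l, dq y l g (g' l y), forall k, {for y, continuous (fun z => g z 0 k)},
        forall l k, {for y, continuous (fun z => g' l z 0 k)} & dirac g' y = 0].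

Lemma qnorm_gt_nbhs (s : R) y : s < qnorm y -> \forall z \near y, s < qnorm z.
Proof.
move=> sy; have [s0|s0] := ltP s 0.
  by near=> z; exact: lt_le_trans s0 (qnorm_ge0 z).
have c : {for y, continuous (@qnorm2 R)} by exact: (cont_qnorm2 (@qcont_id R)).
have h : \forall z \near y, s ^+ 2 < qnorm2 z.
  by apply: (cvgr_gt _ c); rewrite -sqr_qnorm ltr_pXn2r ?nnegrE ?qnorm_ge0.
near=> z; rewrite -(@ltr_pXn2r _ 2) ?nnegrE ?qnorm_ge0// sqr_qnorm; near: z; exact: h.
Unshelve. all: by end_near. Qed.

Lemma is_derive_near0 (u : quat R -> R) y l :
  (\forall z \near y, u z = 0) -> is_derive y (eq4 R l) u 0.
Proof.
move=> u0; have h : \forall z \near y, (fun=> 0 : R) z = u z.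
  by near=> z; apply/esym; near: z.
exact: (near_eq_is_derive h (is_derive_cst 0 y (eq4 R l))).
Unshelve. all: by end_near. Qed.

Lemma cont_near0 (u : quat R -> R) y :
  (\forall z \near y, u z = 0) -> {for y, continuous u}.
Proof.
move=> u0; have uy : u y = 0 := nbhs_singleton u0.
have FF : Filter (nbhs y) by exact: nbhs_filter.
move=> A; rewrite uy => /= /nbhs_singleton A0.
by rewrite nbhs_simpl /=; apply: (@filterS _ _ FF _ _ _ u0) => z /= ->.
Qed.

(** Multiply g by a cutoff that is constant on the ball of radius rho. The result
    satisfies the Fueter equation there, so in the Cauchy-Pompeiu formula the
    density H lives in a spherical shell around it, and g x is recovered from
    values away from the singularity. *)
Lemma cauchy_rep (rho r : R) g g' : 0 < rho -> rho < r -> regular_ball r g g' ->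
  exists (m : nat) H, [/\ qbnd H, forall y, qnorm y <= rho -> H y = 0 &
    forall x, qnorm x < rho ->
      g x = qmean m (fun y => epsker 0 (y - x) *q H y)].
Proof.
move=> rho0 rr hg.
pose s := (rho + r) / 2; have [rs sr] : rho < s /\ s < r by rewrite /s; split; lra.
have s0 : 0 < s by lra.
pose a := rho ^+ 4; pose T := s ^+ 4; pose b := (T - a) ^+ 3.
have aT : a < T by rewrite /a /T ltr_pXn2r ?nnegrE// ltW.
have b0 : 0 < b by rewrite exprn_gt0// subr_gt0.
have out y : s <= qnorm y -> T <= qnorm2 y ^+ 2.
  by move=> sy; rewrite -sqr_qnorm -exprM lerXn2r ?nnegrE ?qnorm_ge0 ?(ltW s0).
have inn y : qnorm y <= rho -> qnorm2 y ^+ 2 <= a.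
  by move=> sy; rewrite -sqr_qnorm -exprM lerXn2r ?nnegrE ?qnorm_ge0 ?(ltW rho0).
have bmp0 y : s <= qnorm y -> bump a b y = 0.
  by move=> /out; exact: (bump_out (ltW aT) (lexx _)).
have bwt0 y : s <= qnorm y -> bwt a b y = 0.
  by move=> /out; exact: (bwt_out (ltW aT) (lexx _)).
pose F y := bump a b y *: g y.
pose F' l y := (- (bwt a b y * qnorm2 y * y 0 l)) *: g y + bump a b y *: g' l y.
have F0 y : s <= qnorm y -> F y = 0 by move=> h; rewrite /F bmp0// scale0r.
have F'0 l y : s <= qnorm y -> F' l y = 0.
  by move=> h; rewrite /F' bmp0// bwt0// !mul0r oppr0 !scale0r addr0.
have far y : ~~ (qnorm y < r) -> \forall z \near y, s <= qnorm z.
  rewrite -leNgt => ry; have : s < qnorm y by exact: lt_le_trans ry.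
  by move=> /qnorm_gt_nbhs; apply: filterS => z /ltW.
have db l y : is_derive y (eq4 R l) (bump a b) (- (bwt a b y * qnorm2 y * y 0 l)).
  have := is_derive_bump a b l 0 y; rewrite subr0.
  by under [X in is_derive _ _ X]eq_fun do rewrite subr0.
have E0 (u : quat R -> R) : (fun y => u (y - 0)) = u.
  by apply/funext => y; rewrite subr0.
have cb : continuous (bump a b) by have := @cont_bump R a b 0; rewrite E0.
have cw : continuous (bwt a b) by have := @cont_bwt R a b 0; rewrite E0.
have cn : continuous (@qnorm2 R) by exact: (cont_qnorm2 (@qcont_id R)).
have C : C1c r F F'.
  have sup y l : r <= `|y 0 l| -> s <= qnorm y.
    by move=> h; apply: (le_trans _ (coord_le_qnorm y l)); lra.
  split.
  - move=> l y; have [yr|yr] := boolP (qnorm y < r).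
      by have [dg _ _ _] := hg y yr; exact: dq_scale.
    move=> k; rewrite F'0 ?mxE; last exact: nbhs_singleton (far y yr).
    apply: is_derive_near0; apply: filterS (far y yr) => z h.
    by rewrite F0// mxE.
  - move=> k y; have [yr|yr] := boolP (qnorm y < r).
      have [_ cg _ _] := hg y yr; rewrite /F; under eq_fun do rewrite scaleqE.
      exact: (cvgM (cb y) (cg k)).
    apply: cont_near0; apply: filterS (far y yr) => z h.
    by rewrite F0// mxE.
  - move=> l k y; have [yr|yr] := boolP (qnorm y < r).
      have [_ cg cg' _] := hg y yr; rewrite /F'.
      under eq_fun do rewrite addqE !scaleqE.
      have c1 : {for y, continuous (fun z : quat R => bwt a b z * qnorm2 z * z 0 l)}.
        exact: (cvgM (cvgM (cw y) (cn y)) (@coord_cont R l y)).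
      exact: (cvgD (cvgM (cvgN c1) (cg k)) (cvgM (cb y) (cg' l k))).
    apply: cont_near0; apply: filterS (far y yr) => z h.
    by rewrite F'0// mxE.
  - by apply/suppP => y l /sup; exact: F0.
  - by move=> l; apply/suppP => y j /sup; exact: F'0.
pose H y := dirac F' y.
have HE y : H y = (- (bwt a b y * qnorm2 y)) *: (y *q g y).
  rewrite /H /dirac.
  have -> : \sum_l eq4 R l *q F' l y = (- (bwt a b y * qnorm2 y)) *: (y *q g y) +
      bump a b y *: dirac g' y.
    rewrite /dirac [y *q _](_ : _ = (\sum_l y 0 l *: eq4 R l) *q g y); last first.
      by rewrite -quat_sum.
    rewrite mulq_suml !scaler_sumr -big_split; apply: eq_bigr => l _ /=.
    by rewrite /F' mulqDr !scaleqAr scaleqAl scalerA mulNr.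
  have [yr|yr] := boolP (qnorm y < r).
    by have [_ _ _ ->] := hg y yr; rewrite scaler0 addr0.
  by rewrite bmp0 ?scale0r ?addr0//; exact: nbhs_singleton (far y yr).
have bH : qbnd H := dirac_bnd C.
have H0 y : qnorm y <= rho -> H y = 0.
  by move=> /inn h; rewrite HE (bwt_plateau _ h) mul0r oppr0 scale0r.
have [m rm] : exists m : nat, r + 5 <= m%:R.
  by exists (Num.truncn (r + 5)).+1; rewrite ltW// truncnS_gt.
have m2 : (2 <= m)%N by rewrite -(ler_nat R); lra.
have W0 := mean_wt_gt0 R m2; set W := mean m (@wt R) in W0.
have B30 : 0 < B0 R ^+ 3 by apply: exprn_gt0; exact: B0_gt0.
have b30 : 0 < b ^+ 3 by apply: exprn_gt0.
pose c := - (B0 R ^+ 3 / (W * b ^+ 3)).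
exists m, (fun y => c *: H y); split; first exact: qbndZ.
  by move=> y /H0 ->; rewrite scaler0.
move=> x xr; pose d := (rho - qnorm x) ^+ 2.
have d0 : 0 < d by rewrite exprn_gt0// subr_gt0.
have hd y : qnorm2 (y - x) < d -> H y = 0.
  rewrite -sqr_qnorm /d ltr_pXn2r ?nnegrE ?qnorm_ge0 ?subr_ge0 ?(ltW xr)// => h.
  by apply: H0; have := qnormD (y - x) x; rewrite subrK; lra.
have xX l : `|x 0 l| <= r by apply: (le_trans (coord_le_qnorm x l)); lra.
have rm' : r <= m%:R by lra.
have := pompeiu C rm' xX rm d0 hd; rewrite -/W => P.
have Fx : F x = b ^+ 3 *: g x.
  by rewrite /F (bump_plateau (ltW b0) (inn x (ltW xr))).
have bK := epsker0_qbnd d0 hd bH.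
have -> : (fun y => epsker 0 (y - x) *q (c *: H y)) =
    (fun y => c *: (epsker 0 (y - x) *q H y)).
  by apply/funext => y; rewrite scaleqAr.
rewrite qmeanZ//.
have -> : qmean m (fun y => epsker 0 (y - x) *q H y) = (- (W * b ^+ 3 / B0 R ^+ 3)) *: g x.
  apply: (@scalerI _ _ (B0 R ^+ 3)); first by rewrite gt_eqF.
  rewrite P Fx !scalerA -scaleNr; congr (_ *: _).
  by move: (B0 R ^+ 3) B30 => q q0; field; rewrite gt_eqF.
rewrite scalerA /c; move: (B0 R ^+ 3) B30 (b ^+ 3) b30 => q q0 p p0.
rewrite [X in X *: _](_ : _ = 1) ?scale1r//.
by field; rewrite !gt_eqF.
Qed.

End Representation.

(** * Expansion of the Cauchy kernel *)

Section FreeSeries.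
Variable R : realType.
Implicit Types (a b : seq 'I_4 -> quat R) (l : 'I_4) (x y z : quat R) (w : seq 'I_4).

(** Power series in four real variables, kept with one coefficient for each word of
    variables instead of each monomial: products and derivatives then have
    one-line recursions, and different coefficient families may have the same
    sum. [ev a k y] is the homogeneous part of degree k. *)
Fixpoint ev a k y : quat R :=
  if k is k'.+1 then \sum_l y 0 l *: ev (fun w => a (l :: w)) k' y else a [::].

Lemma evD a b k y : ev (fun w => a w + b w) k y = ev a k y + ev b k y.
Proof.
elim: k a b => [//|k IH] a b /=; rewrite -big_split; apply: eq_bigr => l _.
by rewrite IH scalerDr.
Qed.

Lemma ev_mull c a k y : ev (fun w => c *q a w) k y = c *q ev a k y.
Proof.
elim: k a => [//|k IH] a /=; rewrite mulq_sumr; apply: eq_bigr => l _.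
by rewrite (IH (fun w => a (l :: w))) scaleqAr.
Qed.

(** The recursion step of a geometric series in noncommuting variables. *)
Lemma ev_lin (c : 'I_4 -> quat R) a b k y :
  (forall l w, a (l :: w) = c l *q b w) ->
  ev a k.+1 y = (\sum_l y 0 l *: c l) *q ev b k y.
Proof.
move=> h; rewrite /= mulq_suml; apply: eq_bigr => l _.
rewrite scaleqAl -ev_mull; congr (_ *: _).
by congr ev; apply/funext => w; rewrite h.
Qed.

Lemma ev_lin_add (c : 'I_4 -> quat R) a b d k y :
  (forall l w, a (l :: w) = c l *q b w + d (l :: w)) ->
  ev a k.+1 y = (\sum_l y 0 l *: c l) *q ev b k y + ev d k.+1 y.
Proof.
move=> h; rewrite -(@ev_lin c (fun w => if w is l :: w' then c l *q b w' else 0) b)// -evD.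
rewrite /=; apply: eq_bigr => l _; congr (_ *: _).
by congr ev; apply/funext => w; rewrite h.
Qed.

Lemma sqr_step k (t K : R) : 0 <= t -> 0 <= K ->
  t * (k.+1%:R ^+ 2 * t ^+ k * K) + k.+2%:R * t ^+ k.+1 * K <=
  k.+2%:R ^+ 2 * t ^+ k.+1 * K.
Proof.
move=> t0 K0; rewrite (exprS t) -(natr1 k.+1).
have n0 : 0 <= k.+1%:R :> R by []; move: (k.+1%:R : R) n0 => n n0.
have T0 : 0 <= t * t ^+ k * K by rewrite !mulr_ge0// exprn_ge0.
have -> : t * (n ^+ 2 * t ^+ k * K) + (n + 1) * (t * t ^+ k) * K =
  (n ^+ 2 + (n + 1)) * (t * t ^+ k * K) by ring.
by rewrite -[leRHS]mulrA ler_wpM2r//; nra.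
Qed.

Section Geometric.
Variables (c : 'I_4 -> quat R) (kappa : quat R).

(** With q the linear form sum_l y_l c_l, the three families expand
    (1-q)^-1 kappa, conj(1-q)^-1 (1-q)^-1 kappa and
    (1-q)^-1 conj(1-q)^-1 (1-q)^-1 kappa in turn: each multiplies the previous
    one by a geometric series. *)
Fixpoint geoE w : quat R := if w is l :: w' then c l *q geoE w' else kappa.
Fixpoint geoU w : quat R :=
  if w is l :: w' then qconj (c l) *q geoU w' + geoE (l :: w') else kappa.
Fixpoint geoP w : quat R :=
  if w is l :: w' then c l *q geoP w' + geoU (l :: w') else kappa.

Variable y : quat R.
Let q := \sum_l y 0 l *: c l.

Lemma qconj_lin : \sum_l y 0 l *: qconj (c l) = qconj q.
Proof. by rewrite /q !sum_ord4; qring. Qed.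

Lemma ev_geoE k : ev geoE k.+1 y = q *q ev geoE k y.
Proof. exact: ev_lin. Qed.
Lemma ev_geoU k : ev geoU k.+1 y = qconj q *q ev geoU k y + ev geoE k.+1 y.
Proof. by rewrite -qconj_lin; exact: ev_lin_add. Qed.
Lemma ev_geoP k : ev geoP k.+1 y = q *q ev geoP k y + ev geoU k.+1 y.
Proof. exact: ev_lin_add. Qed.

Lemma ev_geoE_le (t : R) k : qnorm q <= t -> qnorm (ev geoE k y) <= t ^+ k * qnorm kappa.
Proof.
move=> qt; have t0 : 0 <= t := le_trans (qnorm_ge0 _) qt.
elim: k => [|k IH]; first by rewrite expr0 mul1r.
by rewrite ev_geoE qnormM exprS -mulrA ler_pM ?qnorm_ge0.
Qed.

Lemma ev_geoU_le (t : R) k : qnorm q <= t ->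
  qnorm (ev geoU k y) <= k.+1%:R * t ^+ k * qnorm kappa.
Proof.
move=> qt; have t0 : 0 <= t := le_trans (qnorm_ge0 _) qt.
elim: k => [|k IH]; first by rewrite expr0 !mul1r.
rewrite ev_geoU; apply: (le_trans (qnormD _ _)).
rewrite qnormM qnorm_conj -natr1 !mulrDl mul1r lerD ?ev_geoE_le//.
rewrite exprS (_ : _ * _ * _ = t * (k.+1%:R * t ^+ k * qnorm kappa)); last by ring.
by rewrite ler_pM ?qnorm_ge0.
Qed.

Lemma ev_geoP_le (t : R) k : qnorm q <= t ->
  qnorm (ev geoP k y) <= k.+1%:R ^+ 2 * t ^+ k * qnorm kappa.
Proof.
move=> qt; have t0 : 0 <= t := le_trans (qnorm_ge0 _) qt.
elim: k => [|k IH]; first by rewrite !expr1n expr0 !mul1r.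
rewrite ev_geoP; apply: (le_trans (qnormD _ _)).
rewrite qnormM; apply: (@le_trans _ _ (t * (k.+1%:R ^+ 2 * t ^+ k * qnorm kappa) +
  k.+2%:R * t ^+ k.+1 * qnorm kappa)).
  by rewrite lerD ?ev_geoU_le// ler_pM ?qnorm_ge0.
exact: (sqr_step k t0 (qnorm_ge0 _)).
Qed.

Lemma geo_sum (p u : nat -> quat R) (s : quat R) N :
  p 0%N = u 0%N -> (forall k, p k.+1 = s *q p k + u k.+1) ->
  (q1 - s) *q (\sum_(k < N.+1) p k) = \sum_(k < N.+1) u k - s *q p N.
Proof.
move=> p0 pS; elim: N => [|N IH].
  by rewrite !big_ord1 p0 mulqBl mul1q.
rewrite big_ord_recr [in RHS]big_ord_recr /= mulqDr IH mulqBl mul1q pS.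
by rewrite !addrA subrK.
Qed.

(** The three geometric recursions multiply up to (1-q) conj(1-q) (1-q). *)
Lemma geoP_sum N :
  (q1 - q) *q ((q1 - qconj q) *q ((q1 - q) *q (\sum_(k < N.+1) ev geoP k y))) =
  kappa - (q *q ev geoE N y + (q1 - q) *q (qconj q *q ev geoU N y)
    + (q1 - q) *q ((q1 - qconj q) *q (q *q ev geoP N y))).
Proof.
rewrite (@geo_sum (fun k => ev geoP k y) (fun k => ev geoU k y))//; last exact: ev_geoP.
rewrite mulqBr (@geo_sum (fun k => ev geoU k y) (fun k => ev geoE k y))//; last exact: ev_geoU.
rewrite !mulqBr (@geo_sum (fun k => ev geoE k y) (fun k => if k is 0 then kappa else 0))//;
  last first.
  by move=> k; rewrite addr0 ev_geoE.
by rewrite big_ord_recl big1 // addr0 !opprD !addrA.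
Qed.

(** Multiplying the remainder by (1-q) conj(1-q) (1-q) leaves the three boundary
    terms of the geometric recursions, and each factor has norm at least 1 - t. *)
Lemma geoP_tail (t : R) (Z : quat R) N : qnorm q <= t -> t < 1 ->
  (q1 - q) *q ((q1 - qconj q) *q ((q1 - q) *q Z)) = kappa ->
  qnorm (Z - \sum_(k < N.+1) ev geoP k y) <=
    7 * (N.+1%:R ^+ 2 * t ^+ N) * qnorm kappa / (1 - t) ^+ 3.
Proof.
move=> qt t1 hZ; have t0 : 0 <= t := le_trans (qnorm_ge0 _) qt.
have t3 : 0 < (1 - t) ^+ 3 by rewrite exprn_gt0// subr_gt0.
have A1 : 1 - t <= qnorm (q1 - q).
  by have := qnormD (q1 - q) q; rewrite subrK qnorm_q1; lra.
have A2 : qnorm (q1 - q) <= 2.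
  by apply: (le_trans (qnormD _ _)); rewrite qnormN qnorm_q1; lra.
have cA : q1 - qconj q = qconj (q1 - q) by qring.
have B1 : qnorm (q1 - qconj q) = qnorm (q1 - q) by rewrite cA qnorm_conj.
set D := Z - _.
have E : (q1 - q) *q ((q1 - qconj q) *q ((q1 - q) *q D)) =
   q *q ev geoE N y + (q1 - q) *q (qconj q *q ev geoU N y)
    + (q1 - q) *q ((q1 - qconj q) *q (q *q ev geoP N y)).
  by rewrite /D mulqBr (mulqBr _ _ (q1 - qconj q)) (mulqBr _ _ (q1 - q)) hZ geoP_sum
     opprB addrC subrK.
rewrite ler_pdivlMr//.
apply: (@le_trans _ _ (qnorm D * qnorm (q1 - q) ^+ 3)).
  rewrite ler_wpM2l ?qnorm_ge0// lerXn2r ?nnegrE ?qnorm_ge0// subr_ge0; exact: ltW.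
have -> : qnorm D * qnorm (q1 - q) ^+ 3 = qnorm ((q1 - q) *q ((q1 - qconj q) *q ((q1 - q) *q D))).
  by rewrite !qnormM B1; ring.
rewrite E; set T := t ^+ N * qnorm kappa.
have T0 : 0 <= T by rewrite mulr_ge0 ?exprn_ge0 ?qnorm_ge0.
have n1 : 1 <= N.+1%:R :> R by rewrite ler1n.
have e1 : qnorm (q *q ev geoE N y) <= T.
  rewrite qnormM -[leRHS]mul1r ler_pM ?qnorm_ge0//; first lra.
  exact: ev_geoE_le.
have e2 : qnorm ((q1 - q) *q (qconj q *q ev geoU N y)) <= 2 * (N.+1%:R * T).
  rewrite !qnormM qnorm_conj ler_pM ?mulr_ge0 ?qnorm_ge0//.
  rewrite -[leRHS]mul1r ler_pM ?qnorm_ge0//; first lra.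
  by rewrite /T mulrA; exact: ev_geoU_le.
have e3 : qnorm ((q1 - q) *q ((q1 - qconj q) *q (q *q ev geoP N y))) <= 2 * (2 * (N.+1%:R ^+ 2 * T)).
  rewrite !qnormM B1 ler_pM ?mulr_ge0 ?qnorm_ge0//.
  rewrite ler_pM ?mulr_ge0 ?qnorm_ge0//.
  rewrite -[leRHS]mul1r ler_pM ?qnorm_ge0//; first lra.
  by rewrite /T mulrA; exact: ev_geoP_le.
apply: (le_trans (qnormD _ _)).
apply: (le_trans (lerD (qnormD _ _) (lexx _))).
apply: (le_trans (lerD (lerD e1 e2) e3)).
have -> : 7 * (N.+1%:R ^+ 2 * t ^+ N) * qnorm kappa = 7 * (N.+1%:R ^+ 2 * T) by rewrite /T; ring.
have h1 : N.+1%:R * T <= N.+1%:R ^+ 2 * T.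
  by rewrite ler_wpM2r// expr2 ler_peMl// (le_trans ler01).
have h2 : T <= N.+1%:R ^+ 2 * T.
  by rewrite -[leLHS]mul1r ler_wpM2r// exprn_ege1.
lra.
Qed.

Lemma geoE_coef (C : R) w : (forall l, qnorm (c l) <= C) ->
  qnorm (geoE w) <= C ^+ size w * qnorm kappa.
Proof.
move=> cC; elim: w => [|l w IH] /=; first by rewrite expr0 mul1r.
by rewrite qnormM exprS -mulrA ler_pM ?qnorm_ge0.
Qed.

Lemma geoU_coef (C : R) w : (forall l, qnorm (c l) <= C) ->
  qnorm (geoU w) <= (size w).+1%:R * C ^+ size w * qnorm kappa.
Proof.
move=> cC; have C0 : 0 <= C := le_trans (qnorm_ge0 _) (cC 0).
elim: w => [|l w IH]; first by rewrite expr0 !mul1r.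
rewrite [geoU _]/=; apply: (le_trans (qnormD _ _)).
rewrite qnormM qnorm_conj -[(size _).+1%:R]natr1 !mulrDl mul1r lerD ?(geoE_coef (l :: w))//.
rewrite /= exprS (_ : _ * _ * _ = C * ((size w).+1%:R * C ^+ size w * qnorm kappa)); last by ring.
by rewrite ler_pM ?qnorm_ge0.
Qed.

Lemma geoP_coef (C : R) w : (forall l, qnorm (c l) <= C) ->
  qnorm (geoP w) <= (size w).+1%:R ^+ 2 * C ^+ size w * qnorm kappa.
Proof.
move=> cC; have C0 : 0 <= C := le_trans (qnorm_ge0 _) (cC 0).
elim: w => [|l w IH]; first by rewrite !expr1n expr0 !mul1r.
rewrite [geoP _]/=; apply: (le_trans (qnormD _ _)).
rewrite qnormM; apply: (@le_trans _ _ (C * ((size w).+1%:R ^+ 2 * C ^+ size w * qnorm kappa) +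
  (size w).+2%:R * C ^+ (size w).+1 * qnorm kappa)).
  by rewrite lerD ?(geoU_coef (l :: w))// ler_pM ?qnorm_ge0.
exact: (sqr_step (size w) C0 (qnorm_ge0 _)).
Qed.

End Geometric.
End FreeSeries.

(** * Power series of regular functions *)

Section Expansion.
Variable R : realType.
Implicit Types (a b : seq 'I_4 -> quat R) (l : 'I_4) (x y z : quat R) (w : seq 'I_4).

Lemma natr_exp_le (t : R) k : 0 <= t -> t < 1 -> k.+1%:R * t ^+ k <= (1 - t)^-1.
Proof.
move=> t0 t1; have t2 : 0 < 1 - t by rewrite subr_gt0.
rewrite -[leRHS]mul1r ler_pdivlMr//.
apply: (@le_trans _ _ ((\sum_(i < k.+1) t ^+ i) * (1 - t))).
  have -> : k.+1%:R * t ^+ k = \sum_(i < k.+1) t ^+ k.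
    by rewrite sumr_const card_ord mulr_natl.
  rewrite ler_wpM2r ?(ltW t2)//; apply: ler_sum => i _.
  by rewrite ler_wiXn2l ?(ltW t1)// -ltnS.
rewrite mulrC -opprB mulNr -subrX1 opprB gerBl exprn_ge0//.
Qed.

Lemma sqr_exp_bounded (t : R) : 0 <= t -> t < 1 ->
  exists2 C : R, 0 <= C & forall k, k.+1%:R ^+ 2 * t ^+ k <= C.
Proof.
move=> t0 t1; pose s := Num.sqrt t.
have s0 : 0 <= s by exact: sqrtr_ge0.
have s1 : s < 1 by rewrite -(@ltr_pXn2r _ 2) ?nnegrE// sqr_sqrtr// expr1n.
exists ((1 - s)^-1 ^+ 2) => [|k]; first exact: sqr_ge0.
have -> : k.+1%:R ^+ 2 * t ^+ k = (k.+1%:R * s ^+ k) ^+ 2.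
  by rewrite exprMn -exprM mulnC exprM sqr_sqrtr.
rewrite lerXn2r ?nnegrE ?natr_exp_le// ?mulr_ge0 ?exprn_ge0//.
by rewrite invr_ge0 subr_ge0 ltW.
Qed.

Lemma qmean_ev m (A : quat R -> seq 'I_4 -> quat R) k x :
  (forall w, qbnd (fun y => A y w)) ->
  qbnd (fun y => ev (A y) k x) /\
  ev (fun w => qmean m (fun y => A y w)) k x = qmean m (fun y => ev (A y) k x).
Proof.
elim: k A => [|k IH] A bA /=; first by split.
have h l := IH (fun y w => A y (l :: w)) (fun w => bA (l :: w)).
have hb l : qbnd (fun y => x 0 l *: ev (fun w => A y (l :: w)) k x).
  by apply: qbndZ; exact: (h l).1.
split; first exact: qbnd_sum.
rewrite qmean_sum//; apply: eq_bigr => l _; rewrite qmeanZ; last exact: (h l).1.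
by rewrite (h l).2.
Qed.

Lemma geoP0 (c : 'I_4 -> quat R) w : geoP c 0 w = 0.
Proof.
have E v : geoE c 0 v = 0 by elim: v => [//|l v /= ->]; rewrite mulq0.
have U v : geoU c 0 v = 0 by elim: v => [//|l v /= ->]; rewrite E !mulq0 addr0.
by elim: w => [//|l w /= ->]; rewrite E U !mulq0 !addr0.
Qed.

Lemma ev0 k x : ev (fun=> 0) k x = 0.
Proof. by elim: k => [//|k IH] /=; rewrite big1// => l _; rewrite IH scaler0. Qed.

(** With q = y^-1 x one has y - x = y (1 - q), so that the Cauchy kernel
   (y - x)^-1 / |y - x|^2 is (1-q)^-1 conj(1-q)^-1 (1-q)^-1 y^-1 / |y|^2 *)
Lemma epsker0_factor x y h : y != 0 -> qnorm x < qnorm y ->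
  let q := qinv y *q x in
  (q1 - q) *q ((q1 - qconj q) *q ((q1 - q) *q (epsker 0 (y - x) *q h))) =
  epsker 0 y *q h.
Proof.
move=> y0 xy q; set A := q1 - q.
have yA : y - x = y *q A by rewrite /A mulqBr mulq1 /q mulqA mulqV// mul1q.
have A0 : A != 0.
  apply/eqP => A0; move: yA; rewrite A0 mulq0 => /eqP; rewrite subr_eq0 => /eqP yx.
  by move: xy; rewrite yx ltxx.
have n0 : qnorm2 A != 0 by rewrite qnorm2_eq0.
have B : q1 - qconj q = qconj A by rewrite /A; qring.
have k0 : A *q epsker 0 (y - x) = (qnorm2 A)^-1 *: epsker 0 y.
  rewrite yA /epsker !addr0 scaleqAr qconjM mulqA mulq_conj qnorm2M scaleqAl mul1q !scalerA.
  congr (_ *: _); rewrite invfM exprMn -mulrA mulrC; congr (_ * _).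
  by rewrite expr2 -mulrA mulVf// mulr1.
by rewrite B mulqA mulq_conj (mulqA A) k0 !scaleqAl mul1q scalerA mulfV// scale1r.
Qed.

(** Expand the kernel under the mean in the Cauchy representation. For y outside
    the ball of radius s > rho the form q = y^-1 x has norm at most |x|/s, and the
    gap between rho and s absorbs the polynomial factors (k+1)^2. *)
Theorem regular_ball_expansion (rho r : R) g g' : 0 < rho -> rho < r ->
  regular_ball r g g' ->
  exists a (M : R), [/\ 0 <= M, forall w, qnorm (a w) <= M * rho^-1 ^+ size w,
    forall k x, qnorm (ev a k x) <= M * (qnorm x / rho) ^+ k &
    forall x, qnorm x < rho -> exists C : R, forall N,
      qnorm (g x - \sum_(k < N.+1) ev a k x) <= C * (qnorm x / rho) ^+ N].
Proof.
move=> rho0 rr hg; pose s := (rho + r) / 2.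
have [rs sr] : rho < s /\ s < r by rewrite /s; split; lra.
have s0 : 0 < s by lra.
have [m [H [[MH HM] H0 rep]]] := cauchy_rep s0 sr hg.
have MH0 : 0 <= MH := le_trans (qnorm_ge0 _) (HM 0).
pose c y l := qinv y *q eq4 R l; pose kap y := epsker 0 y *q H y.
have kap0 y : qnorm y <= s -> kap y = 0 by move=> /H0 h; rewrite /kap h mulq0.
pose K := ((s ^+ 2)^-1 ^+ 2 + (s ^+ 2)^-1) * MH.
have s20 : 0 < s ^+ 2 by rewrite exprn_gt0.
have K0 : 0 <= K by rewrite mulr_ge0// addr_ge0 ?sqr_ge0// invr_ge0 ltW.
have kapK y : qnorm (kap y) <= K.
  have [ys|ys] := leP (qnorm y) s; first by rewrite kap0// qnorm0.
  rewrite qnormM ler_pM ?qnorm_ge0//; apply: epsker0_bnd => //.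
  by rewrite -sqr_qnorm lerXn2r ?nnegrE ?qnorm_ge0 ?(ltW s0)// ltW.
pose A y := geoP (c y) (kap y).
have A0 y : qnorm y <= s -> A y = (fun=> 0).
  by move=> ys; apply/funext => w; rewrite /A kap0// geoP0.
have cC y l : s < qnorm y -> qnorm (c y l) <= s^-1.
  move=> ys; rewrite /c qnormM qnorm_eq4 mulr1 qnormV lef_pV2 ?posrE ?(ltW ys)//.
  exact: lt_trans ys.
have si0 : 0 <= s^-1 by rewrite invr_ge0 ltW.
have pos (n k : nat) (u : R) : 0 <= u -> 0 <= n%:R ^+ 2 * u ^+ k.
  by move=> u0; apply: mulr_ge0; [exact: sqr_ge0|exact: exprn_ge0].
have Aw y w : qnorm (A y w) <= (size w).+1%:R ^+ 2 * s^-1 ^+ size w * K.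
  have [ys|ys] := leP (qnorm y) s.
    by rewrite A0// qnorm0; apply: mulr_ge0 => //; exact: pos.
  apply: (le_trans (geoP_coef (kap y) w (fun l => cC y l ys))).
  by rewrite ler_wpM2l ?kapK// pos.
have linE y x : \sum_l x 0 l *: c y l = qinv y *q x.
  by rewrite [in RHS](quat_sum x) mulq_sumr; apply: eq_bigr => l _; rewrite scaleqAr.
have qle y x : s < qnorm y -> qnorm (\sum_l x 0 l *: c y l) <= qnorm x / s.
  move=> ys; rewrite linE qnormM qnormV mulrC ler_wpM2l ?qnorm_ge0// lef_pV2 ?posrE ?(ltW ys)//.
  exact: lt_trans ys.
have xs0 x : 0 <= qnorm x / s by rewrite mulr_ge0 ?qnorm_ge0.
have Ak y k x : qnorm (ev (A y) k x) <= k.+1%:R ^+ 2 * (qnorm x / s) ^+ k * K.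
  have [ys|ys] := leP (qnorm y) s.
    by rewrite A0// ev0 qnorm0; apply: mulr_ge0 => //; exact: pos.
  apply: (le_trans (ev_geoP_le (kap y) k (qle y x ys))).
  by rewrite ler_wpM2l ?kapK// pos.
pose a w := qmean m (fun y => A y w).
have bA w : qbnd (fun y => A y w) by exists ((size w).+1%:R ^+ 2 * s^-1 ^+ size w * K).
have aE k x := (qmean_ev m k x bA).2.
have bE k x := (qmean_ev m k x bA).1.
have bc (k : R) : bnd (fun _ : quat R => k) by exists `|k|.
have rs1 : rho / s < 1 by rewrite ltr_pdivrMr// mul1r.
have rs0 : 0 <= rho / s by rewrite divr_ge0 ?ltW.
have [C0 C00 hC] := sqr_exp_bounded rs0 rs1.
have V0 := vol_ge0 R m.
have M0 : 0 <= 4 * (vol R m * (C0 * K)) by do !apply: mulr_ge0 => //.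
have big (p u X : R) : p * u <= C0 -> 0 <= X ->
    4 * (vol R m * (p * (u * X) * K)) <= 4 * (vol R m * (C0 * K)) * X.
  move=> pu X0; rewrite (_ : 4 * _ = 4 * (vol R m * (p * u * K)) * X); last by ring.
  apply: ler_wpM2r => //; do 2 apply: ler_wpM2l => //; exact: ler_wpM2r.
exists a, (4 * (vol R m * (C0 * K))); split => //.
- move=> w; apply: (le_trans (qmean_norm m (bc _) (fun y => Aw y w))).
  rewrite mean_cst.
  have -> : s^-1 ^+ size w = (rho / s) ^+ size w * rho^-1 ^+ size w.
    by rewrite -exprMn mulrAC mulfV ?mul1r// gt_eqF.
  by apply: big => //; rewrite exprn_ge0// invr_ge0 ltW.
- move=> k x; rewrite /a aE; apply: (le_trans (qmean_norm m (bc _) (fun y => Ak y k x))).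
  rewrite mean_cst.
  have -> : (qnorm x / s) ^+ k = (rho / s) ^+ k * (qnorm x / rho) ^+ k.
    rewrite -exprMn; congr (_ ^+ _); field; rewrite !gt_eqF//.
  by apply: big => //; rewrite exprn_ge0// divr_ge0 ?qnorm_ge0 ?(ltW rho0).
move=> x xrho; have xs : qnorm x < s by exact: lt_trans rs.
pose t := qnorm x / s; have t1 : t < 1 by rewrite /t ltr_pdivrMr// mul1r.
have t0 : 0 <= t := xs0 x.
exists (4 * (vol R m * (7 * C0 * K / (1 - t) ^+ 3))) => N.
have d0 : 0 < (s - qnorm x) ^+ 2 by rewrite exprn_gt0// subr_gt0.
have hd y : qnorm2 (y - x) < (s - qnorm x) ^+ 2 -> H y = 0.
  rewrite -sqr_qnorm ltr_pXn2r ?nnegrE ?qnorm_ge0 ?subr_ge0 ?(ltW xs)// => h.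
  by apply: H0; have := qnormD (y - x) x; rewrite subrK; lra.
have bZ := epsker0_qbnd d0 hd (ex_intro _ MH HM).
have -> : g x - \sum_(k < N.+1) ev a k x =
    qmean m (fun y => epsker 0 (y - x) *q H y - \sum_(k < N.+1) ev (A y) k x).
  rewrite qmeanB//; last by apply: qbnd_sum => k; exact: bE.
  rewrite rep// qmean_sum; last by move=> k; exact: bE.
  by congr (_ - _); apply: eq_bigr => k _; rewrite /a aE.
have t3 : 0 < (1 - t) ^+ 3 by rewrite exprn_gt0// subr_gt0.
pose B := 7 * (N.+1%:R ^+ 2 * t ^+ N) * K / (1 - t) ^+ 3.
have B00 : 0 <= B.
  by rewrite divr_ge0 ?(ltW t3)// mulr_ge0// mulr_ge0// pos.
(* The difference of integrands vanishes for y in the ball of radius s, and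
   elsewhere it is the tail of the geometric expansion of the kernel. *)
apply: (@le_trans _ _ (4 * (vol R m * B))).
  rewrite -mean_cst; apply: qmean_norm => // y.
  have [ys|ys] := leP (qnorm y) s.
    by rewrite H0// A0// mulq0 sub0r big1 ?oppr0 ?qnorm0// => k _; exact: ev0.
  have yn0 : y != 0 by rewrite -qnorm_gt0; exact: lt_trans ys.
  have := @geoP_tail R (c y) (kap y) x t (epsker 0 (y - x) *q H y) N (qle y x ys) t1.
  rewrite linE => /(_ (epsker0_factor (H y) yn0 (lt_trans xs ys))) /le_trans; apply.
  rewrite /B ler_wpM2r ?invr_ge0 ?(ltW t3)// ler_wpM2l ?kapK//.
  by rewrite mulr_ge0// pos.
have tN : t ^+ N = (rho / s) ^+ N * (qnorm x / rho) ^+ N.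
  by rewrite -exprMn; congr (_ ^+ _); rewrite /t; field; rewrite !gt_eqF.
have h := hC N; rewrite /B tN; set X := (qnorm x / rho) ^+ N.
have X0 : 0 <= X by rewrite exprn_ge0// divr_ge0 ?qnorm_ge0 ?(ltW rho0).
set u := (rho / s) ^+ N in h *; set D := (1 - t) ^+ 3 in t3 *.
have Q0 : 0 <= 4 * (vol R m * (7 * (K / D))) * X.
  by apply: mulr_ge0 => //; do 3 apply: mulr_ge0 => //; rewrite divr_ge0// ltW.
rewrite [leLHS](_ : _ = (N.+1%:R ^+ 2 * u) * (4 * (vol R m * (7 * (K / D))) * X)); last by ring.
rewrite [leRHS](_ : _ = C0 * (4 * (vol R m * (7 * (K / D))) * X)); last by ring.
exact: ler_wpM2r.
Qed.

End Expansion.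

(** * Termwise differentiation of power series *)

Section FormalDerivative.
Variable R : realType.
Implicit Types (a b : seq 'I_4 -> quat R) (l : 'I_4) (x y z c : quat R) (w : seq 'I_4).

(** Coefficient of the word w in the l-th derivative: insert l in w at all
    positions. *)
Fixpoint dl l w b : quat R :=
  if w is m :: w' then b (l :: m :: w') + dl l w' (fun v => b (m :: v)) else b [:: l].
Definition dser l b : seq 'I_4 -> quat R := fun w => dl l w b.

Lemma dserD l a b : dser l (fun w => a w + b w) = (fun w => dser l a w + dser l b w).
Proof.
apply/funext => w; rewrite /dser; elim: w a b => [//|m w IH] a b /=.
by rewrite (IH (fun v => a (m :: v)) (fun v => b (m :: v))) addrACA.
Qed.

Lemma dser_mull l c a : dser l (fun w => c *q a w) = (fun w => c *q dser l a w).
Proof.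
apply/funext => w; rewrite /dser; elim: w a => [//|m w IH] a /=.
by rewrite (IH (fun v => a (m :: v))) mulqDr.
Qed.

Lemma dserC l m b : dser l (dser m b) = dser m (dser l b).
Proof.
apply/funext => w; rewrite /dser; elim: w b => [|p w IH] b /=; first by rewrite addrC.
have D k (u v : seq 'I_4 -> quat R) : dl k w (fun s => u s + v s) = dl k w u + dl k w v.
  by have := dserD k u v => /(congr1 (fun f => f w)).
rewrite !D IH.
rewrite !addrA; congr (_ + _).
rewrite [b (m :: _) + _]addrC -!addrA; congr (_ + _); congr (_ + _).
by rewrite addrC.
Qed.

(** The l-th partial derivative of the block [ev b k], as a function. *)
Fixpoint dev l b k y : quat R :=
  if k is k'.+1 then ev (fun w => b (l :: w)) k' y +
     \sum_m y 0 m *: dev l (fun w => b (m :: w)) k' y else 0.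

Lemma devS l b k y : dev l b k.+1 y = ev (dser l b) k y.
Proof.
elim: k b => [|k IH] b; first by rewrite /= big1 ?addr0// => m _; rewrite scaler0.
rewrite -[LHS]/(ev (fun w => b (l :: w)) k.+1 y +
   \sum_m y 0 m *: dev l (fun w => b (m :: w)) k.+1 y).
under [X in _ + X]eq_bigr do rewrite IH.
rewrite [ev _ k.+1 y]/= [RHS]/= -big_split; apply: eq_bigr => m _.
by rewrite /= -scalerDr -evD.
Qed.

Section Bounds.
Variables (s : R) (l : 'I_4) (y : quat R) (t : R).
Hypothesis s0 : 0 < s.
Hypothesis ys : forall m, `|y 0 m| <= s.
Hypothesis yts : forall m, `|(y + t *: eq4 R l) 0 m| <= s.

Lemma sum_le (u v : 'I_4 -> quat R) (K : R) : (forall m, `|u m 0 m| <= s) ->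
  (forall m, qnorm (v m) <= K) -> qnorm (\sum_m u m 0 m *: v m) <= 4 * s * K.
Proof.
move=> us vK; apply: (le_trans (qnorm_sum _ _ _)).
apply: (@le_trans _ _ (\sum_(m < 4) s * K)); last by rewrite sum_ord4; lra.
apply: ler_sum => m _; rewrite qnormZ ler_pM ?qnorm_ge0//.
Qed.

Lemma ev_le b k (B : R) : (forall w, size w = k -> qnorm (b w) <= B) ->
  qnorm (ev b k y) <= B * (4 * s) ^+ k.
Proof.
elim: k b => [|k IH] b hb /=; first by rewrite expr0 mulr1; exact: hb.
rewrite exprS mulrCA; apply: (@sum_le (fun=> y)) => // m.
by apply: IH => w hw; apply: hb; rewrite /= hw.
Qed.

Lemma evt_le b k (B : R) : (forall w, size w = k -> qnorm (b w) <= B) ->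
  qnorm (ev b k (y + t *: eq4 R l)) <= B * (4 * s) ^+ k.
Proof.
elim: k b => [|k IH] b hb /=; first by rewrite expr0 mulr1; exact: hb.
rewrite exprS mulrCA; apply: (@sum_le (fun=> y + t *: eq4 R l)) => // m.
by apply: IH => w hw; apply: hb; rewrite /= hw.
Qed.

Lemma evt_split b k : ev b k.+1 (y + t *: eq4 R l) =
  \sum_m y 0 m *: ev (fun w => b (m :: w)) k (y + t *: eq4 R l) +
  t *: ev (fun w => b (l :: w)) k (y + t *: eq4 R l).
Proof.
rewrite /=; under eq_bigr do rewrite addqE scalerDl.
rewrite big_split /=; congr (_ + _); rewrite (bigD1 l)//= scaleqE eq4E eqxx mulr1.
by rewrite big1 ?addr0// => m /negbTE ml; rewrite scaleqE eq4E ml mulr0 scale0r.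
Qed.

Lemma ev_diff_le b k (B : R) : (forall w, size w = k -> qnorm (b w) <= B) ->
  4 * s * qnorm (ev b k (y + t *: eq4 R l) - ev b k y) <=
  `|t| * k%:R * B * (4 * s) ^+ k.
Proof.
elim: k b => [|k IH] b hb; first by rewrite /= subrr qnorm0 !mulr0 !mul0r.
rewrite evt_split [ev b k.+1 y]/= addrAC -sumrB.
have hm m w : size w = k -> qnorm (b (m :: w)) <= B by move=> hw; apply: hb; rewrite /= hw.
have h1 := IH _ (hm _).
have h2 := evt_le (hm l).
pose K := `|t| * k%:R * B * (4 * s) ^+ k / (4 * s).
have s4 : 0 < 4 * s by rewrite mulr_gt0.
have e1 : qnorm (\sum_(i < 4) (y 0 i *: ev (fun w => b (i :: w)) k (y + t *: eq4 R l) -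
    y 0 i *: ev (fun w => b (i :: w)) k y)) <= 4 * s * K.
  under eq_bigr do rewrite -scalerBr.
  apply: (@sum_le (fun=> y)) => // m.
  by rewrite /K ler_pdivlMr// mulrC; exact: (h1 m).
apply: (@le_trans _ _ (4 * s * (4 * s * K + `|t| * (B * (4 * s) ^+ k)))).
  rewrite ler_wpM2l ?(ltW s4)//; apply: (le_trans (qnormD _ _)).
  by rewrite lerD// qnormZ ler_wpM2l.
rewrite le_eqVlt; apply/orP; left; apply/eqP.
rewrite /K -(natr1 k) exprS; move: (4 * s) s4 => q q0.
by field; rewrite gt_eqF.
Qed.

(** Second order Taylor remainder of a block along an axis, with a bound that is
    still summable over k. *)
Lemma ev_rem_le b k (B : R) : (forall w, size w = k -> qnorm (b w) <= B) ->
  (4 * s) ^+ 2 * qnorm (ev b k (y + t *: eq4 R l) - ev b k y - t *: dev l b k y) <=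
  t ^+ 2 * k%:R ^+ 2 * B * (4 * s) ^+ k.
Proof.
have s4 : 0 < 4 * s by rewrite mulr_gt0.
elim: k b => [|k IH] b hb.
  by rewrite /= subrr scaler0 subrr qnorm0 mulr0 expr0n /= mulr0 !mul0r.
have hm m w : size w = k -> qnorm (b (m :: w)) <= B by move=> hw; apply: hb; rewrite /= hw.
have B0 : 0 <= B by apply: le_trans (qnorm_ge0 _) (hm l (nseq k l) _); rewrite size_nseq.
set yt := y + t *: eq4 R l.
pose r (d : seq 'I_4 -> quat R) j := ev d j yt - ev d j y - t *: dev l d j y.
have E : ev b k.+1 yt - ev b k.+1 y - t *: dev l b k.+1 y =
   \sum_m y 0 m *: r (fun w => b (m :: w)) k +
   t *: (ev (fun w => b (l :: w)) k yt - ev (fun w => b (l :: w)) k y).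
  rewrite /yt evt_split -/yt [ev b k.+1 y]/= [dev l b k.+1 y]/= /r.
  under [in RHS]eq_bigr do rewrite !scalerBr.
  rewrite !sumrB scalerDr scalerBr scaler_sumr.
  have -> : \sum_(i < 4) y 0 i *: (t *: dev l (fun w => b (i :: w)) k y) =
     \sum_(i < 4) t *: (y 0 i *: dev l (fun w => b (i :: w)) k y).
    by apply: eq_bigr => i _; rewrite !scalerA mulrC.
  move: (\sum_m _) (\sum_i _) (\sum_i _) => X Y Z.
  move: (t *: ev _ k yt) (t *: ev _ k y) => V W.
  by apply/rowP => j; rewrite !mxE; ring.
have h1 m := IH _ (hm m).
have h2 := ev_diff_le (hm l).
pose K := t ^+ 2 * k%:R ^+ 2 * B * (4 * s) ^+ k / (4 * s) ^+ 2.
have e1 : qnorm (\sum_m y 0 m *: r (fun w => b (m :: w)) k) <= 4 * s * K.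
  apply: (@sum_le (fun=> y)) => // m.
  by rewrite /K ler_pdivlMr ?exprn_gt0// mulrC; exact: (h1 m).
have e2 : qnorm (ev (fun w => b (l :: w)) k yt - ev (fun w => b (l :: w)) k y) <=
    `|t| * k%:R * B * (4 * s) ^+ k / (4 * s).
  by rewrite ler_pdivlMr// mulrC.
rewrite E; apply: (@le_trans _ _ ((4 * s) ^+ 2 * (4 * s * K +
    `|t| * (`|t| * k%:R * B * (4 * s) ^+ k / (4 * s))))).
  rewrite ler_wpM2l ?sqr_ge0//; apply: (le_trans (qnormD _ _)).
  by rewrite lerD// qnormZ ler_wpM2l.
have tt : t ^+ 2 = `|t| ^+ 2 by rewrite real_normK ?num_real.
rewrite /K tt -(natr1 k) (exprS _ k).
have k0 : 0 <= k%:R :> R by [].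
move: (4 * s) (`|t|) (normr_ge0 t) s4 => q u u0 q0.
have -> : q ^+ 2 * (q * (u ^+ 2 * k%:R ^+ 2 * B * q ^+ k / q ^+ 2) +
   u * (u * k%:R * B * q ^+ k / q)) = (k%:R ^+ 2 + k%:R) * (u ^+ 2 * B * (q * q ^+ k)).
  by field; rewrite gt_eqF.
have -> : u ^+ 2 * (k%:R + 1) ^+ 2 * B * (q * q ^+ k) =
   (k%:R + 1) ^+ 2 * (u ^+ 2 * B * (q * q ^+ k)) by ring.
rewrite ler_wpM2r//; last by nra.
by rewrite !mulr_ge0// ?exprn_ge0 ?ltW.
Qed.

End Bounds.
End FormalDerivative.

Section LocalExpansion.
Variable R : realType.
Implicit Types (a b : seq 'I_4 -> quat R) (l : 'I_4) (x y z c : quat R) (w : seq 'I_4).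
Implicit Types (F G : quat R -> quat R) (S : set (quat R)).

Lemma qcvgP (u : nat -> quat R) (L : quat R) : u @ \oo --> L <->
  forall e : R, 0 < e -> exists N, forall n, (N <= n)%N -> qnorm (L - u n) <= e.
Proof.
split=> [/cvgrPdist_le h e e0|h].
  have /h [N _ hN] : 0 < e / 4 by rewrite divr_gt0.
  exists N => n /hN /= Ln; apply: (le_trans (qnorm_le_mxnorm _)); lra.
apply/cvgrPdist_le => e e0; have [N hN] := h e e0.
by exists N => // n /hN; exact: le_trans (mxnorm_le_qnorm _).
Qed.

Lemma qcvg_le (u : nat -> quat R) (L : quat R) (C : R) :
  (forall n, qnorm (u n) <= C) -> u @ \oo --> L -> qnorm L <= C.
Proof.
move=> uC /qcvgP h; apply/ler_addgt0Pr => e e0; have [N /(_ N (leqnn N)) hN] := h e e0.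
rewrite -(subrK (u N) L); apply: (le_trans (qnormD _ _)).
by rewrite addrC lerD.
Qed.

Lemma qcvg_unique (u : nat -> quat R) (L L' : quat R) :
  u @ \oo --> L -> u @ \oo --> L' -> L = L'.
Proof. by move=> h h'; apply: (cvg_unique _ h h'); exact: norm_hausdorff. Qed.

Lemma qcvg_mull c (u : nat -> quat R) (L : quat R) :
  u @ \oo --> L -> (fun n => c *q u n) @ \oo --> c *q L.
Proof.
move=> /qcvgP h; apply/qcvgP => e e0.
have c0 : 0 < qnorm c + 1 by rewrite ltr_wpDl ?qnorm_ge0.
have [N hN] := h (e / (qnorm c + 1)) (divr_gt0 e0 c0).
exists N => n /hN Ln; rewrite -mulqBr qnormM.
apply: (@le_trans _ _ (qnorm c * (e / (qnorm c + 1)))).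
  by rewrite ler_wpM2l ?qnorm_ge0.
by rewrite mulrA ler_pdivrMr// mulrC ler_wpM2l ?(ltW e0)// lerDl.
Qed.

Lemma series_mull c (u : nat -> quat R) : series (fun k => c *q u k) = (fun n => c *q series u n).
Proof. by apply/funext => n; rewrite /series /= mulq_sumr. Qed.

Lemma qseries_cvg (u : nat -> quat R) (C t : R) : 0 <= t -> t < 1 ->
  (forall k, qnorm (u k) <= C * t ^+ k) -> cvgn (series u).
Proof.
move=> t0 t1 uC.
have h l : cvgn (series (fun k => u k 0 l)).
  apply: normed_cvg; apply: (@series_le_cvg _ _ (fun k => C * t ^+ k)) => //.
  - by move=> k; exact: normr_ge0.
  - by move=> k; exact: le_trans (qnorm_ge0 _) (uC k).
  - by move=> k; exact: le_trans (coord_le_qnorm _ _) (uC k).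
  - by apply: is_cvg_geometric_series; rewrite ger0_norm.
apply/cvg_ex; exists (\row_l limn (series (fun k => u k 0 l))).
apply/qcvgP => e e0.
have : \forall n \near \oo, forall l,
    `|limn (series (fun k => u k 0 l)) - series (fun k => u k 0 l) n| <= e / 4.
  apply: filter_forall => l; have /cvgrPdist_le := h l; apply; exact: divr_gt0.
move=> [N _ hN]; exists N => n /hN /= hn.
apply: (@le_trans _ _ (4 * (e / 4))); last by lra.
apply: qnorm_le_coord => l; rewrite addqE oppqE mxE.
by have := hn l; rewrite /series /= summxE.
Qed.

Lemma is_derive_quadq F y v (d : quat R) (C r : R) : 0 < r ->
  (forall h : R, `|h| < r -> qnorm (F (y + h *: v) - F y - h *: d) <= C * h ^+ 2) ->
  is_derive y v F d.
Proof.
move=> r0 hC.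
suff L : (fun h : R => h^-1 *: (F (h *: v + y) - F y)) @ 0^' --> d.
  by split; [apply/cvg_ex; exists d|exact: cvg_lim].
apply/cvgrPdist_le => e e0.
have C1 : 0 < `|C| + 1 by rewrite ltr_wpDl.
near=> h.
have h0 : h != 0 by near: h; exact: nbhs_dnbhs_neq.
have hr : `|h| < r by near: h; exact: dnbhs0_lt.
have he : `|h| <= e / (`|C| + 1) by near: h; apply: dnbhs0_le; rewrite divr_gt0.
have := hC h hr; rewrite (addrC y).
have -> : d - h^-1 *: (F (h *: v + y) - F y) =
    (- h^-1) *: (F (h *: v + y) - F y - h *: d).
  move: (F (h *: v + y) - F y) => A.
  by rewrite scalerBr scalerA mulNr mulVf// scaleN1r opprK addrC scaleNr.
move=> H; apply: (le_trans (mxnorm_le_qnorm _)).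
rewrite qnormZ normrN normfV mulrC ler_pdivrMr ?normr_gt0//.
apply: (le_trans H); rewrite -(real_normK (num_real h)) expr2 mulrA ler_wpM2r//.
apply: (@le_trans _ _ ((`|C| + 1) * `|h|)).
  by rewrite ler_wpM2r//; have := ler_norm C; lra.
by rewrite mulrC -ler_pdivlMr.
Unshelve. all: by end_near. Qed.

Definition geobnd (M rho : R) b := forall w, qnorm (b w) <= M * rho^-1 ^+ size w.

(** Near 0 and on S, the function F is the sum of the series b. In the cube of half
    side rho/16 the blocks are bounded by M 4^-k, which leaves room for the
    polynomial factors that differentiation brings. *)
Definition hasexp S b F := exists M rho : R, [/\ 0 < rho, geobnd M rho b &
  forall y, S y -> (forall m, `|y 0 m| < rho / 16) -> series (ev b ^~ y) @ \oo --> F y].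

Lemma geobnd_le (M rho rho' : R) b : 0 < rho' -> rho' <= rho -> geobnd M rho b ->
  geobnd M rho' b.
Proof.
move=> r0 rr hb w; apply: (le_trans (hb w)).
have M0 : 0 <= M by have := le_trans (qnorm_ge0 _) (hb [::]); rewrite expr0 mulr1.
have rh : 0 < rho by exact: lt_le_trans rr.
rewrite ler_wpM2l// lerXn2r ?nnegrE ?invr_ge0 ?(ltW r0) ?(ltW rh)//.
by rewrite lef_pV2.
Qed.

Lemma hasexpD S a b F G : hasexp S a F -> hasexp S b G ->
  hasexp S (fun w => a w + b w) (fun y => F y + G y).
Proof.
move=> [M [r [r0 ha hF]]] [N [p [p0 hb hG]]].
pose q := Num.min r p; have q0 : 0 < q by rewrite lt_min r0 p0.
have [qr qp] : q <= r /\ q <= p by rewrite !ge_min !lexx orbT.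
exists (M + N), q; split=> // [w|y Sy hy].
  apply: (le_trans (qnormD _ _)); rewrite mulrDl lerD//.
    exact: (geobnd_le q0 qr ha).
  exact: (geobnd_le q0 qp hb).
have -> : series (ev (fun w => a w + b w) ^~ y) =
    (fun n => series (ev a ^~ y) n + series (ev b ^~ y) n).
  by apply/funext => n; rewrite /series /= -big_split; apply: eq_bigr => k _; rewrite evD.
apply: cvgD; [apply: hF|apply: hG] => // m; apply: (lt_le_trans (hy m)); lra.
Qed.

Lemma hasexp_mull S c b F : hasexp S b F -> hasexp S (fun w => c *q b w) (fun y => c *q F y).
Proof.
move=> [M [r [r0 hb hF]]]; exists (qnorm c * M), r; split=> // [w|y Sy hy].
  by rewrite qnormM -mulrA ler_wpM2l ?qnorm_ge0.
have -> : (ev (fun w => c *q b w) ^~ y) = (fun k => c *q ev b k y).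
  by apply/funext => k; rewrite ev_mull.
by rewrite series_mull; apply: qcvg_mull; exact: hF.
Qed.

Lemma dl_le (M rho : R) l w b : 0 < rho -> geobnd M rho b ->
  qnorm (dl l w b) <= (size w).+1%:R * M * rho^-1 ^+ (size w).+1.
Proof.
move=> r0; elim: w M b => [|m w IH] M b hb /=.
  by rewrite mul1r; exact: (hb [:: l]).
apply: (le_trans (qnormD _ _)).
have hm : geobnd (M * rho^-1) rho (fun v => b (m :: v)).
  by move=> v; apply: (le_trans (hb _)); rewrite exprS mulrA.
apply: (le_trans (lerD (hb _) (IH _ _ hm))); rewrite /= -[X in _ <= X * M * _]natr1.
by rewrite le_eqVlt; apply/orP; left; apply/eqP; rewrite (exprS _ (size w).+1); ring.
Qed.

Lemma geobnd_dser (M rho : R) l b : 0 < rho -> geobnd M rho b ->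
  geobnd (2 * M * rho^-1) (rho / 2) (dser l b).
Proof.
move=> r0 hb w; apply: (le_trans (dl_le l w r0 hb)).
have M0 : 0 <= M by have := le_trans (qnorm_ge0 _) (hb [::]); rewrite expr0 mulr1.
have h := @natr_exp_le R (2^-1) (size w).
have {}h : (size w).+1%:R * 2^-1 ^+ size w <= 2 :> R.
  apply: (le_trans (h _ _)); [by rewrite invr_ge0|lra|].
  by rewrite (_ : 1 - 2^-1 = 2^-1) ?invrK//; lra.
have -> : (rho / 2)^-1 ^+ size w = 2 ^+ size w * rho^-1 ^+ size w.
  by rewrite invfM invrK mulrC exprMn.
have -> : (size w).+1%:R * M * rho^-1 ^+ (size w).+1 =
   ((size w).+1%:R * 2^-1 ^+ size w) * (M * rho^-1 * (2 ^+ size w * rho^-1 ^+ size w)).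
  have h2 : (2^-1 : R) ^+ size w * 2 ^+ size w = 1 by rewrite -exprMn mulVf ?expr1n.
  rewrite (exprS rho^-1); move: h2.
  move: ((2^-1 : R) ^+ size w) ((2 : R) ^+ size w) (rho^-1 ^+ size w) => p q u h2.
  by move: ((size w).+1%:R : R) (rho^-1) => n v; rewrite -[LHS]mulr1 -h2; ring.
rewrite [leRHS](_ : _ = 2 * (M * rho^-1 * (2 ^+ size w * rho^-1 ^+ size w))); last by ring.
rewrite ler_wpM2r// mulr_ge0 ?mulr_ge0 ?exprn_ge0 ?invr_ge0 ?(ltW r0)//.
Qed.

Lemma geo_half_sum n : \sum_(0 <= k < n) (2^-1 : R) ^+ k <= 2.
Proof.
have : \sum_(0 <= k < n) (2^-1 : R) ^+ k = 2 - 2 * 2^-1 ^+ n.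
  elim: n => [|n IH]; first by rewrite big_nil expr0; lra.
  by rewrite big_nat_recr //= IH exprS; lra.
move=> ->; have : 0 <= (2^-1 : R) ^+ n by rewrite exprn_ge0// invr_ge0.
lra.
Qed.

(** Differentiation term by term: by [ev_rem_le] the remainders of the blocks sum
    to at most a constant times t^2. *)
Lemma hasexp_deriv S l b F : (forall y (t : R), S y -> S (y + t *: eq4 R l)) ->
  hasexp S b F -> hasexp S (dser l b) ('D_(eq4 R l) F) /\
  exists2 d : R, 0 < d & forall y, S y -> (forall m, `|y 0 m| < d) ->
    derivable F y (eq4 R l).
Proof.
move=> Sl [M [rho [r0 hb hF]]].
have M0 : 0 <= M by have := le_trans (qnorm_ge0 _) (hb [::]); rewrite expr0 mulr1.
pose s := rho / 16; have s0 : 0 < s by rewrite divr_gt0.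
have h12 : 0 <= (2^-1 : R) by rewrite invr_ge0.
have h12' : (2^-1 : R) < 1 by lra.
have [C0 C00 hC0] := sqr_exp_bounded h12 h12'.
pose bd k := M * rho^-1 ^+ k.
have hbd k w : size w = k -> qnorm (b w) <= bd k by move=> <-; exact: hb.
have q4 k : rho^-1 ^+ k * (4 * s) ^+ k = 2^-1 ^+ k * 2^-1 ^+ k.
  by rewrite -!exprMn; congr (_ ^+ _); rewrite /s; field; rewrite gt_eqF.
have s4 : 0 < 4 * s by rewrite mulr_gt0.
have dcv y : (forall m, `|y 0 m| < s) -> cvgn (series (ev (dser l b) ^~ y)).
  move=> ys; have ys' m : `|y 0 m| <= s := ltW (ys m).
  apply: (@qseries_cvg _ (2 * M * rho^-1) 2^-1) => // k.
  have := geobnd_dser l r0 hb => hd.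
  have hk w : size w = k ->
      qnorm (dser l b w) <= 2 * M * rho^-1 * (rho / 2)^-1 ^+ k by move=> <-; exact: hd.
  apply: (le_trans (ev_le ys' hk)).
  rewrite -mulrA -exprMn le_eqVlt; apply/orP; left; apply/eqP; congr (_ * _ ^+ _).
  by rewrite /s; field; rewrite gt_eqF.
pose G y := limn (series (ev (dser l b) ^~ y)).
(* With s = rho / 16 the blocks decay like 4^-k: one factor 2^-k absorbs k^2, with
   constant C0, and the other one sums to 2. *)
pose C := 2 * (M * C0) / (4 * s) ^+ 2.
have main y (t : R) : S y -> (forall m, `|y 0 m| < s) ->
    (forall m, `|(y + t *: eq4 R l) 0 m| < s) ->
    qnorm (F (y + t *: eq4 R l) - F y - t *: G y) <= C * t ^+ 2.
  move=> Sy ys yts; set yt := y + t *: eq4 R l.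
  have cF := hF y Sy ys; have cFt := hF yt (Sl y t Sy) yts.
  have cG : series (ev (dser l b) ^~ y) @ \oo --> G y by exact: dcv.
  have cD : series (dev l b ^~ y) @ \oo --> G y.
    rewrite -(cvg_shiftS (series (dev l b ^~ y))).
    have -> // : [sequence series (dev l b ^~ y) n.+1]_n = series (ev (dser l b) ^~ y).
    apply/funext => n; rewrite /series /= big_nat_recl//= add0r.
    by apply: eq_bigr => k _; rewrite -devS.
  have cc : (fun n => \sum_(0 <= k < n) (ev b k yt - ev b k y - t *: dev l b k y))
      @ \oo --> F yt - F y - t *: G y.
    under eq_fun do rewrite !sumrB -scaler_sumr.
    by apply: cvgB; [exact: cvgB|apply: cvgZ; [exact: cvg_cst|exact: cD]].
  apply: (qcvg_le _ cc) => n.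
  apply: (le_trans (qnorm_sum _ _ _)).
  apply: (@le_trans _ _ (\sum_(0 <= k < n) (t ^+ 2 * (M * C0) / (4 * s) ^+ 2) * 2^-1 ^+ k)).
    apply: ler_sum => k _.
    have := ev_rem_le s0 (fun m => ltW (ys m)) (fun m => ltW (yts m)) (hbd k).
    rewrite -/yt mulrC -ler_pdivlMr ?exprn_gt0// => /le_trans; apply.
    rewrite [leRHS]mulrAC ler_wpM2r ?invr_ge0 ?sqr_ge0//.
    rewrite /bd [leLHS](_ : _ = (k%:R ^+ 2 * 2^-1 ^+ k) * (t ^+ 2 * M * 2^-1 ^+ k)); last first.
      have -> : t ^+ 2 * k%:R ^+ 2 * (M * rho^-1 ^+ k) * (4 * s) ^+ k =
        t ^+ 2 * k%:R ^+ 2 * M * (rho^-1 ^+ k * (4 * s) ^+ k) by ring.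
      by rewrite q4; ring.
    rewrite (_ : t ^+ 2 * (M * C0) * 2^-1 ^+ k = C0 * (t ^+ 2 * M * 2^-1 ^+ k)); last by ring.
    apply: ler_wpM2r.
      by apply: mulr_ge0; [apply: mulr_ge0 => //; exact: sqr_ge0|exact: exprn_ge0].
    apply: le_trans (hC0 k); rewrite ler_wpM2r ?exprn_ge0//.
    by rewrite lerXn2r ?nnegrE// ler_nat.
  rewrite -mulr_sumr /C.
  rewrite [leRHS](_ : _ = (t ^+ 2 * (M * C0) / (4 * s) ^+ 2) * 2); last by ring.
  rewrite ler_wpM2l ?geo_half_sum// divr_ge0 ?sqr_ge0// mulr_ge0 ?sqr_ge0// mulr_ge0//.
have D y : S y -> (forall m, `|y 0 m| < s) -> is_derive y (eq4 R l) F (G y).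
  move=> Sy ys; apply: (@is_derive_quadq _ _ _ _ C (s - `|y 0 l|)); first by rewrite subr_gt0.
  move=> h hs; apply: main => // m; rewrite addqE scaleqE eq4E.
  have [->|_] := eqVneq m l; last by rewrite mulr0 addr0.
  by rewrite mulr1; apply: (le_lt_trans (ler_normD _ _)); lra.
split; last by exists s => // y Sy ys; have [] := D y Sy ys.
exists (2 * M * rho^-1), (rho / 2); split; [by rewrite divr_gt0|exact: geobnd_dser|].
move=> y Sy ys; have ys' m : `|y 0 m| < s.
  by apply: (lt_le_trans (ys m)); rewrite /s; lra.
have [_ ->] := D y Sy ys'; exact: dcv.
Qed.

Lemma evX b k (t : R) y : ev b k (t *: y) = t ^+ k *: ev b k y.
Proof.
elim: k b => [|k IH] b; first by rewrite expr0 scale1r.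
rewrite /= scaler_sumr; apply: eq_bigr => l _.
by rewrite IH scaleqE !scalerA exprS; congr (_ *: _); ring.
Qed.

Lemma hasexp0 S b F : S 0 -> hasexp S b F -> F 0 = b [::].
Proof.
move=> S0 [M [rho [r0 _ hF]]].
have h := hF 0 S0 (fun m => _).
have {}h : series (ev b ^~ 0) @ \oo --> F 0.
  by apply: h => m; rewrite mxE normr0 divr_gt0.
apply: (qcvg_unique h); apply/qcvgP => e e0; exists 1%N => -[//|n] _.
rewrite /series /= big_nat_recl//= big1 ?addr0 ?subrr ?qnorm0 ?ltW// => k _.
by rewrite big1// => l _; rewrite mxE scale0r.
Qed.

(** The identity theorem for power series in one real variable. *)
Lemma qseries_zero (u : nat -> quat R) (B Q d : R) : 0 < d -> 0 < Q ->
  (forall k, qnorm (u k) <= B * Q ^+ k) ->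
  (forall t : R, 0 < t -> t < d -> series (fun k => t ^+ k *: u k) @ \oo --> (0 : quat R)) ->
  forall k, u k = 0.
Proof.
move=> d0 Q0 uB hu k.
have B0 : 0 <= B by have := le_trans (qnorm_ge0 _) (uB 0%N); rewrite expr0 mulr1.
elim/ltn_ind: k => k IH; apply/eqP; rewrite -qnorm_eq0 eq_le qnorm_ge0 andbT.
pose A := 2 * B * Q ^+ k.+1.
have A0 : 0 <= A.
  by apply: mulr_ge0; [exact: mulr_ge0|apply: exprn_ge0; exact: ltW].
have key (t : R) : 0 < t -> t < d -> t * Q <= 2^-1 -> qnorm (u k) <= A * t.
  move=> t0 td tQ; have tQ0 : 0 <= t * Q by rewrite mulr_ge0 ?(ltW t0) ?(ltW Q0).
  have tk : 0 < t ^+ k by rewrite exprn_gt0.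
  have c := hu t t0 td.
  suff : qnorm (t ^+ k *: u k) <= A * t * t ^+ k.
    by rewrite qnormZ (gtr0_norm tk) mulrC ler_pM2r.
  apply: (@qcvg_le (fun n => t ^+ k *: u k - series (fun k => t ^+ k *: u k) (n + k.+1)%N)); last first.
    rewrite -[X in _ --> X]subr0; apply: cvgB; first exact: cvg_cst.
    exact: (cvg_comp _ _ (cvg_addnr k.+1) c).
  move=> n; rewrite /series /= (@big_cat_nat _ _ _ k.+1)//=; last exact: leq_addl.
  rewrite big_nat_recr//= big_nat big1 ?add0r; last first.
    by move=> j /andP[_ jk]; rewrite IH// scaler0.
  rewrite opprD addrA subrr sub0r qnormN.
  apply: (le_trans (qnorm_sum _ _ _)).
  rewrite -{1}[k.+1]add0n big_addn addnK.
  apply: (@le_trans _ _ (\sum_(0 <= i < n) B * (t * Q) ^+ k.+1 * 2^-1 ^+ i)).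
    apply: ler_sum => i _; rewrite qnormZ ger0_norm ?exprn_ge0 ?(ltW t0)//.
    apply: (@le_trans _ _ (t ^+ (i + k.+1) * (B * Q ^+ (i + k.+1)))).
      by rewrite ler_wpM2l// exprn_ge0 ?ltW.
    have -> : t ^+ (i + k.+1) * (B * Q ^+ (i + k.+1)) =
        B * (t * Q) ^+ k.+1 * (t * Q) ^+ i by rewrite !exprMn !exprD; ring.
    apply: ler_wpM2l; first by apply: mulr_ge0 => //; exact: exprn_ge0.
    by rewrite lerXn2r ?nnegrE// invr_ge0.
  rewrite -mulr_sumr; apply: (@le_trans _ _ (B * (t * Q) ^+ k.+1 * 2)).
    by rewrite ler_wpM2l ?geo_half_sum// mulr_ge0 ?exprn_ge0.
  by rewrite le_eqVlt; apply/orP; left; apply/eqP; rewrite /A exprMn (exprS t); ring.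
apply/ler_addgt0Pr => e e0; rewrite add0r.
have A1 : 0 < A + 1 by lra.
have Q1 : 0 < 2 * Q by lra.
pose t := Num.min (d / 2) (Num.min (2 * Q)^-1 (e / (A + 1))).
have t0 : 0 < t by rewrite !lt_min divr_gt0// invr_gt0 Q1 divr_gt0.
have [t1 t2 t3] : [/\ t <= d / 2, t <= (2 * Q)^-1 & t <= e / (A + 1)].
  by rewrite /t !ge_min !lexx !orbT.
apply: (le_trans (key t t0 _ _)); first lra.
  by apply: (@le_trans _ _ ((2 * Q)^-1 * Q)); [rewrite ler_wpM2r// ltW|rewrite invfM mulfVK// gt_eqF].
apply: (@le_trans _ _ ((A + 1) * t)); first by rewrite ler_wpM2r ?(ltW t0)//; lra.
by rewrite mulrC -ler_pdivlMr.
Qed.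

Lemma hasexp_zero S b F (d : R) : 0 < d -> (forall y (t : R), S y -> S (t *: y)) ->
  hasexp S b F -> (forall y, S y -> (forall m, `|y 0 m| < d) -> F y = 0) ->
  forall y k, S y -> ev b k y = 0.
Proof.
move=> d0 SZ [M [rho [r0 hb hF]]] F0 y k Sy; move: k.
pose s := `|y| + 1; have s0 : 0 < s by rewrite ltr_wpDl.
have ys m : `|y 0 m| < s by apply: (le_lt_trans (coord_le_mxnorm y m)); rewrite /s; lra.
pose e := Num.min d (rho / 16); have e0 : 0 < e by rewrite lt_min d0 divr_gt0.
have es : 0 < e / s by rewrite divr_gt0.
have Q0 : 0 < rho^-1 * (4 * s) by rewrite !mulr_gt0 ?invr_gt0.
apply: (@qseries_zero _ M _ _ es Q0) => [k|t t0 te].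
  rewrite exprMn mulrA; apply: (@ev_le R s y (fun m => ltW (ys m))) => w <-; exact: hb.
have small m : `|(t *: y) 0 m| < e.
  rewrite scaleqE normrM (gtr0_norm t0); apply: (@le_lt_trans _ _ (t * s)).
    by rewrite ler_wpM2l ?ltW.
  by rewrite -ltr_pdivlMr.
have -> : (fun k => t ^+ k *: ev b k y) = (ev b ^~ (t *: y)).
  by apply/funext => k; rewrite evX.
rewrite -(F0 (t *: y)); [|exact: SZ|].
  apply: hF; first exact: SZ.
  by move=> m; apply: (lt_le_trans (small m)); rewrite /e ge_min lexx orbT.
by move=> m; apply: (lt_le_trans (small m)); rewrite /e ge_min lexx.
Qed.

End LocalExpansion.

(** * Monogenic power series *)

Section NullSeries.
Variable R : realType.
Implicit Types (a b : seq 'I_4 -> quat R) (l : 'I_4) (x y z c : quat R) (w : seq 'I_4).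

(** Coefficient families whose sum is the zero function; they need not vanish
    word by word. *)
Definition null b := (exists M rho : R, 0 < rho /\ geobnd M rho b) /\
  forall k y, ev b k y = 0.

Lemma null_hasexp b : null b -> hasexp setT b (fun=> 0).
Proof.
move=> [[M [rho [r0 hb]]] b0]; exists M, rho; split => // y _ _.
apply/qcvgP => e e0; exists 0%N => n _; rewrite /series /= big1 ?subrr ?qnorm0 ?ltW//.
Qed.

Lemma nullD a b : null a -> null b -> null (fun w => a w + b w).
Proof.
move=> na nb; have ha := null_hasexp na; have hb := null_hasexp nb.
have [M [rho [r0 h _]]] := hasexpD ha hb; split; first by exists M, rho.
by move=> k y; rewrite evD na.2 nb.2 addr0.
Qed.

Lemma null_mull c b : null b -> null (fun w => c *q b w).
Proof.
move=> nb; have [M [rho [r0 h _]]] := hasexp_mull c (null_hasexp nb).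
split; first by exists M, rho.
by move=> k y; rewrite ev_mull nb.2 mulq0.
Qed.

Lemma null_dser l b : null b -> null (dser l b).
Proof.
move=> nb; have [hd _] := hasexp_deriv (S := setT) (l := l) (fun y t _ => I) (null_hasexp nb).
have [M [rho [r0 h _]]] := hd; split; first by exists M, rho.
move=> k y; apply: (hasexp_zero ltr01 _ hd) => // z _ _.
exact: derive_cst.
Qed.

Lemma null_nil b : null b -> b [::] = 0.
Proof. by move=> [_ /(_ 0%N 0)]. Qed.

Lemma null0 : null (fun=> 0).
Proof.
split; last by move=> k y; exact: ev0.
by exists 0, 1; split => // w; rewrite qnorm0 mul0r.
Qed.

Definition same_sum a b := null (fun w => a w - b w).

Lemma same_sum_refl a : same_sum a a.
Proof. by rewrite /same_sum; under eq_fun do rewrite subrr; exact: null0. Qed.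

Lemma same_sum_trans b a d : same_sum a b -> same_sum b d -> same_sum a d.
Proof.
move=> h1 h2; have := nullD h1 h2; rewrite /same_sum.
by under eq_fun do rewrite addrA subrK.
Qed.

Lemma same_sum_dser l a b : same_sum a b -> same_sum (dser l a) (dser l b).
Proof.
move=> /(null_dser l); rewrite /same_sum.
have -> : dser l (fun w => a w - b w) = (fun w => dser l a w - dser l b w).
  have E : (fun w => a w - b w) = (fun w => a w + (- q1) *q b w).
    by apply/funext => w; rewrite mulNq mul1q.
  by rewrite E dserD dser_mull; apply/funext => w; rewrite mulNq mul1q.
by [].
Qed.

Lemma same_sum_mull c a b : same_sum a b -> same_sum (fun w => c *q a w) (fun w => c *q b w).
Proof. by move=> /(null_mull c); rewrite /same_sum; under eq_fun do rewrite mulqBr. Qed.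

Lemma same_sumD a b a' b' : same_sum a b -> same_sum a' b' -> same_sum (fun w => a w + a' w) (fun w => b w + b' w).
Proof.
move=> h1 h2; have := nullD h1 h2; rewrite /same_sum.
by under [in X in _ -> X]eq_fun do rewrite opprD addrACA.
Qed.

Lemma same_sum_nil a b : same_sum a b -> a [::] = b [::].
Proof. by move=> /null_nil /eqP; rewrite subr_eq0 => /eqP. Qed.

(** Series annihilated by d0 + i d1 + j d2. *)
Definition mono b := null (fun w => dser 0 b w + qi *q dser 1 b w + qj *q dser 2 b w).

Lemma mono_dser l b : mono b -> mono (dser l b).
Proof.
move=> /(null_dser l); rewrite /mono !dserD !dser_mull.
by rewrite (dserC l 0) (dserC l 1) (dserC l 2).
Qed.

Definition laplb b : seq 'I_4 -> quat R :=
  fun w => dser 0 (dser 0 b) w + dser 1 (dser 1 b) w.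
Definition dbarb b : seq 'I_4 -> quat R := fun w => dser 0 b w + qi *q dser 1 b w.
Definition deltab k1 k2 b := iter k1 (dser 1) (iter k2./2 laplb (if odd k2 then dbarb b else b)).
Definition dd k1 k2 b := iter k1 (dser 1) (iter k2 (dser 2) b).

Fixpoint jn (k : nat) : quat R := if k is k'.+1 then (- qj) *q jn k' else q1.

Lemma jnD m n : jn (m + n) = jn m *q jn n.
Proof. by elim: m => [|m IH]; rewrite ?mul1q// addSn /= IH mulqA. Qed.

Lemma dbarb_same_sum b : mono b -> same_sum (dbarb b) (fun w => (- qj) *q dser 2 b w).
Proof. by rewrite /same_sum /mono /dbarb; under [in X in _ -> X]eq_fun do rewrite mulNq opprK. Qed.

Lemma laplb_same_sum b : mono b -> same_sum (laplb b) (fun w => jn 2 *q dser 2 (dser 2 b) w).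
Proof.
move=> mb; pose N w := dser 0 b w + qi *q dser 1 b w + qj *q dser 2 b w.
have n1 : null (fun w => dser 0 N w + ((- qi) *q dser 1 N w + (- qj) *q dser 2 N w)).
  by apply: nullD; [exact: null_dser|apply: nullD; apply: null_mull; exact: null_dser].
have EN l : dser l N = (fun w => dser l (dser 0 b) w + qi *q dser l (dser 1 b) w +
    qj *q dser l (dser 2 b) w) by rewrite /N !dserD !dser_mull.
rewrite /same_sum; suff -> : (fun w => laplb b w - jn 2 *q dser 2 (dser 2 b) w) =
  (fun w => dser 0 N w + ((- qi) *q dser 1 N w + (- qj) *q dser 2 N w)) by [].
apply/funext => w; rewrite !EN /laplb (dserC 1 0) (dserC 2 0) (dserC 2 1).
move: (dser 0 (dser 0 b) w) (dser 0 (dser 1 b) w) (dser 0 (dser 2 b) w).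
move: (dser 1 (dser 1 b) w) (dser 1 (dser 2 b) w) (dser 2 (dser 2 b) w) => A B C D E F.
have ij : qi *q qj = - (qj *q qi) :> quat R by qring.
have ii : qi *q qi = - q1 :> quat R by qring.
rewrite /= !mulqDr !mulNq !mulqN !mulNq !mulqA ij ii mulq1 !mulNq mul1q.
move: (qi *q B) (qi *q F) (qj *q D) (qj *q E) => a b' c' d'.
by move: (qj *q qi *q B) (qj *q qj *q A) => p q; apply/rowP => j; rewrite !mxE; ring.
Qed.

Lemma laplb_mull c b : laplb (fun w => c *q b w) = (fun w => c *q laplb b w).
Proof. by rewrite /laplb !dser_mull; apply/funext => w; rewrite mulqDr. Qed.

Lemma same_sum_laplb a b : same_sum a b -> same_sum (laplb a) (laplb b).
Proof. by move=> h; apply: same_sumD; do 2 apply: same_sum_dser. Qed.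

Lemma iter_laplb_mull c b t : iter t laplb (fun w => c *q b w) = (fun w => c *q iter t laplb b w).
Proof. by elim: t => [//|t IH]; rewrite !iterS IH laplb_mull. Qed.

Lemma iter_same_sum_laplb a b t : same_sum a b -> same_sum (iter t laplb a) (iter t laplb b).
Proof. by move=> h; elim: t => [//|t IH]; rewrite !iterS; exact: same_sum_laplb. Qed.

Lemma mono_iter l b t : mono b -> mono (iter t (dser l) b).
Proof. by move=> h; elim: t => [//|t IH]; rewrite iterS; exact: mono_dser. Qed.

Lemma mulqfA c d b : (fun w => c *q (d *q b w)) = (fun w => c *q d *q b w).
Proof. by apply/funext => w; rewrite mulqA. Qed.

Lemma iter_laplb_same_sum b t : mono b ->
  same_sum (iter t laplb b) (fun w => jn t.*2 *q iter t.*2 (dser 2) b w).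
Proof.
move=> mb; elim: t => [|t IH].
  have E : (fun w => q1 *q b w) = b by apply/funext => w; rewrite mul1q.
  by rewrite /= E; exact: same_sum_refl.
rewrite iterS; apply: (same_sum_trans (same_sum_laplb IH)); rewrite laplb_mull.
have := same_sum_mull (jn t.*2) (laplb_same_sum (mono_iter 2 t.*2 mb)).
rewrite doubleS !iterS; rewrite (_ : jn t.*2.+2 = jn t.*2 *q jn 2).
  by rewrite mulqfA.
by rewrite -[t.*2.+2]addn2 jnD.
Qed.

Lemma iter_same_sum_dser l a b t : same_sum a b -> same_sum (iter t (dser l) a) (iter t (dser l) b).
Proof. by move=> h; elim: t => [//|t IH]; rewrite !iterS; exact: same_sum_dser. Qed.

Lemma iter_dser_mull l c b t :
  iter t (dser l) (fun w => c *q b w) = (fun w => c *q iter t (dser l) b w).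
Proof. by elim: t => [//|t IH]; rewrite !iterS IH dser_mull. Qed.

(** On monogenic series d0 + i d1 acts as - j d2, and (d0)^2 + (d1)^2 as - (d2)^2,
    since (d0 - i d1 - j d2)(d0 + i d1 + j d2) is the Laplacian. Hence the
    operators of the theorem, which differentiate along C only, compute the
    derivatives in the direction of j. *)
Lemma deltab_dd k1 k2 b : mono b -> deltab k1 k2 b [::] = jn k2 *q dd k1 k2 b [::].
Proof.
move=> mb; rewrite /deltab /dd.
have -> : jn k2 *q iter k1 (dser 1) (iter k2 (dser 2) b) [::] =
   iter k1 (dser 1) (fun w => jn k2 *q iter k2 (dser 2) b w) [::].
  by rewrite iter_dser_mull.
apply: same_sum_nil; apply: iter_same_sum_dser.
have := odd_double_half k2; move: (k2./2) => t; case: (odd k2) => /= <-.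
  apply: (same_sum_trans (iter_same_sum_laplb t (dbarb_same_sum mb))).
  rewrite iter_laplb_mull add1n iterSr.
  have := same_sum_mull (- qj) (iter_laplb_same_sum t (mono_dser 2 mb)).
  by rewrite mulqfA.
by rewrite add0n; exact: iter_laplb_same_sum.
Qed.

Lemma euler b k y : k%:R *: ev b k y = \sum_l y 0 l *: dev l b k y.
Proof.
elim: k b => [|k IH] b.
  by rewrite scale0r big1// => l _; rewrite scaler0.
rewrite [dev]lock /= -lock.
under [RHS]eq_bigr do rewrite /= scalerDr.
rewrite big_split /= -natr1 scalerDl scale1r addrC; congr (_ + _).
under [RHS]eq_bigr do rewrite scaler_sumr.
rewrite exchange_big scaler_sumr; apply: eq_bigr => m _ /=.
rewrite scalerA mulrC -scalerA IH scaler_sumr; apply: eq_bigr => l _.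
by rewrite !scalerA mulrC.
Qed.

Definition zeta1 y : quat R := y 0 1 *: q1 - y 0 0 *: qi.
Definition zeta2 y : quat R := y 0 2 *: q1 - y 0 0 *: qj.

(** Euler's identity for homogeneous functions, with d0 eliminated by the
    monogenic equation: the two Fueter variables appear. *)
Lemma mono_euler b k y : mono b -> y 0 3 = 0 ->
  k.+1%:R *: ev b k.+1 y = zeta1 y *q ev (dser 1 b) k y + zeta2 y *q ev (dser 2 b) k y.
Proof.
move=> [_ mb] y3; rewrite euler sum_ord4 y3 scale0r addr0 !devS.
have := mb k y; rewrite !evD !ev_mull.
move: (ev (dser 0 b) k y) (ev (dser 1 b) k y) (ev (dser 2 b) k y) => A B C h.
have -> : A = - (qi *q B + qj *q C).
  by apply/eqP; rewrite -addr_eq0 addrA h.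
by rewrite /zeta1 /zeta2; qring.
Qed.

End NullSeries.

(** * Fueter polynomials *)

Section FueterPolynomials.
Variable R : realType.
Implicit Types (b : seq 'I_4 -> quat R) (x y z c : quat R).

(** The entry one step lower in the first, respectively second, index, read as 0
    when that index is 0. *)
Definition lf1 (f : nat -> nat -> quat R) k1 k2 : quat R :=
  if k1 is k.+1 then f k k2 else 0.
Definition lf2 (f : nat -> nat -> quat R) k1 k2 : quat R :=
  if k2 is k.+1 then f k1 k else 0.

Lemma fueterT_rec k1 k2 x :
  (k1 + k2)%:R *: fueterT k1 k2 x =
    k1%:R *: (lf1 (fun i j => fueterT i j x) k1 k2 *q
              (x 0 1 *: q1 - ((-1) ^+ k2 * x 0 0) *: qi))
  + k2%:R *: (lf2 (fun i j => fueterT i j x) k1 k2 *q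
              (x 0 0 *: q1 + x 0 2 *: qj + x 0 3 *: qk)).
Proof.
have h n (v : quat R) : n.+1%:R *: (n.+1%:R^-1 *: v) = v.
  by rewrite scalerA mulfV ?pnatr_eq0// scale1r.
case: k1 => [|k1]; case: k2 => [|k2].
- by rewrite !scale0r addr0.
- by rewrite [fueterT _ _ _]/= add0n h scale0r.
- by rewrite [fueterT _ _ _]/= addn0 h scale0r.
- by rewrite [fueterT _ _ _]/= h.
Qed.

(** The factor (-j)^k2 turns the polynomials [fueterT] into the classical Fueter
    polynomials, divided by k1! k2!: symmetrized products of the variables zeta1
    and zeta2. *)
Definition fpol k1 k2 y : quat R :=
  (k1`! * k2`!)%:R^-1 *: (fueterT k1 k2 y *q jn R k2).

Lemma jn_zeta1 k y :
  (y 0 1 *: q1 - ((-1) ^+ k * y 0 0) *: qi) *q jn R k = jn R k *q zeta1 y.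
Proof.
elim: k => [|k IH]; first by rewrite expr0 mul1r mulq1 mul1q.
rewrite [jn R k.+1]/= -mulqA -IH !mulqA; congr (_ *q _).
by rewrite exprS; move: ((-1) ^+ k) => e; qring.
Qed.

Lemma jn_zeta2 k y : zeta2 y *q jn R k = jn R k *q zeta2 y.
Proof.
elim: k => [|k IH]; first by rewrite mulq1 mul1q.
rewrite [jn R k.+1]/= -mulqA -IH !mulqA; congr (_ *q _).
by rewrite /zeta2; qring.
Qed.

Lemma fact_inv k (t : R) : k.+1%:R * (k.+1`!%:R^-1 * t) = k`!%:R^-1 * t.
Proof.
by rewrite mulrA factS natrM invfM mulrA mulfV ?mul1r// pnatr_eq0.
Qed.

(** The defining recursion of [fueterT], after moving the power of j to the right
    of the Fueter variables. *)
Lemma fpol_right k1 k2 y : y 0 3 = 0 ->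
  (k1 + k2)%:R *: fpol k1 k2 y =
  lf1 (fun i j => fpol i j y) k1 k2 *q zeta1 y + lf2 (fun i j => fpol i j y) k1 k2 *q zeta2 y.
Proof.
move=> y3; rewrite /fpol scalerA mulrC -scalerA -scaleqAl fueterT_rec mulqDl scalerDr.
rewrite y3 scale0r addr0; congr (_ + _).
  rewrite scaleqAl scalerA natrM invfM; case: k1 => [|k1].
    by rewrite mulr0 scale0r mul0q.
  rewrite [X in X *: _](_ : _ = k1`!%:R^-1 * k2`!%:R^-1); last by rewrite mulrC fact_inv.
  by rewrite [lf1 _ _ _]/= [lf1 _ _ _]/= -mulqA jn_zeta1 mulqA scaleqAl natrM invfM.
rewrite scaleqAl scalerA natrM invfM; case: k2 => [|k2].
  by rewrite mulr0 scale0r mul0q.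
rewrite [X in X *: _](_ : _ = k1`!%:R^-1 * k2`!%:R^-1); last first.
  by rewrite mulrC (mulrC k1`!%:R^-1) fact_inv mulrC.
rewrite [lf2 _ _ _]/= [lf2 _ _ _]/= scaleqAl natrM invfM; congr (_ *: _).
rewrite -!mulqA; congr (_ *q _); rewrite -jn_zeta2 [jn R k2.+1]/= mulqA; congr (_ *q _).
by rewrite /zeta2; qring.
Qed.

Lemma lf12 f k1 k2 : lf1 (lf2 f) k1 k2 = lf2 (lf1 f) k1 k2.
Proof. by case: k1; case: k2. Qed.

(** Since the Fueter polynomials are symmetric sums of products of the Fueter
   variables, the variables can equally be peeled off on the left. *)
Lemma fpol_left n k1 k2 y : (k1 + k2)%N = n -> y 0 3 = 0 ->
  n%:R *: fpol k1 k2 y =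
  zeta1 y *q lf1 (fun i j => fpol i j y) k1 k2 + zeta2 y *q lf2 (fun i j => fpol i j y) k1 k2.
Proof.
move=> kn y3; elim: n k1 k2 kn => [|n IH] k1 k2 kn.
  have [-> ->] : k1 = 0%N /\ k2 = 0%N by lia.
  by rewrite scale0r /= !mulq0 addr0.
set f := fun i j => fpol i j y.
have f00 : f 0%N 0%N = q1 by rewrite /f /fpol /= mulq1 invr1 scale1r.
have RR i j p : (i + j)%N = p -> p%:R *: fpol i j y =
    lf1 f i j *q zeta1 y + lf2 f i j *q zeta2 y by move=> <-; exact: fpol_right.
case: n IH kn => [|n] IH kn.
  rewrite (RR _ _ _ kn); have [[-> ->]|[-> ->]] : (k1 = 1 /\ k2 = 0)%N \/ (k1 = 0 /\ k2 = 1)%N by lia.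
    by rewrite /= f00 mulq1 mul1q mul0q mulq0.
  by rewrite /= f00 mulq1 mul1q mul0q mulq0.
have E1 : n.+1%:R *: lf1 f k1 k2 = zeta1 y *q lf1 (lf1 f) k1 k2 + zeta2 y *q lf1 (lf2 f) k1 k2.
  case: k1 kn => [|k1] kn /=; first by rewrite scaler0 !mulq0 addr0.
  by apply: IH; lia.
have E2 : n.+1%:R *: lf2 f k1 k2 = zeta1 y *q lf2 (lf1 f) k1 k2 + zeta2 y *q lf2 (lf2 f) k1 k2.
  case: k2 kn {E1} => [|k2] kn /=; first by rewrite scaler0 !mulq0 addr0.
  by apply: IH; lia.
have F1 : n.+1%:R *: lf1 f k1 k2 = lf1 (lf1 f) k1 k2 *q zeta1 y + lf1 (lf2 f) k1 k2 *q zeta2 y.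
  case: k1 kn {E1 E2} => [|k1] kn /=; first by rewrite scaler0 !mul0q addr0.
  by apply: RR; lia.
have F2 : n.+1%:R *: lf2 f k1 k2 = lf2 (lf1 f) k1 k2 *q zeta1 y + lf2 (lf2 f) k1 k2 *q zeta2 y.
  case: k2 kn {E1 E2 F1} => [|k2] kn /=; first by rewrite scaler0 !mul0q addr0.
  by apply: RR; lia.
apply: (@scalerI _ _ (n.+1%:R : R)); first by rewrite pnatr_eq0.
rewrite (RR _ _ _ kn) !(scalerDr n.+1%:R).
rewrite -(scaleqAl _ (lf1 f k1 k2)) -(scaleqAl _ (lf2 f k1 k2)) E1 E2.
rewrite -(scaleqAr _ (zeta1 y)) -(scaleqAr _ (zeta2 y)) F1 F2 lf12.
by move: (zeta1 y) (zeta2 y) => u v; rewrite !mulqDl !mulqDr !mulqA addrACA.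
Qed.

(** The reversion fixes 1, i, j and reverses products; the Fueter polynomials are
   invariant, hence have no k-component. *)
Definition qrev x : quat R := mkq (x 0 0) (x 0 1) (x 0 2) (- x 0 3).

Lemma qrevM x y : qrev (x *q y) = qrev y *q qrev x.
Proof. by rewrite /qrev; qring. Qed.
Lemma qrevD x y : qrev (x + y) = qrev x + qrev y.
Proof. by rewrite /qrev; qring. Qed.
Lemma qrevZ (t : R) x : qrev (t *: x) = t *: qrev x.
Proof. by rewrite /qrev; qring. Qed.
Lemma qrev0 : qrev 0 = 0.
Proof. by rewrite /qrev; qring. Qed.

Lemma fpol_rev n k1 k2 y : (k1 + k2)%N = n -> y 0 3 = 0 ->
  qrev (fpol k1 k2 y) = fpol k1 k2 y.
Proof.
move=> kn y3; elim: n k1 k2 kn => [|n IH] k1 k2 kn.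
  have [-> ->] : k1 = 0%N /\ k2 = 0%N by lia.
  by rewrite /fpol /qrev /=; qring.
apply: (@scalerI _ _ (n.+1%:R : R)); first by rewrite pnatr_eq0.
rewrite (fpol_left kn y3) -qrevZ.
have -> : n.+1%:R *: fpol k1 k2 y = lf1 (fun i j => fpol i j y) k1 k2 *q zeta1 y +
    lf2 (fun i j => fpol i j y) k1 k2 *q zeta2 y by rewrite -kn fpol_right.
rewrite qrevD !qrevM.
have z1 : qrev (zeta1 y) = zeta1 y by rewrite /qrev /zeta1; qring.
have z2 : qrev (zeta2 y) = zeta2 y by rewrite /qrev /zeta2; qring.
rewrite z1 z2; congr (_ *q _ + _ *q _).
  by case: k1 kn => [|k1] kn /=; [exact: qrev0|apply: IH; lia].
by case: k2 kn => [|k2] kn /=; [exact: qrev0|apply: IH; lia].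
Qed.

Lemma fpol_k0 k1 k2 y : y 0 3 = 0 -> fpol k1 k2 y 0 3 = 0.
Proof.
move=> y3; have := fpol_rev (erefl (k1 + k2)%N) y3 => /(congr1 (fun q : quat R => q 0 3)).
by rewrite /qrev mkq_3; lra.
Qed.

(** Induction on the degree: [mono_euler] peels off a Fueter variable on the left
    of the block and [fpol_left] does the same for the Fueter polynomials. *)
Lemma mono_taylor k b y : mono b -> y 0 3 = 0 ->
  ev b k y = \sum_(k1 < k.+1) fpol k1 (k - k1) y *q dd k1 (k - k1) b [::].
Proof.
move=> mb y3; elim: k b mb => [|k IH] b mb.
  by rewrite big_ord1 /fpol /= mulq1 invr1 scale1r mul1q.
apply: (@scalerI _ _ (k.+1%:R : R)); first by rewrite pnatr_eq0.
rewrite mono_euler// (IH _ (mono_dser 1 mb)) (IH _ (mono_dser 2 mb)).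
have d1 k1 k2 : dd k1 k2 (dser 1 b) = dd k1.+1 k2 b.
  rewrite /dd iterSr; congr iter; elim: k2 => [//|k2 IH2].
  by rewrite !iterS IH2 dserC.
have d2 k1 k2 : dd k1 k2 (dser 2 b) = dd k1 k2.+1 b by rewrite /dd iterSr.
rewrite scaler_sumr.
under [RHS]eq_bigr => k1 _ do rewrite -scaleqAl (@fpol_left k.+1) ?subnKC -1?ltnS// mulqDl -!mulqA.
rewrite big_split /=; congr (_ + _).
  rewrite [in RHS]big_ord_recl /= mul0q mulq0 add0r mulq_sumr; apply: eq_bigr => i _.
  by rewrite d1 /= subSS.
rewrite [in RHS]big_ord_recr /= subnn /= mul0q mulq0 addr0 mulq_sumr; apply: eq_bigr => i _.
by rewrite d2 subSn -1?ltnS.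
Qed.

End FueterPolynomials.

(** * Rotations exchanging the three-dimensional slices *)

Section Rotation.
Variable R : realType.
Implicit Types (x y z c : quat R).

(** The rotation fixing C and sending j to al j + be k. *)
Definition rot (al be : R) x : quat R :=
  mkq (x 0 0) (x 0 1) (al * x 0 2 - be * x 0 3) (be * x 0 2 + al * x 0 3).

Lemma rotD al be x y : rot al be (x + y) = rot al be x + rot al be y.
Proof. by rewrite /rot; qring. Qed.
Lemma rotZ al be (t : R) x : rot al be (t *: x) = t *: rot al be x.
Proof. by rewrite /rot; qring. Qed.
Lemma rotN al be x : rot al be (- x) = - rot al be x.
Proof. by rewrite /rot; qring. Qed.
Lemma rotB al be x y : rot al be (x - y) = rot al be x - rot al be y.
Proof. by rewrite rotD rotN. Qed.
Lemma rot0 al be : rot al be 0 = 0.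
Proof. by rewrite /rot; qring. Qed.
Lemma rot_q1 al be : rot al be q1 = q1.
Proof. by rewrite /rot; qring. Qed.
Lemma rot_qi al be : rot al be qi = qi.
Proof. by rewrite /rot; qring. Qed.
Lemma rot_qj al be : rot al be qj = al *: qj + be *: qk.
Proof. by rewrite /rot; qring. Qed.
Lemma rot_sum al be (I : Type) (r : seq I) (P : pred I) (F : I -> quat R) :
  rot al be (\sum_(i <- r | P i) F i) = \sum_(i <- r | P i) rot al be (F i).
Proof. by apply: (big_morph (rot al be)) => [a b|]; [exact: rotD|exact: rot0]. Qed.

Lemma rot_complex al be x : x 0 2 = 0 -> x 0 3 = 0 -> rot al be x = x.
Proof. by move=> x2 x3; rewrite /rot x2 x3; apply: quatP; rewrite ?qcoordE ?x2 ?x3; ring. Qed.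

Variables al be : R.
Hypothesis albe : al ^+ 2 + be ^+ 2 = 1.

Lemma albeN : al ^+ 2 + (- be) ^+ 2 = 1. Proof. by rewrite sqrrN. Qed.

Lemma rotK x : rot al (- be) (rot al be x) = x.
Proof.
rewrite /rot; apply: quatP; rewrite ?qcoordE //.
  by transitivity ((al ^+ 2 + be ^+ 2) * x 0 2); [ring|rewrite albe mul1r].
by transitivity ((al ^+ 2 + be ^+ 2) * x 0 3); [ring|rewrite albe mul1r].
Qed.

Lemma rotVK x : rot al be (rot al (- be) x) = x.
Proof.
rewrite /rot; apply: quatP; rewrite ?qcoordE //.
  by transitivity ((al ^+ 2 + be ^+ 2) * x 0 2); [ring|rewrite albe mul1r].
by transitivity ((al ^+ 2 + be ^+ 2) * x 0 3); [ring|rewrite albe mul1r].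
Qed.

Lemma rotM x y : rot al be (x *q y) = rot al be x *q rot al be y.
Proof.
rewrite /rot; apply: quatP; rewrite ?qcoordE.
- rewrite [RHS](_ : _ = x 0 0 * y 0 0 - x 0 1 * y 0 1 -
    (al ^+ 2 + be ^+ 2) * (x 0 2 * y 0 2 + x 0 3 * y 0 3)); last by ring.
  by rewrite albe; ring.
- rewrite [RHS](_ : _ = x 0 0 * y 0 1 + x 0 1 * y 0 0 +
    (al ^+ 2 + be ^+ 2) * (x 0 2 * y 0 3 - x 0 3 * y 0 2)); last by ring.
  by rewrite albe; ring.
- ring.
- ring.
Qed.

Lemma rot_norm x : qnorm (rot al be x) = qnorm x.
Proof.
rewrite !qnormE /qnorm2 /rot ?qcoordE; congr Num.sqrt.
rewrite [LHS](_ : _ = x 0 0 ^+ 2 + x 0 1 ^+ 2 + (al ^+ 2 + be ^+ 2) * (x 0 2 ^+ 2 + x 0 3 ^+ 2)); last by ring.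
by rewrite albe; ring.
Qed.

Definition flat y : quat R := mkq (y 0 0) (y 0 1) (y 0 2) 0.

Lemma flat_id y : y 0 3 = 0 -> flat y = y.
Proof. by move=> y3; apply: quatP; rewrite ?qcoordE ?y3. Qed.

Lemma flat3 y : flat y 0 3 = 0. Proof. by rewrite qcoordE. Qed.

Lemma flat_norm y : qnorm (flat y) <= qnorm y.
Proof.
rewrite !qnormE ler_sqrt ?qnorm2_ge0// /qnorm2 !qcoordE expr0n /= addr0.
by rewrite lerDl sqr_ge0.
Qed.

Lemma space3_rot x : space3 (rot al be qj) x <-> exists2 y : quat R, y 0 3 = 0 & x = rot al be y.
Proof.
split=> [[a [b [t ->]]]|[y y3 ->]].
  exists (mkq a b t 0); first by rewrite qcoordE.
  by rewrite /rot; qring.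
exists (y 0 0), (y 0 1), (y 0 2); rewrite rot_qj /rot y3.
by qring.
Qed.

Lemma space3_k x : space3 (rot al be qj) x <-> rot al (- be) x 0 3 = 0.
Proof.
rewrite space3_rot; split=> [[y y3 ->]|h]; first by rewrite rotK.
by exists (rot al (- be) x); rewrite ?rotVK.
Qed.

Lemma space3D x y : space3 (rot al be qj) x -> space3 (rot al be qj) y ->
  space3 (rot al be qj) (x + y).
Proof. by rewrite !space3_k rotD addqE => -> ->; rewrite addr0. Qed.

(** A rotation about C is an algebra automorphism that fixes i and maps the Fueter
    variables of one slice to those of another. *)
Lemma rot_fueterT k1 k2 y : y 0 3 = 0 ->
  fueterT k1 k2 (rot al be y) = rot al be (fueterT k1 k2 y).
Proof.
move=> y3; have [n kn] : exists n, (k1 + k2)%N = n by exists (k1 + k2)%N.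
elim: n k1 k2 kn => [|n IH] k1 k2 kn.
  have [-> ->] : k1 = 0%N /\ k2 = 0%N by lia.
  by rewrite /= rot_q1.
apply: (@scalerI _ _ (n.+1%:R : R)); first by rewrite pnatr_eq0.
rewrite -rotZ.
have E x : n.+1%:R *: fueterT k1 k2 x = (k1 + k2)%:R *: fueterT k1 k2 x by rewrite kn.
rewrite !E !fueterT_rec rotD !rotZ !rotM.
have -> : (rot al be y) 0 0 *: q1 + (rot al be y) 0 2 *: qj + (rot al be y) 0 3 *: qk =
  rot al be (y 0 0 *: q1 + y 0 2 *: qj + y 0 3 *: qk).
  by rewrite /rot y3; qring.
have -> : (rot al be y) 0 1 *: q1 - ((-1) ^+ k2 * (rot al be y) 0 0) *: qi =
  rot al be (y 0 1 *: q1 - ((-1) ^+ k2 * y 0 0) *: qi).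
  by move: ((-1) ^+ k2) => e; rewrite /rot; qring.
have -> : lf1 (fun i j => fueterT i j (rot al be y)) k1 k2 =
    rot al be (lf1 (fun i j => fueterT i j y) k1 k2).
  by case: k1 kn {E} => [|k1] kn /=; [rewrite rot0|apply: IH; lia].
have -> // : lf2 (fun i j => fueterT i j (rot al be y)) k1 k2 =
    rot al be (lf2 (fun i j => fueterT i j y) k1 k2).
by case: k2 kn {E} => [|k2] kn /=; [rewrite rot0|apply: IH; lia].
Qed.

End Rotation.

(** * Continuity from continuous partial derivatives *)

Section ContinuityFromPartials.
Variable R : realType.
Implicit Types (y z w : quat R) (l : 'I_4) (u : quat R -> R).

Lemma line_lipschitz u l w (t M : R) :
  (forall s : R, `|s| <= `|t| -> exists2 d : R, is_derive (w + s *: eq4 R l) (eq4 R l) u d & `|d| <= M) ->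
  `|u (w + t *: eq4 R l) - u w| <= M * `|t|.
Proof.
move=> h.
have /choice [du hdu] : forall s : R, exists d : R, `|s| <= `|t| ->
    is_derive s (1 : R) (fun s : R => u (w + s *: eq4 R l)) d /\ `|d| <= M.
  move=> s; have [st|st] := leP (`|s|) (`|t|); last by exists 0.
  by have [d D dM] := h s st; exists d => _; split=> //; exact: is_derive_line.
have cont (a b : R) : (forall s, s \in `[a, b] -> `|s| <= `|t|) ->
   {within `[a, b], continuous (fun s : R => u (w + s *: eq4 R l))}.
  move=> hab; apply: derivable_within_continuous => s sab.
  by have [[]] := hdu s (hab s sab).
have [t0|t0] := leP 0 t.
  have hab s : s \in `[0, t] -> `|s| <= `|t|.
    by rewrite in_itv /= => /andP[s0 st]; rewrite !ger0_norm.
  have D s : s \in `]0, t[ -> is_derive s (1 : R) (fun s : R => u (w + s *: eq4 R l)) (du s).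
    by move=> /subset_itv_oo_cc /hab /hdu [].
  have [c] := MVT_segment t0 D (cont _ _ hab).
  move=> /hab /hdu [_ dM]; rewrite scale0r addr0 subr0 => ->.
  by rewrite normrM ler_wpM2r.
have hab s : s \in `[t, 0] -> `|s| <= `|t|.
  rewrite in_itv /= => /andP[s0 st]; rewrite !ler0_norm ?lerN2//; exact: ltW.
have D s : s \in `]t, 0[ -> is_derive s (1 : R) (fun s : R => u (w + s *: eq4 R l)) (du s).
  by move=> /subset_itv_oo_cc /hab /hdu [].
have [c] := MVT_segment (ltW t0) D (cont _ _ hab).
move=> /hab /hdu [_ dM]; rewrite scale0r addr0 sub0r distrC => ->.
by rewrite normrM normrN ler_wpM2r.
Qed.

(** Move from y to a nearby point along one axis at a time; each step is
    controlled by the mean value theorem. *)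
Lemma continuous_of_partials u (u' : 'I_4 -> quat R -> R) y :
  (\forall z \near y, forall l, is_derive z (eq4 R l) u (u' l z)) ->
  (forall l, {for y, continuous (u' l)}) -> {for y, continuous u}.
Proof.
move=> du cu'.
have FF : Filter (nbhs y) by exact: nbhs_filter.
pose M := \sum_l (`|u' l y| + 1).
have hM l : \forall z \near y, `|u' l z| <= M.
  have /cvgrPdist_le /(_ 1 ltr01) := cu' l; apply: filterS => z h.
  apply: (@le_trans _ _ (`|u' l y| + 1)).
    have := ler_normB (u' l y) (u' l y - u' l z); rewrite subKr.
    by move=> /le_trans; apply; rewrite lerD2l.
  by rewrite /M (bigD1 l)//= lerDl sumr_ge0// => m _; rewrite addr_ge0.
have hM' : \forall z \near y, forall l, `|u' l z| <= M.
  exact: (@filter_forall _ _ (fun l z => `|u' l z| <= M) _ _ hM).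
have [r /= r0 hr] : exists2 r : R, 0 < r & forall z, (forall m, `|y 0 m - z 0 m| < r) ->
    forall l, is_derive z (eq4 R l) u (u' l z) /\ `|u' l z| <= M.
  have /nbhs_ballP [r r0 hr] := @filterI _ (nbhs y) FF _ _ du hM'.
  exists (r / 8); first by rewrite divr_gt0.
  move=> z hz l; have [|h1 h2] := hr z; last by split.
  rewrite -ball_normE /ball_ /=; apply: (le_lt_trans (mxnorm_le_qnorm _)).
  apply: (@le_lt_trans _ _ (4 * (r / 8))); last by have := r0 : 0 < r; lra.
  by apply: qnorm_le_coord => m; rewrite addqE oppqE ltW.
have M0 : 0 <= M by rewrite sumr_ge0// => l _; rewrite addr_ge0.
have step w l (t : R) : (forall m, `|y 0 m - w 0 m| < r) ->
    (forall m, `|y 0 m - (w + t *: eq4 R l) 0 m| < r) -> w 0 l = y 0 l ->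
    `|u (w + t *: eq4 R l) - u w| <= M * `|t|.
  move=> hw hwt wl; apply: line_lipschitz => s st.
  have [|h1 h2] := hr (w + s *: eq4 R l) _ l; last by exists (u' l (w + s *: eq4 R l)).
  move=> m; have := hwt m; have := hw m; rewrite !addqE !scaleqE eq4E.
  have [->|_] := eqVneq m l; last by rewrite !mulr0 addr0.
  rewrite !mulr1 wl !opprD !addrA subrr !add0r !normrN => _ tr.
  exact: le_lt_trans st tr.
have key z : (forall m, `|y 0 m - z 0 m| < r) ->
    `|u z - u y| <= M * (`|z 0 0 - y 0 0| + `|z 0 1 - y 0 1| + `|z 0 2 - y 0 2| + `|z 0 3 - y 0 3|).
  move=> hz.
  pose w1 : quat R := mkq (z 0 0) (y 0 1) (y 0 2) (y 0 3).
  pose w2 : quat R := mkq (z 0 0) (z 0 1) (y 0 2) (y 0 3).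
  pose w3 : quat R := mkq (z 0 0) (z 0 1) (z 0 2) (y 0 3).
  have hy m : `|y 0 m - y 0 m| < r by rewrite subrr normr0.
  have h1 m : `|y 0 m - w1 0 m| < r by elim/ord4P: m; rewrite /w1 qcoordE.
  have h2 m : `|y 0 m - w2 0 m| < r by elim/ord4P: m; rewrite /w2 qcoordE.
  have h3 m : `|y 0 m - w3 0 m| < r by elim/ord4P: m; rewrite /w3 qcoordE.
  have e1 : w1 = y + (z 0 0 - y 0 0) *: eq4 R 0 by rewrite /w1 /eq4 /=; qring.
  have e2 : w2 = w1 + (z 0 1 - y 0 1) *: eq4 R 1 by rewrite /w2 /w1 /eq4 /=; qring.
  have e3 : w3 = w2 + (z 0 2 - y 0 2) *: eq4 R 2 by rewrite /w3 /w2 /eq4 /=; qring.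
  have e4 : z = w3 + (z 0 3 - y 0 3) *: eq4 R 3 by rewrite /w3 /eq4 /=; qring.
  have s1 : `|u w1 - u y| <= M * `|z 0 0 - y 0 0| by rewrite {1}e1; apply: step; rewrite -?e1.
  have s2 : `|u w2 - u w1| <= M * `|z 0 1 - y 0 1|.
    by rewrite {1}e2; apply: step; rewrite -?e2// /w1 qcoordE.
  have s3 : `|u w3 - u w2| <= M * `|z 0 2 - y 0 2|.
    by rewrite {1}e3; apply: step; rewrite -?e3// /w2 qcoordE.
  have s4 : `|u z - u w3| <= M * `|z 0 3 - y 0 3|.
    by rewrite {1}e4; apply: step; rewrite -?e4// /w3 qcoordE.
  have -> : u z - u y = (u z - u w3) + (u w3 - u w2) + (u w2 - u w1) + (u w1 - u y) by ring.
  have t1 := ler_normD (u z - u w3 + (u w3 - u w2) + (u w2 - u w1)) (u w1 - u y).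
  have t2 := ler_normD (u z - u w3 + (u w3 - u w2)) (u w2 - u w1).
  have t3 := ler_normD (u z - u w3) (u w3 - u w2).
  rewrite !mulrDr; lra.
apply/(@cvgrPdist_le _ _ _ _ FF) => e e0.
have M1 : 0 < M + 1 by lra.
pose d := Num.min r (e / 4 / (M + 1)).
have d0 : 0 < d by rewrite lt_min r0 !divr_gt0.
apply/nbhs_ballP; exists d => //= z; rewrite -ball_normE /ball_ /= => yz.
have hz m : `|y 0 m - z 0 m| < d.
  by apply: le_lt_trans yz; have := coord_le_mxnorm (y - z) m; rewrite addqE oppqE.
have hzr m : `|y 0 m - z 0 m| < r by apply: (lt_le_trans (hz m)); rewrite /d ge_min lexx.
have hze m : `|z 0 m - y 0 m| <= e / 4 / (M + 1).
  rewrite distrC; apply: (le_trans (ltW (hz m))); by rewrite /d ge_min lexx orbT.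
rewrite distrC; apply: (le_trans (key z hzr)).
apply: (@le_trans _ _ ((M + 1) * (4 * (e / 4 / (M + 1))))).
  apply: ler_pM; [exact: M0|by rewrite !addr_ge0|lra|].
  by have := hze 0; have := hze 1; have := hze 2; have := hze 3; lra.
by rewrite le_eqVlt; apply/orP; left; apply/eqP; field; rewrite gt_eqF.
Qed.

End ContinuityFromPartials.

(** * Power series on a three-dimensional slice *)

Section Lift.
Variable R : realType.
Implicit Types (x y z c p : quat R) (l : 'I_4) (f : quat R -> quat R).

Lemma qnorm_lt_nbhs (s : R) y : qnorm y < s -> \forall z \near y, qnorm z < s.
Proof.
move=> sy; have s0 : 0 < s by apply: le_lt_trans sy; exact: qnorm_ge0.
have c : {for y, continuous (@qnorm2 R)} by exact: (cont_qnorm2 (@qcont_id R)).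
have h : \forall z \near y, qnorm2 z < s ^+ 2.
  by apply: (cvgr_lt _ c); rewrite -sqr_qnorm ltr_pXn2r ?nnegrE ?qnorm_ge0 ?(ltW s0).
near=> z; rewrite -(@ltr_pXn2r _ 2) ?nnegrE ?qnorm_ge0 ?(ltW s0)// sqr_qnorm.
by near: z; exact: h.
Unshelve. all: by end_near. Qed.

Lemma is_derive_coords f x v d : is_derive x v f d ->
  forall m, is_derive x v (fun z => f z 0 m) (d 0 m).
Proof.
move=> [df <-] m; split; first by move/derivable_mxP : df; apply.
by rewrite derive_mx// mxE.
Qed.

Variables (al be : R).
Hypothesis albe : al ^+ 2 + be ^+ 2 = 1.
Let J : quat R := rot al be qj.

(** Affine parametrization of the slice through p, constant in the fourth
    coordinate; [slice_dir l] is the image of the l-th axis. *)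
Definition slice_lift p y : quat R := p + rot al be (flat y).
Definition slice_dir l : quat R := [:: q1; qi; J; 0]`_l.

Lemma slice_lift_dir p y l (s : R) :
  slice_lift p (y + s *: eq4 R l) = slice_lift p y + s *: slice_dir l.
Proof.
rewrite /slice_lift -addrA; congr (p + _); rewrite /slice_dir /J /rot /flat.
by elim/ord4P: l; rewrite /eq4 /=; qring.
Qed.

Lemma cont_slice_lift p : continuous (slice_lift p).
Proof.
move=> y; apply/(@cvgrPdist_le _ _ _ _ (nbhs_filter y)) => e e0.
apply/nbhs_ballP; exists (e / 4); first exact: divr_gt0.
move=> z; rewrite -ball_normE /ball_ /= => yz.
apply: (le_trans (mxnorm_le_qnorm _)); rewrite /slice_lift opprD addrACA subrr add0r.
rewrite -rotB rot_norm// (_ : flat y - flat z = flat (y - z)); last by rewrite /flat; qring.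
apply: (le_trans (flat_norm _)); apply: (le_trans (qnorm_le_mxnorm _)).
by have := ltW yz; lra.
Qed.

Definition slice_pull p f y : quat R := rot al (- be) (f (slice_lift p y)).
Definition slice_pull' p f l y : quat R := rot al (- be) ('D_(slice_dir l) f (slice_lift p y)).

Lemma rot_comp_cont (F : quat R -> quat R) y : {for y, continuous F} ->
  forall k, {for y, continuous (fun z => (rot al (- be) (F z)) 0 k)}.
Proof.
move=> cF; have c m : {for y, continuous (fun z => F z 0 m)}.
  exact: (cvg_comp _ _ cF (@coord_cont R m (F y))).
have E k : (fun z => (rot al (- be) (F z)) 0 k) = (fun z => mkq (F z 0 0) (F z 0 1)
    (al * F z 0 2 - (- be) * F z 0 3) ((- be) * F z 0 2 + al * F z 0 3) 0 k) by [].
apply: ord4P; rewrite E.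
- by rewrite (_ : (fun z => _) = (fun z => F z 0 0)) //; apply/funext => z; rewrite mkq_0.
- by rewrite (_ : (fun z => _) = (fun z => F z 0 1)) //; apply/funext => z; rewrite mkq_1.
- rewrite (_ : (fun z => _) = (fun z => al * F z 0 2 - (- be) * F z 0 3)); last first.
    by apply/funext => z; rewrite mkq_2.
  exact: (cvgB (cvgM (cvg_cst al) (c 2)) (cvgM (cvg_cst (- be)) (c 3))).
- rewrite (_ : (fun z => _) = (fun z => (- be) * F z 0 2 + al * F z 0 3)); last first.
    by apply/funext => z; rewrite mkq_3.
  exact: (cvgD (cvgM (cvg_cst (- be)) (c 2)) (cvgM (cvg_cst al) (c 3))).
Qed.

Lemma rot_dirac3 (A B C : quat R) : A + qi *q B + J *q C = 0 ->
  rot al (- be) A + qi *q rot al (- be) B + qj *q rot al (- be) C = 0.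
Proof.
move=> /(congr1 (rot al (- be))); rewrite rot0 => <-; have ne := albeN albe.
rewrite (rotD _ _ (A + _)) (rotD _ _ A) (rotM ne qi) (rotM ne J).
by rewrite rot_qi (rotK albe).
Qed.

(** On a three-dimensional slice extended trivially in the fourth variable, a
   J-monogenic function becomes Fueter regular. *)
Lemma slice_pull_regular (V : set (quat R)) p (r : R) f : monogenic J V f ->
  (forall y, qnorm y < r -> V (slice_lift p y)) ->
  regular_ball r (slice_pull p f) (slice_pull' p f).
Proof.
move=> [df cf ef] hV.
have der x l : V x -> derivable f x (slice_dir l).
  move=> Vx; have h v := df x v Vx.
  elim/ord4P: l; rewrite /slice_dir /=; last exact: derivable0.
  - by apply: h; rewrite !inE eqxx.
  - by apply: h; rewrite !inE eqxx orbT.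
  - by apply: h; rewrite !inE eqxx !orbT.
have dqP y l : qnorm y < r -> dq y l (slice_pull p f) (slice_pull' p f l y).
  move=> yr; have D := DeriveDef (der _ l (hV y yr)) erefl.
  have C m : is_derive y (eq4 R l) (fun z => f (slice_lift p z) 0 m)
      ('D_(slice_dir l) f (slice_lift p y) 0 m).
    apply: is_derive_from_line.
    have -> : (fun s : R => f (slice_lift p (y + s *: eq4 R l)) 0 m) =
      (fun s : R => f (slice_lift p y + s *: slice_dir l) 0 m).
      by apply/funext => s; rewrite slice_lift_dir.
    apply: (@is_derive_line _ _ (fun z => f z 0 m)).
    by rewrite scale0r addr0; exact: is_derive_coords.
  have C0 := C 0; have C1 := C 1; have C2 := C 2; have C3 := C 3.
  rewrite /slice_pull /slice_pull' /rot; apply: ord4P.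
  - by under eq_fun do rewrite mkq_0; rewrite mkq_0.
  - by under eq_fun do rewrite mkq_1; rewrite mkq_1.
  - under eq_fun do rewrite mkq_2; rewrite mkq_2.
    by apply: is_derive_eq; rewrite /GRing.scale /=; ring.
  - under eq_fun do rewrite mkq_3; rewrite mkq_3.
    by apply: is_derive_eq; rewrite /GRing.scale /=; ring.
have cD y l : qnorm y < r ->
    {for y, continuous (fun z => 'D_(slice_dir l) f (slice_lift p z))}.
  move=> yr; have [l3|l3] := eqVneq l 3.
    have -> : (fun z => 'D_(slice_dir l) f (slice_lift p z)) = (fun=> 0).
      by apply/funext => z; rewrite l3 /slice_dir /= derive0.
    exact: cst_continuous.
  have /cf /subspace_continuousP /(_ _ (hV y yr)) h : slice_dir l \in [:: q1; qi; J].
    rewrite !inE /slice_dir; elim/ord4P: l l3 => //= _; by rewrite eqxx ?orbT.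
  move=> A /h hA; have c := @cont_slice_lift p y _ hA.
  have nr := qnorm_lt_nbhs yr.
  rewrite !nbhs_simpl /= in c *.
  apply: (@filterS2 _ _ (nbhs_filter y) _ _ _ _ c nr) => z h1 h2.
  by apply: h1; exact: hV.
have cg' y l k : qnorm y < r -> {for y, continuous (fun z => slice_pull' p f l z 0 k)}.
  by move=> yr; exact: (rot_comp_cont (cD y l yr)).
move=> y yr; split.
- by move=> l; exact: dqP.
- move=> k; apply: (@continuous_of_partials _ _ (fun l z => slice_pull' p f l z 0 k)).
    by apply: (@filterS _ _ (nbhs_filter y) _ _ _ (qnorm_lt_nbhs yr)) => z zr l; exact: dqP.
  by move=> l; exact: cg'.
- by move=> l k; exact: cg'.
have E := rot_dirac3 (ef _ (hV y yr)).
rewrite /dirac sum_ord4 /slice_pull' {4}/slice_dir /= derive0 rot0 mulq0 addr0.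
by rewrite /eq4 /slice_dir /= mul1q.
Qed.

(** The lifted function is regular in a four-dimensional ball, hence a power
    series there; it does not depend on the fourth variable, so the Fueter
    equation reduces to the monogenic equation in three variables. *)
Theorem slice_expansion (V : set (quat R)) p (r rho : R) f : monogenic J V f ->
  (forall y, y 0 3 = 0 -> qnorm y < r -> V (p + rot al be y)) -> 0 < rho -> rho < r ->
  exists a (M : R), [/\ mono a,
    0 <= M /\ (forall k y, qnorm (ev a k y) <= M * (qnorm y / rho) ^+ k),
    exists2 N : R, 0 <= N & geobnd N rho a &
    forall y, y 0 3 = 0 -> qnorm y < rho ->
      series (ev a ^~ y) @ \oo --> rot al (- be) (f (p + rot al be y))].
Proof.
move=> mf hV rho0 rr.
have hV' y : qnorm y < r -> V (slice_lift p y).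
  by move=> yr; apply: hV; [exact: flat3|exact: le_lt_trans (flat_norm y) yr].
have reg := slice_pull_regular mf hV'.
have [a [M [M0 ha hak hc]]] := regular_ball_expansion rho0 rr reg.
have cv y : qnorm y < rho -> series (ev a ^~ y) @ \oo --> slice_pull p f y.
  move=> yr; have [C hC] := hc y yr.
  have t0 : 0 <= qnorm y / rho by rewrite divr_ge0 ?qnorm_ge0 ?(ltW rho0).
  have t1 : qnorm y / rho < 1 by rewrite ltr_pdivrMr// mul1r.
  have C1 : 0 < `|C| + 1 by rewrite ltr_wpDl.
  apply/qcvgP => e e0.
  have : (fun n => (qnorm y / rho) ^+ n) @ \oo --> (0 : R).
    by apply: cvg_expr; rewrite ger0_norm.
  move=> /cvgrPdist_le /(_ (e / (`|C| + 1)) (divr_gt0 e0 C1)) [N _ hN].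
  exists N.+1 => -[//|n] Nn; have /= := hN n Nn; rewrite sub0r normrN ger0_norm ?exprn_ge0// => h.
  rewrite /series /= big_mkord; apply: (le_trans (hC n)).
  apply: (@le_trans _ _ ((`|C| + 1) * (qnorm y / rho) ^+ n)).
    by rewrite ler_wpM2r ?exprn_ge0//; have := ler_norm C; lra.
  by rewrite mulrC -ler_pdivlMr.
have box (d : R) y : (forall m, `|y 0 m| < d) -> qnorm y <= 4 * d.
  by move=> h; apply: qnorm_le_coord => m; exact: ltW.
have he : hasexp setT a (slice_pull p f).
  exists M, rho; split=> // y _ hy; apply: cv; apply: (le_lt_trans (box _ _ hy)).
  by lra.
have hd l := (hasexp_deriv (S := setT) (l := l) (fun y t _ => I) he).1.
exists a, M; split => //; last first.
- move=> y y3 yr; have := cv y yr; rewrite /slice_pull /slice_lift flat_id//.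
- by exists M.
have hD := hasexpD (hasexpD (hd 0) (hasexp_mull qi (hd 1))) (hasexp_mull qj (hd 2)).
split; first by have [N [s [s0 hb _]]] := hD; exists N, s.
have d8 : 0 < rho / 8 by rewrite divr_gt0.
move=> k y; apply: (hasexp_zero d8 _ hD) => // z _ hz.
have zr : qnorm z < r.
  apply: (le_lt_trans (box _ _ hz)).
  by have : 4 * (rho / 8) < r by lra.
have [dz _ _ e] := reg z zr.
have E l : 'D_(eq4 R l) (slice_pull p f) z = slice_pull' p f l z.
  have dv : derivable (slice_pull p f) z (eq4 R l).
    apply/derivable_mxP => i j; rewrite (ord1 i); by have [] := dz l j.
  apply/rowP => j; rewrite (derive_mx dv) mxE.
  by have [_ ->] := dz l j.
have e3 : slice_pull' p f 3 z = 0.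
  by rewrite /slice_pull' /slice_dir [nth _ _ _]/= derive0 rot0.
rewrite /dirac sum_ord4 e3 mulq0 addr0 eq4_0 eq4_1 eq4_2 mul1q in e.
by rewrite (E 0) (E 1) (E 2).
Qed.

End Lift.

(** * Taylor expansion on a slice *)

Section SliceTaylor.
Variable R : realType.
Implicit Types (x y z c p : quat R) (l : 'I_4) (f F : quat R -> quat R).
Implicit Types (a b : seq 'I_4 -> quat R) (Omega V : set (quat R)).

Section RotatedSeries.
Variables al be : R.
Hypothesis albe : al ^+ 2 + be ^+ 2 = 1.
Let rt := rot al be.

Lemma dser_rot l b : dser l (fun w => rt (b w)) = (fun w => rt (dser l b w)).
Proof.
apply/funext => w; rewrite /dser; elim: w b => [//|m w IH] b /=.
by rewrite (IH (fun v => b (m :: v))) /rt rotD.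
Qed.

Lemma deltab_rot k1 k2 b : deltab k1 k2 (fun w => rt (b w)) = (fun w => rt (deltab k1 k2 b w)).
Proof.
have H1 k d : iter k (dser 1) (fun w => rt (d w)) = (fun w => rt (iter k (dser 1) d w)).
  by elim: k => [//|k IH]; rewrite !iterS IH dser_rot.
have H2 k d : iter k (@laplb R) (fun w => rt (d w)) = (fun w => rt (iter k (@laplb R) d w)).
  elim: k => [//|k IH]; rewrite !iterS IH /laplb !dser_rot.
  by apply/funext => w; rewrite /rt rotD.
have H3 d : dbarb (fun w => rt (d w)) = (fun w => rt (dbarb d w)).
  by rewrite /dbarb !dser_rot; apply/funext => w; rewrite /rt rotD (rotM albe) rot_qi.
by rewrite /deltab; case: (odd k2); rewrite ?H3 H2 H1.
Qed.

Lemma ev_rot b k y : ev (fun w => rt (b w)) k y = rt (ev b k y).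
Proof.
elim: k b => [//|k IH] b /=; rewrite /rt rot_sum; apply: eq_bigr => l _.
by rewrite rotZ; congr (_ *: _); exact: IH.
Qed.

Lemma qcvg_rot (u : nat -> quat R) (L : quat R) : u @ \oo --> L ->
  (fun n => rt (u n)) @ \oo --> rt L.
Proof.
move=> /qcvgP h; apply/qcvgP => e /h [N hN]; exists N => n /hN.
by rewrite -rotB rot_norm.
Qed.

Lemma series_rot (u : nat -> quat R) :
  series (fun k => rt (u k)) = (fun n => rt (series u n)).
Proof. by apply/funext => n; rewrite /series /= /rt rot_sum. Qed.

End RotatedSeries.

Lemma derive_translate f p v y : 'D_v (fun z => f (p + z)) y = 'D_v f (p + y).
Proof.
rewrite /derive.
have -> : (fun h : R => h^-1 *: (((fun z => f (p + z)) \o shift y) (h *: v) - f (p + y))) =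
  (fun h : R => h^-1 *: ((f \o shift (p + y)) (h *: v) - f (p + y))) => //.
by apply/funext => h /=; rewrite addrCA.
Qed.

(** The partial derivatives are abstracted into operators d0 and d1 that commute
   with translations. *)
Lemma translate_operator (d0 d1 : (quat R -> quat R) -> quat R -> quat R) k1 k2 f p :
  (forall F, d0 (fun z => F (p + z)) = (fun y => d0 F (p + y))) ->
  (forall F, d1 (fun z => F (p + z)) = (fun y => d1 F (p + y))) ->
  let op F := iter k1 d1 (iter k2./2 (fun G x => d0 (d0 G) x + d1 (d1 G) x)
    (if odd k2 then (fun x => d0 F x + qi *q d1 F x) else F)) in
  op (fun z => f (p + z)) = (fun y => op f (p + y)).
Proof.
move=> h0 h1 op.
have H1 k F : iter k d1 (fun z => F (p + z)) = (fun z => iter k d1 F (p + z)).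
  by elim: k => [//|k IH]; rewrite !iterS IH h1.
have H2 k F : iter k (fun G x => d0 (d0 G) x + d1 (d1 G) x) (fun z => F (p + z)) =
    (fun z => iter k (fun G x => d0 (d0 G) x + d1 (d1 G) x) F (p + z)).
  by elim: k => [//|k IH]; rewrite !iterS IH h0 h1 h0 h1.
rewrite /op; case: (odd k2); last by rewrite H2 H1.
by rewrite h0 h1 (H2 _ (fun x => d0 f x + qi *q d1 f x)) H1.
Qed.

Lemma delta0_translate k1 k2 f p :
  delta0 k1 k2 (fun z => f (p + z)) = (fun y => delta0 k1 k2 f (p + y)).
Proof.
apply: (@translate_operator (fun F => 'D_q1 F) (fun F => 'D_qi F)) => F;
  by apply/funext => y; exact: derive_translate.
Qed.

Definition cplane : set (quat R) := [set y | y 0 2 = 0 /\ y 0 3 = 0].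

Lemma hasexp_delta0 b F k1 k2 : hasexp cplane b F ->
  hasexp cplane (deltab k1 k2 b) (delta0 k1 k2 F).
Proof.
have S0 y (t : R) : cplane y -> cplane (y + t *: eq4 R 0).
  by move=> [y2 y3]; split; rewrite !addqE !scaleqE !eq4E /= ?y2 ?y3 mulr0 addr0.
have S1 y (t : R) : cplane y -> cplane (y + t *: eq4 R 1).
  by move=> [y2 y3]; split; rewrite !addqE !scaleqE !eq4E /= ?y2 ?y3 mulr0 addr0.
have D0 b' G : hasexp cplane b' G -> hasexp cplane (dser 0 b') ('D_q1 G).
  by move=> h; exact: (hasexp_deriv S0 h).1.
have D1 b' G : hasexp cplane b' G -> hasexp cplane (dser 1 b') ('D_qi G).
  by move=> h; exact: (hasexp_deriv S1 h).1.
have H1 k b' G : hasexp cplane b' G -> hasexp cplane (iter k (dser 1) b')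
    (iter k (fun g : quat R -> quat R => 'D_qi g) G).
  by move=> h; elim: k => [//|k IH]; rewrite !iterS; exact: D1.
have H2 k b' G : hasexp cplane b' G -> hasexp cplane (iter k (@laplb R) b') (iter k (@laplC R) G).
  by move=> h; elim: k => [//|k IH]; rewrite !iterS; exact: (hasexpD (D0 _ _ (D0 _ _ IH)) (D1 _ _ (D1 _ _ IH))).
have H3 b' G : hasexp cplane b' G -> hasexp cplane (dbarb b') (dbarC G).
  by move=> h; exact: (hasexpD (D0 _ _ h) (hasexp_mull qi (D1 _ _ h))).
by move=> h; rewrite /delta0 /deltab; apply: H1; apply: H2; case: (odd k2) => //; exact: H3.
Qed.

(** Rotated back, the series of [slice_expansion] represents f along C near p, so
    its coefficients are read off by the operators [delta0] and the blocks are
    the terms [term13], by [mono_taylor] and [deltab_dd]. *)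
Theorem slice_taylor (al be : R) V p (r rho : R) f : al ^+ 2 + be ^+ 2 = 1 ->
  monogenic (rot al be qj) V f ->
  (forall y, y 0 3 = 0 -> qnorm y < r -> V (p + rot al be y)) -> 0 < rho -> rho < r ->
  exists2 M : R, 0 <= M & forall y, y 0 3 = 0 ->
    (forall k, qnorm (term13 f p k (p + rot al be y)) <= M * (qnorm y / rho) ^+ k) /\
    (qnorm y < rho -> series (fun k => term13 f p k (p + rot al be y)) @ \oo --> f (p + rot al be y)).
Proof.
move=> albe mf hV r0 rr.
have [a [M [ma [M0 hM] [N N0 hN] hc]]] := slice_expansion albe mf hV r0 rr.
have hc' y : y 0 3 = 0 -> qnorm y < rho ->
    series (ev (fun w => rot al be (a w)) ^~ y) @ \oo --> f (p + rot al be y).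
  move=> y3 yr; have := qcvg_rot albe (hc y y3 yr); rewrite (rotVK albe) -series_rot//.
  by rewrite (_ : (fun k => _) = (ev (fun w => rot al be (a w)) ^~ y))// funeqE => k; rewrite ev_rot.
have he : hasexp cplane (fun w => rot al be (a w)) (fun y => f (p + y)).
  exists N, rho; split => // [w|y [y2 y3] hy]; first by rewrite (rot_norm albe).
  rewrite -{2}(rot_complex al be y2 y3); apply: hc' => //.
  apply: (@le_lt_trans _ _ (4 * (rho / 16))); last by lra.
  by apply: qnorm_le_coord => m; exact: ltW.
have coef k1 k2 : delta0 k1 k2 f p = rot al be (jn R k2 *q dd k1 k2 a [::]).
  have := hasexp0 _ (hasexp_delta0 k1 k2 he); rewrite delta0_translate addr0 (deltab_rot albe).
  by rewrite (deltab_dd _ _ ma); apply; split; rewrite mxE.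
have T k y : y 0 3 = 0 -> term13 f p k (p + rot al be y) = rot al be (ev a k y).
  move=> y3; rewrite /term13 (mono_taylor _ ma y3) rot_sum; apply: eq_bigr => k1 _.
  rewrite [_ + _ - _]addrAC subrr add0r (rot_fueterT albe)// /coef13 coef -rotZ -(rotM albe).
  by rewrite /fpol -scaleqAl -scaleqAr mulqA.
exists M => // y y3; split=> [k|yr]; first by rewrite T// (rot_norm albe).
have := hc' y y3 yr; rewrite (_ : (ev _ ^~ y) = (fun k => term13 f p k (p + rot al be y)))//.
by rewrite funeqE => k; rewrite ev_rot T.
Qed.

Lemma rot_param x : exists al be : R, al ^+ 2 + be ^+ 2 = 1 /\
  exists2 y : quat R, y 0 3 = 0 & x = rot al be y.
Proof.
pose s := Num.sqrt (x 0 2 ^+ 2 + x 0 3 ^+ 2).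
have ss : s ^+ 2 = x 0 2 ^+ 2 + x 0 3 ^+ 2 by rewrite sqr_sqrtr// addr_ge0 ?sqr_ge0.
have [s0|s0] := eqVneq s 0.
  exists 1, 0; split; first by rewrite expr0n /= addr0 expr1n.
  have /eqP : x 0 2 ^+ 2 + x 0 3 ^+ 2 = 0 by rewrite -ss s0 expr0n.
  rewrite paddr_eq0 ?sqr_ge0// !sqrf_eq0 => /andP[/eqP x2 /eqP x3].
  by exists x => //; rewrite /rot; apply: quatP; rewrite !qcoordE ?x2 ?x3; ring.
exists (x 0 2 / s), (x 0 3 / s); split.
  by rewrite !expr_div_n -mulrDl -ss divff// expf_neq0.
exists (mkq (x 0 0) (x 0 1) s 0); first by rewrite qcoordE.
by rewrite /rot; apply: quatP; rewrite !qcoordE ?mulr0 ?subr0 ?addr0 ?divfK.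
Qed.

Lemma circP J : circ J <-> exists al be : R, al ^+ 2 + be ^+ 2 = 1 /\ J = rot al be qj.
Proof.
split=> [[al [be [ab ->]]]|[al [be [ab ->]]]]; exists al, be; split => //; by rewrite rot_qj.
Qed.

(** Write x = x' + x'' with x' in C and x'' in the span of j and k. The rotation
    sends x to x' + u x'' with u = al + be i, while x' and x'' are half the sum and
    half the difference of x and its rotation by pi. *)
Lemma rot_halves (al be : R) x c : rot al be x *q c =
  2^-1 *: ((q1 + (al *: q1 + be *: qi)) *q (x *q c) +
           (q1 - (al *: q1 + be *: qi)) *q (rot (-1) 0 x *q c)).
Proof.
rewrite !mulqA -mulqDl -scaleqAl; congr (_ *q _).
by rewrite /rot; qexpand; apply: quatP; rewrite ?qcoordE; field.
Qed.

End SliceTaylor.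

(** * Taylor expansion in the ball *)

Section BallExpansion.
Variable R : realType.
Implicit Types (x y z c p : quat R) (f : quat R -> quat R) (Omega V : set (quat R)).

Lemma space3_complex z (al be : R) : qcomplex z -> space3 (rot al be qj) z.
Proof. by move=> [a [b ->]]; exists a, b, 0; rewrite scale0r addr0. Qed.

Lemma unit_qnorm_le2 (al be : R) : al ^+ 2 + be ^+ 2 = 1 ->
  qnorm (q1 + (al *: q1 + be *: qi)) <= 2 /\ qnorm (q1 - (al *: q1 + be *: qi)) <= 2.
Proof.
move=> ab.
have nu : qnorm (al *: q1 + be *: qi) = 1.
  rewrite qnormE /qnorm2 !qcoordE [X in Num.sqrt X](_ : _ = al ^+ 2 + be ^+ 2); last by ring.
  by rewrite ab sqrtr1.
have h1 := qnormD (q1 : quat R) (al *: q1 + be *: qi).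
have h2 := qnormD (q1 : quat R) (- (al *: q1 + be *: qi)).
by rewrite qnorm_q1 ?qnormN nu in h1 h2; split; rewrite -(_ : 1 + 1 = 2 :> R).
Qed.

Section Ball.
Variables (Omega : set (quat R)) (z0 : quat R) (r : R) (f : quat R -> quat R).
Hypotheses (hz0 : qcomplex z0) (hball : qball z0 r `<=` Omega) (hf : regular13 Omega f).

Lemma slice_in_ball (al be : R) y : al ^+ 2 + be ^+ 2 = 1 -> y 0 3 = 0 -> qnorm y < r ->
  qslice Omega (rot al be qj) (z0 + rot al be y).
Proof.
move=> ab y3 yr; split.
  by apply: hball; rewrite /qball /= [_ + _ - _]addrAC subrr add0r (rot_norm ab).
by apply: (space3D ab); [exact: space3_complex|apply/space3_rot; exists y].
Qed.

Lemma slice_monogenic (al be : R) : al ^+ 2 + be ^+ 2 = 1 ->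
  monogenic (rot al be qj) (qslice Omega (rot al be qj)) f.
Proof. by move=> ab; apply: hf; apply/circP; exists al, be. Qed.

(** By [rot_halves] the terms on the slice of j determine those on every slice, so
    the bound obtained there is uniform. *)
Lemma term13_bound (rho : R) : 0 < rho -> rho < r -> exists2 M : R, 0 <= M &
  forall k x, qnorm (term13 f z0 k x) <= M * (qnorm (x - z0) / rho) ^+ k.
Proof.
move=> r0 rr; have e1 : (1 : R) ^+ 2 + 0 ^+ 2 = 1 by rewrite expr0n /= addr0 expr1n.
have [M M0 hM] := slice_taylor e1 (slice_monogenic e1)
  (fun y => @slice_in_ball _ _ y e1) r0 rr.
have idr y : rot 1 0 y = y by rewrite /rot; qring.
exists (2 * M); first by rewrite mulr_ge0.
move=> k x; have [al [be [ab [y y3 xy]]]] := rot_param (x - z0).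
have -> : x = z0 + rot al be y by rewrite -xy addrC subrK.
rewrite [X in qnorm X / _](_ : _ = rot al be y); last by rewrite addrAC subrr add0r.
rewrite (rot_norm ab).
have m1 : (-1 : R) ^+ 2 + 0 ^+ 2 = 1 by rewrite sqrrN.
pose y' := rot (-1) 0 y; have y'3 : y' 0 3 = 0 by rewrite /y' /rot qcoordE y3; ring.
have ny' : qnorm y' = qnorm y by rewrite (rot_norm m1).
have t1 := (hM _ y3).1 k; have t2 := (hM _ y'3).1 k.
rewrite !idr ny' in t1 t2.
have -> : term13 f z0 k (z0 + rot al be y) =
  2^-1 *: ((q1 + (al *: q1 + be *: qi)) *q term13 f z0 k (z0 + y) +
           (q1 - (al *: q1 + be *: qi)) *q term13 f z0 k (z0 + y')).
  rewrite /term13 !mulq_sumr -big_split scaler_sumr; apply: eq_bigr => k1 _ /=.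
  rewrite ![z0 + _ - z0]addrAC subrr !add0r /y'.
  by rewrite (rot_fueterT ab)// (rot_fueterT m1)// rot_halves.
have [u1 u2] := unit_qnorm_le2 ab.
set B := M * _ in t1 t2 *.
rewrite qnormZ ger0_norm ?invr_ge0//.
apply: (@le_trans _ _ (2^-1 * (2 * B + 2 * B))); last by rewrite /B; lra.
rewrite ler_wpM2l ?invr_ge0//; apply: (le_trans (qnormD _ _)).
by rewrite !qnormM lerD// ler_pM ?qnorm_ge0.
Qed.

(** Each x lies on a slice through z0, where [slice_taylor] applies. *)
Lemma ball_series_cvg x : qball z0 r x -> series (fun k => term13 f z0 k x) @ \oo --> f x.
Proof.
rewrite /qball /= => xr; have [al [be [ab [y y3 xy]]]] := rot_param (x - z0).
have yr : qnorm y < r by move: xr; rewrite xy (rot_norm ab).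
have x' : x = z0 + rot al be y by rewrite -xy addrC subrK.
pose rho := (qnorm y + r) / 2.
have r1 : qnorm y < rho by rewrite /rho; lra.
have r2 : rho < r by rewrite /rho; lra.
have r0 : 0 < rho by exact: le_lt_trans (qnorm_ge0 _) r1.
have [M _ hM] := slice_taylor ab (slice_monogenic ab)
  (fun y => @slice_in_ball _ _ y ab) r0 r2.
by rewrite x'; exact: (hM _ y3).2 r1.
Qed.

Lemma ball_series_abs x : qball z0 r x ->
  cvgn (series (fun k => qnorm (term13 f z0 k x))).
Proof.
rewrite /qball /= => xr; pose rho := (qnorm (x - z0) + r) / 2.
have r1 : qnorm (x - z0) < rho by rewrite /rho; lra.
have r2 : rho < r by rewrite /rho; lra.
have r0 : 0 < rho by exact: le_lt_trans (qnorm_ge0 _) r1.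
have [M M0 hM] := term13_bound r0 r2.
have t0 : 0 <= qnorm (x - z0) / rho by rewrite divr_ge0 ?qnorm_ge0 ?(ltW r0).
apply: (@series_le_cvg _ _ (fun k => M * (qnorm (x - z0) / rho) ^+ k)) => //.
- by move=> k; exact: qnorm_ge0.
- by move=> k; apply: mulr_ge0 => //; exact: exprn_ge0.
- by apply: is_cvg_geometric_series; rewrite ger0_norm// ltr_pdivrMr// mul1r.
Qed.

Lemma compact_in_smaller_ball (K : set (quat R)) : compact K -> K `<=` qball z0 r ->
  0 < r -> exists2 s : R, 0 <= s < r & forall x, K x -> qnorm (x - z0) <= s.
Proof.
move=> cK Kr r0; have [->|/set0P K0] := eqVneq K set0.
  by exists 0; rewrite ?lexx.
have cn : continuous (fun x => qnorm2 (x - z0)).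
  apply: cont_qnorm2 => k y; under eq_fun do rewrite addqE.
  exact: (cvgD (@coord_cont R k y) (cvg_cst ((- z0) 0 k))).
have [m mK hm] := EVT_max_rV K0 cK (continuous_subspaceT cn).
exists (qnorm (m - z0)) => [|x Kx].
  by rewrite qnorm_ge0; apply: Kr; rewrite inE in mK.
rewrite -(@ler_pXn2r _ 2) ?nnegrE ?qnorm_ge0// !sqr_qnorm; apply: hm.
by rewrite inE.
Qed.

Lemma geometric_tail (u : nat -> quat R) (L : quat R) (M t : R) n : 0 <= M ->
  0 <= t -> t < 1 -> (forall k, qnorm (u k) <= M * t ^+ k) -> series u @ \oo --> L ->
  qnorm (L - series u n) <= M / (1 - t) * t ^+ n.
Proof.
move=> M0 t0 t1 hu cu; have t1' : 0 < 1 - t by lra.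
apply: (@qcvg_le _ (fun m => series u (m + n)%N - series u n)); last first.
  by apply: cvgB; [exact: (cvg_comp _ _ (cvg_addnr n) cu)|exact: cvg_cst].
move=> m; rewrite /series /= (@big_cat_nat _ _ _ n)//=; last exact: leq_addl.
rewrite addrAC subrr add0r -{1}[n]add0n big_addn addnK; apply: (le_trans (qnorm_sum _ _ _)).
apply: (@le_trans _ _ (M * t ^+ n * \sum_(0 <= i < m) t ^+ i)).
  by rewrite mulr_sumr; apply: ler_sum => i _; rewrite -mulrA -exprD addnC; exact: hu.
have -> : M / (1 - t) * t ^+ n = M * t ^+ n * (1 - t)^-1 by ring.
apply: ler_wpM2l; first by apply: mulr_ge0 => //; exact: exprn_ge0.
rewrite -div1r ler_pdivlMr//; suff -> : (\sum_(0 <= i < m) t ^+ i) * (1 - t) = 1 - t ^+ m.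
  by rewrite gerBl exprn_ge0.
elim: m => [|m IH]; first by rewrite big_nil mul0r expr0 subrr.
by rewrite big_nat_recr//= mulrDl IH exprS; ring.
Qed.

(** A compact subset of the ball lies in a smaller closed ball, on which
    [term13_bound] makes the remainders geometrically small. *)
Lemma ball_series_uniform (K : set (quat R)) : 0 < r -> compact K -> K `<=` qball z0 r ->
  {uniform K, (fun n x => series (fun k => term13 f z0 k x) n) @ \oo --> f}.
Proof.
move=> r0 cK Kr; have [s /andP[s0 sr] hs] := compact_in_smaller_ball cK Kr r0.
pose rho := (s + r) / 2.
have r1 : s < rho by rewrite /rho; lra.
have r2 : rho < r by rewrite /rho; lra.
have rho0 : 0 < rho by exact: le_lt_trans r1.
have [M M0 hM] := term13_bound rho0 r2.
pose t := s / rho; have t0 : 0 <= t by rewrite divr_ge0 ?(ltW rho0).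
have t1 : t < 1 by rewrite ltr_pdivrMr// mul1r.
have tail n x : K x ->
    qnorm (f x - series (fun k => term13 f z0 k x) n) <= M / (1 - t) * t ^+ n.
  move=> Kx; apply: geometric_tail => //; last by apply: ball_series_cvg; exact: Kr.
  move=> k; apply: (le_trans (hM k x)); apply: ler_wpM2l => //.
  have i0 : 0 <= rho^-1 by rewrite invr_ge0 (ltW rho0).
  have xt : qnorm (x - z0) / rho <= t by apply: ler_wpM2r => //; exact: hs.
  by apply: lerXn2r => //; rewrite nnegrE; apply: mulr_ge0 => //; exact: qnorm_ge0.
move=> P /uniform_nbhs [E [entE EP]].
move: entE; rewrite -entourage_ballE => -[e /= e0 hE].
have : (fun n => M / (1 - t) * t ^+ n) @ \oo --> (0 : R).
  rewrite -[X in _ --> X](mulr0 (M / (1 - t))); apply: cvgM; first exact: cvg_cst.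
  by apply: cvg_expr; rewrite ger0_norm.
move=> /cvgrPdist_lt /(_ e e0) [N _ hN]; exists N => // n /= Nn; apply: EP => x Kx.
apply: hE => /=; rewrite -ball_normE /ball_ /=; apply: (le_lt_trans (mxnorm_le_qnorm _)).
apply: (le_lt_trans (tail n x Kx)); apply: le_lt_trans (hN n Nn).
by rewrite sub0r normrN ler_norm.
Qed.

End Ball.
End BallExpansion.

(** * Slice preserving functions *)

Section SlicePreserving.
Variable R : realType.
Implicit Types (x y z c p : quat R) (f : quat R -> quat R) (Omega V : set (quat R)).

Lemma monogenic_subset J V V' f : V' `<=` V -> monogenic J V f -> monogenic J V' f.
Proof.
move=> sub [d c e]; split=> [x v /sub|v hv|x /sub]; [exact: d| |exact: e].
exact: continuous_subspaceW (c v hv).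
Qed.

(** The polynomial is (y0 + y2 j)^k2, which stays in the span of 1 and j. *)
Lemma fueterT_0 k2 y : y 0 3 = 0 ->
  (fueterT 0 k2 y) 0 1 = 0 /\ (fueterT 0 k2 y) 0 3 = 0.
Proof.
move=> y3; elim: k2 => [|k2 [IH1 IH3]]; first by rewrite /q1 /= !qcoordE.
have : k2.+1%:R *: fueterT 0 k2.+1 y =
    k2.+1%:R *: (fueterT 0 k2 y *q (y 0 0 *: q1 + y 0 2 *: qj + y 0 3 *: qk)).
  by rewrite -{1}[k2.+1]add0n fueterT_rec scale0r add0r.
move=> /(scalerI (_ : k2.+1%:R != 0 :> R)) ->; last by rewrite pnatr_eq0.
by rewrite /q1 /qj /qk !qcoordE y3 IH1 IH3; split; ring.
Qed.

Lemma jn_double t : jn R t.*2 = q1 \/ jn R t.*2 = - q1.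
Proof.
elim: t => [|t IH]; first by left.
have -> : jn R t.+1.*2 = - jn R t.*2.
  rewrite doubleS [LHS]/= mulqA (_ : (- qj) *q (- qj) = - q1); last by qring.
  by rewrite mulNq mul1q.
by case: IH => ->; [right|left; rewrite opprK].
Qed.

(** [fpol_k0] concerns the product with the k2-th power of - j, which is 1 or -1
    for even k2. *)
Lemma fueterT_even k1 k2 y : ~~ odd k2 -> y 0 3 = 0 -> (fueterT k1 k2 y) 0 3 = 0.
Proof.
move=> ek y3; have := fpol_k0 k1 k2 y3; rewrite /fpol scaleqE => /eqP.
have nz : (k1`! * k2`!)%:R != 0 :> R by rewrite pnatr_eq0 -lt0n muln_gt0 !fact_gt0.
rewrite mulf_eq0 invr_eq0 (negbTE nz) /= -[X in jn R X](even_halfK ek) => /eqP.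
case: (jn_double k2./2) => ->; rewrite ?mulqN mulq1// oppqE => /eqP.
by rewrite oppr_eq0 => /eqP.
Qed.

Definition slice_coefs (c : nat -> nat -> quat R) :=
  [/\ forall k1, qcomplex (c k1 0%N),
      forall k1 k2, (k1 = 0 /\ k2 <> 0)%N \/ (k1 <> 0 /\ ~~ odd k2)%N -> qreal (c k1 k2)
    & forall k1 k2, k1 <> 0%N -> odd k2 -> c k1 k2 = 0].

(** After unrotating, each summand is a Fueter polynomial without k-component times
    a real coefficient, apart from the constant term, which lies in C. *)
Lemma slice_coefs_block (al be : R) f p k y : al ^+ 2 + be ^+ 2 = 1 ->
  slice_coefs (coef13 f p) -> y 0 3 = 0 ->
  rot al (- be) (term13 f p k (p + rot al be y)) 0 3 = 0.
Proof.
move=> ab [hc hr h0] y3; rewrite /term13 rot_sum summxE big1// => k1 _.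
move: (k - k1)%N => k2; rewrite [_ + _ - _]addrAC subrr add0r (rot_fueterT ab)//.
rewrite (rotM (albeN ab)) (rotK ab).
have rr c : qreal c -> rot al (- be) c = c.
  by move=> [a ->]; apply: rot_complex; rewrite /q1 !qcoordE mulr0.
have real c (t : quat R) : qreal c -> t 0 3 = 0 -> (t *q rot al (- be) c) 0 3 = 0.
  move=> hcr t3; rewrite rr//; case: hcr => a ->.
  by rewrite scaleqAr mulq1 scaleqE t3 mulr0.
have [k10|k10] := eqVneq (nat_of_ord k1) 0%N.
  rewrite k10; case: k2 => [|k2].
    have [a [b ->]] := hc 0%N; rewrite [fueterT _ _ _]/= mul1q rot_complex;
      by rewrite /q1 /qi !qcoordE; ring.
  by apply: real; [apply: hr; left|exact: (fueterT_0 _ y3).2].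
have [ok|ek] := boolP (odd k2).
  by rewrite h0// ?rot0 ?mulq0 ?mxE//; exact/eqP.
by apply: real; [apply: hr; right; split=> //; exact/eqP|exact: fueterT_even].
Qed.

Lemma qcvg_k (al be : R) (u : nat -> quat R) (L : quat R) : al ^+ 2 + be ^+ 2 = 1 ->
  (forall n, rot al be (u n) 0 3 = 0) -> u @ \oo --> L -> rot al be L 0 3 = 0.
Proof.
move=> ab u3 cu; apply/eqP; rewrite -normr_le0; apply/ler_addgt0Pr => e e0; rewrite add0r.
have /qcvgP /(_ e e0) [N /(_ N (leqnn N)) h] := qcvg_rot ab cu.
by apply: le_trans h; have := coord_le_qnorm (rot al be L - rot al be (u N)) 3;
  rewrite addqE oppqE u3 subr0.
Qed.

Lemma nbhs_qball (A : set (quat R)) x : nbhs x A <-> exists2 e : R, 0 < e & qball x e `<=` A.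
Proof.
split=> [/nbhs_ballP[e /= e0 h]|[e e0 h]].
  exists e => // y xy; apply: h; rewrite -ball_normE /ball_ /=.
  by apply: (le_lt_trans (mxnorm_le_qnorm _)); rewrite qnormB.
apply/nbhs_ballP; exists (e / 8); first exact: divr_gt0.
move=> y; rewrite -ball_normE /ball_ /= => xy; apply: h; rewrite /qball /= qnormB.
by apply: (le_lt_trans (qnorm_le_mxnorm _)); lra.
Qed.

(** Along a slice the k-component is given by a convergent power series, so it
   vanishes on a whole ball as soon as it vanishes near the centre. *)
Lemma slice_identity (al be : R) V p (r s : R) f : al ^+ 2 + be ^+ 2 = 1 ->
  monogenic (rot al be qj) V f ->
  (forall y, y 0 3 = 0 -> qnorm y < r -> V (p + rot al be y)) -> 0 < s ->
  (forall y, y 0 3 = 0 -> qnorm y < s -> space3 (rot al be qj) (f (p + rot al be y))) ->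
  forall y, y 0 3 = 0 -> qnorm y < r -> space3 (rot al be qj) (f (p + rot al be y)).
Proof.
move=> ab mf hV s0 hs y y3 yr; pose rho := (qnorm y + r) / 2.
have r1 : qnorm y < rho by rewrite /rho; lra.
have r2 : rho < r by rewrite /rho; lra.
have r0 : 0 < rho by exact: le_lt_trans (qnorm_ge0 _) r1.
have [a [M [_ [M0 hM] _ hc]]] := slice_expansion ab mf hV r0 r2.
have re c : (c 0 3 *: q1 : quat R) = 0 -> c 0 3 = 0.
  by move=> /(congr1 (fun q : quat R => q 0 0)); rewrite scaleqE /q1 !mkq_0 mxE mulr1.
have cv z : z 0 3 = 0 -> qnorm z < rho ->
    series (fun k => (ev a k z 0 3) *: (q1 : quat R)) @ \oo -->
    (rot al (- be) (f (p + rot al be z)) 0 3) *: (q1 : quat R).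
  move=> z3 zr; have /qcvgP h := hc z z3 zr; apply/qcvgP => e /h [N hN].
  exists N => n /hN; apply: le_trans.
  rewrite /series /= -scaler_suml -scalerBl qnormZ.
  rewrite qnorm_q1 mulr1.
  by apply: le_trans (coord_le_qnorm _ 3); rewrite addqE oppqE summxE.
have z0 : forall k, (ev a k y 0 3) *: (q1 : quat R) = 0.
  pose d := Num.min rho s / (qnorm y + 1).
  have y1 : 0 < qnorm y + 1 by rewrite ltr_wpDl ?qnorm_ge0.
  have d0 : 0 < d by rewrite divr_gt0// lt_min r0.
  have Q0 : 0 < (qnorm y + 1) / rho by rewrite divr_gt0.
  apply: (@qseries_zero _ _ M _ _ d0 Q0) => [k|t t0 td].
    rewrite qnormZ qnorm_q1 mulr1.
    apply: (le_trans (coord_le_qnorm _ 3)); apply: (le_trans (hM k y)).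
    apply: ler_wpM2l => //; apply: lerXn2r.
    - by rewrite nnegrE divr_ge0 ?qnorm_ge0 ?(ltW r0).
    - by rewrite nnegrE (ltW Q0).
    by apply: ler_wpM2r; [rewrite invr_ge0 (ltW r0)|rewrite lerDl].
  have ty : qnorm (t *: y) < Num.min rho s.
    rewrite qnormZ gtr0_norm//; apply: (@le_lt_trans _ _ (t * (qnorm y + 1))).
      by rewrite ler_wpM2l ?(ltW t0)// lerDl.
    by rewrite -ltr_pdivlMr.
  have ty3 : (t *: y) 0 3 = 0 by rewrite scaleqE y3 mulr0.
  move: ty; rewrite lt_min => /andP[tr ts].
  have := cv _ ty3 tr; have /(space3_k ab) -> := hs _ ty3 ts; rewrite scale0r.
  by under eq_fun do rewrite evX scaleqE -scalerA.
apply/(space3_k ab); apply: re.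
apply: (qcvg_unique (cv y y3 r1)); under eq_fun do rewrite z0.
apply/qcvgP => e e0; exists 0%N => n _; rewrite /series /= big1 ?subrr ?qnorm0 ?ltW//.
Qed.

Section Preserving.
Variables (Omega : set (quat R)) (z0 : quat R) (r : R) (f : quat R -> quat R).
Hypotheses (hz0 : qcomplex z0) (hball : qball z0 r `<=` Omega) (hf : regular13 Omega f).
Hypothesis hc : slice_coefs (coef13 f z0).

Lemma ball_values (al be : R) x : al ^+ 2 + be ^+ 2 = 1 -> qball z0 r x ->
  space3 (rot al be qj) x -> space3 (rot al be qj) (f x).
Proof.
move=> ab xr xJ.
have [y y3 xy] : exists2 y : quat R, y 0 3 = 0 & x = z0 + rot al be y.
  have /space3_rot [y y3 e] : space3 (rot al be qj) (x - z0).
    apply: (space3D ab) => //; have [a [b ->]] := hz0.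
    by exists (- a), (- b), 0; rewrite scale0r addr0 !scaleNr opprD.
  by exists y; rewrite // -e addrC subrK.
apply/(space3_k ab); apply: (qcvg_k (albeN ab) _ (ball_series_cvg hz0 hball hf xr)) => n.
rewrite /series /= rot_sum summxE big1// => k _.
by rewrite xy slice_coefs_block.
Qed.

Lemma preserving_ball : slice_preserving13 (qball z0 r) f.
Proof.
split=> [J cJ|J /circP[al [be [ab ->]]] _ [x [xr xJ] <-]]; last exact: ball_values.
by apply: monogenic_subset (hf cJ) => x [/hball Ox Jx].
Qed.

(** The set of points of the slice near which f stays in the slice is open, is
    closed by [slice_identity] and contains z0. *)
Lemma preserving_connected : 0 < r -> open Omega ->
  (forall J, circ J -> connected (qslice Omega J)) -> slice_preserving13 Omega f.
Proof.
move=> r0 oO conn; split=> // J cJ; have /circP[al [be [ab JE]]] := cJ.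
pose A := qslice Omega J.
have mf : monogenic (rot al be qj) A f by rewrite -JE; exact: hf.
pose W := [set x | exists2 e : R, 0 < e & forall y, A y -> qnorm (y - x) < e -> space3 J (f y)].
suff AW : A `&` W = A.
  move=> _ [x Ax <-]; move: (Ax); rewrite -/A -AW => -[_ [e e0]]; apply=> //.
  by rewrite subrr qnorm0.
have rl (p x : quat R) : space3 J p -> space3 J x ->
    exists2 y : quat R, y 0 3 = 0 & x = p + rot al be y.
  move=> pJ xJ; have /space3_rot [y y3 e] : space3 (rot al be qj) (x - p).
    rewrite JE in pJ xJ; apply: (space3D ab) => //.
    by move: pJ; rewrite !(space3_k ab) rotN oppqE => ->; rewrite oppr0.
  by exists y; rewrite // -e addrC subrK.
have lr (p y : quat R) : space3 J p -> y 0 3 = 0 -> space3 J (p + rot al be y).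
  by rewrite JE => pJ y3; apply: (space3D ab) => //; apply/space3_rot; exists y.
apply: (conn J cJ).
- exists z0; split; last first.
    exists r => // y [_ yJ] yr; rewrite JE in yJ *; exact: ball_values.
  split; first by apply: hball; rewrite /qball /= subrr qnorm0.
  by rewrite JE; exact: space3_complex.
- exists W => //; rewrite openE => x [e e0 he]; apply/nbhs_qball; exists (e / 2).
    exact: divr_gt0.
  move=> x'; rewrite /qball /= => xx'; exists (e / 2); first exact: divr_gt0.
  move=> y Ay yx'; apply: he => //; rewrite (_ : y - x = (y - x') + (x' - x)).
    by apply: (le_lt_trans (qnormD _ _)); lra.
  by rewrite addrA subrK.
- exists (closure (A `&` W)); first exact: closed_closure.
  apply/seteqP; split=> [x [Ax Wx]|x [Ax clx]]; first by split => //; apply: subset_closure.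
  split=> //; have [Ox Jx] := Ax.
  have /nbhs_qball [d d0 hd] : nbhs x Omega by exact: open_nbhs_nbhs.
  have [p [[[Op Jp] [e e0 he]] px]] : (A `&` W) `&` qball x (d / 4) !=set0.
    by apply: clx; apply/nbhs_qball; exists (d / 4); [exact: divr_gt0|].
  rewrite /qball /= in px.
  have hV y : y 0 3 = 0 -> qnorm y < d / 2 -> A (p + rot al be y).
    move=> y3 yd; split; last exact: lr.
    apply: hd; rewrite /qball /= addrAC; apply: (le_lt_trans (qnormD _ _)).
    by rewrite (rot_norm ab); lra.
  have hs y : y 0 3 = 0 -> qnorm y < Num.min e (d / 2) ->
      space3 (rot al be qj) (f (p + rot al be y)).
    move=> y3; rewrite lt_min => /andP[ye yd]; rewrite -JE; apply: he; first exact: hV.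
    by rewrite addrAC subrr add0r (rot_norm ab).
  have m0 : 0 < Num.min e (d / 2) by rewrite lt_min e0 divr_gt0.
  have id := slice_identity ab mf hV m0 hs.
  exists (d / 4); first exact: divr_gt0.
  move=> y [Oy Jy] yx; have [w w3 yE] := rl p y Jp Jy.
  rewrite yE JE; apply: id => //; rewrite -(rot_norm ab).
  have -> : rot al be w = (y - x) - (p - x) by rewrite yE opprB addrA subrK addrAC subrr add0r.
  by apply: (le_lt_trans (qnormD _ _)); rewrite qnormN; lra.
Qed.

End Preserving.
End SlicePreserving.

(** * The Taylor theorem and slice preservation *)

Theorem theorem4p13 (R : realType) (Omega : set (quat R)) (z0 : quat R) (r : R)
    (f : quat R -> quat R)
    (hOmega : qdomain Omega) (hz0 : qcomplex z0) (hr : 0 < r)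
    (hball : qball z0 r `<=` Omega) (hf : regular13 Omega f) :
  [/\ (forall x, qball z0 r x ->
         series (fun k => term13 f z0 k x) @ \oo --> f x),
      (forall x, qball z0 r x ->
         cvgn (series (fun k => qnorm (term13 f z0 k x)))),
      (forall K : set (quat R), compact K -> K `<=` qball z0 r ->
         {uniform K, (fun n x => series (fun k => term13 f z0 k x) n)
                       @ \oo --> f})
    & (forall k1, qcomplex (coef13 f z0 k1 0)) ->
      (forall k1 k2, (k1 = 0 /\ k2 <> 0)%N \/ (k1 <> 0 /\ ~~ odd k2)%N ->
         qreal (coef13 f z0 k1 k2)) ->
      (forall k1 k2, k1 <> 0%N -> odd k2 -> coef13 f z0 k1 k2 = 0) ->
      slice_preserving13 (qball z0 r) f /\
      ((forall J, circ J -> connected (qslice Omega J)) ->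
         slice_preserving13 Omega f)].
Proof.
split=> [x|x|K cK|c1 c2 c3].
- exact: (ball_series_cvg hz0 hball hf).
- exact: (ball_series_abs hz0 hball hf).
- exact: (ball_series_uniform hz0 hball hf).
have hc : slice_coefs (coef13 f z0) by split.
split; first exact: (preserving_ball hz0 hball hf).
by case: hOmega => _ oO _; exact: (preserving_connected hz0 hball hf hc hr oO).
Qed.
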